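(* Let $U\subseteq\mathbb{R}^{d+1}$ be open and let $H:U\to\mathbb{R}$ be a real analytic function which is not identically zero. Let $X\subseteq\mathbb{R}^d$ be a closed set such that for every $z\in\partial X$ there is a closed fat subanalytic set $X_z$ with $z\in X_z\subseteq X$. If $f\in\mathcal{C}^\infty(X)$ satisfies $(x,f(x))\in U$ and $H(x,f(x))=0$ for all $x\in X$, then $f$ extends to a holomorphic function on a neighborhood of $X$ in $\mathbb{C}^d$.
   Context: $\mathcal{C}^\infty(X)$ is the set of $f:X\to\mathbb{R}$ such that each $x\in X$ has an open neighborhood $V$ in $\mathbb{R}^d$ and a smooth $F:V\to\mathbb{R}$ with $F=f$ on $V\cap X$. A closed set $Y$ is fat if $Y=\overline{\mathrm{int}(Y)}\neq\emptyset$. Subanalytic is meant in the sense of real analytic geometry.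
   Formalization: ''H not identically zero'' is taken to mean that H does not vanish identically on any connected component of U; for disconnected U the literal statement fails when H is zero on a component containing the graph of f. *)

(* Defs.v *)
(* R^n is modelled by row vectors 'rV[R]_n (max-norm
   topology = usual topology), C^n by 'rV[R[i]]_n with R[i] = complex R. *)
From HB Require Import structures.
From mathcomp Require Import all_boot all_order all_algebra.
From mathcomp Require Import all_classical all_reals all_analysis.
From mathcomp Require Import complex.
Set Implicit Arguments. Unset Strict Implicit. Unset Printing Implicit Defensive.
Import Order.TTheory GRing.Theory Num.Theory.
Import numFieldNormedType.Exports.
Local Open Scope classical_set_scope.
Local Open Scope ring_scope.

Definition mindex (n : nat) := {ffun 'I_n -> nat}.

Definition monom (K : numFieldType) (n : nat) (a : mindex n) (y : 'rV[K]_n) : K :=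
  \prod_(i < n) (y ord0 i) ^+ (a i).

Definition abs_summable_to (K : numFieldType) (n : nat) (u : mindex n -> K) (s : K) :=
  (exists B : K, forall S : seq (mindex n), uniq S -> \sum_(a <- S) `|u a| <= B) /\
  (forall e : K, 0 < e -> exists S0 : seq (mindex n),
      forall S : seq (mindex n), uniq S -> {subset S0 <= S} ->
        `|s - \sum_(a <- S) u a| < e).

Definition analytic_at (K : numFieldType) (n : nat) (F : 'rV[K]_n -> K) (x : 'rV[K]_n) :=
  exists r : K, 0 < r /\ exists c : mindex n -> K,
    forall y : 'rV[K]_n, (forall i, `|y ord0 i - x ord0 i| < r) ->
      abs_summable_to (fun a => c a * monom a (y - x)) (F y).

Definition analytic_on (K : numFieldType) (n : nat) (D : set 'rV[K]_n) (F : 'rV[K]_n -> K) :=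
  forall x, D x -> analytic_at F x.

Definition real_analytic_on (R : realType) (n : nat) (D : set 'rV[R]_n) (F : 'rV[R]_n -> R) :=
  analytic_on D F.

Definition Cplx (R : realType) : numFieldType := (R[i] : numFieldType).

Definition holomorphic_on (R : realType) (n : nat) (W : set 'rV[Cplx R]_n)
  (G : 'rV[Cplx R]_n -> Cplx R) := analytic_on W G.

Definition cplx_of (R : realType) (r : R) : Cplx R := (r%:C)%C.
Definition cvec (R : realType) (n : nat) (x : 'rV[R]_n) : 'rV[Cplx R]_n :=
  map_mx (@cplx_of R) x.

Definition basis_vec (R : realType) (n : nat) (i : 'I_n) : 'rV[R]_n := delta_mx 0 i.

Fixpoint iter_partial (R : realType) (n : nat) (l : seq 'I_n) (F : 'rV[R]_n -> R)
  : 'rV[R]_n -> R :=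
  match l with
  | [::] => F
  | i :: l' => fun x => 'D_(basis_vec R i) (iter_partial l' F) x
  end.

Definition smooth_on (R : realType) (n : nat) (V : set 'rV[R]_n) (F : 'rV[R]_n -> R) :=
  forall (l : seq 'I_n) (x : 'rV[R]_n), V x ->
    {for x, continuous (iter_partial l F)} /\
    forall i : 'I_n, derivable (iter_partial l F) x (basis_vec R i).

Definition Cinf_on (R : realType) (n : nat) (X : set 'rV[R]_n) (f : 'rV[R]_n -> R) :=
  forall x, X x -> exists V : set 'rV[R]_n, open V /\ V x /\
    exists F : 'rV[R]_n -> R, smooth_on V F /\ (forall y, V y -> X y -> F y = f y).

Definition fat (R : realType) (n : nat) (Y : set 'rV[R]_n) :=
  closed Y /\ closure (interior Y) = Y /\ Y !=set0.

Definition boundary (R : realType) (n : nat) (X : set 'rV[R]_n) :=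
  closure X `\` interior X.

Definition semianalytic (R : realType) (N : nat) (B : set 'rV[R]_N) :=
  forall x : 'rV[R]_N, exists W : set 'rV[R]_N, open W /\ W x /\
    exists (k p q : nat) (g : 'I_k -> 'I_p -> 'rV[R]_N -> R)
           (h : 'I_k -> 'I_q -> 'rV[R]_N -> R),
      (forall j l, real_analytic_on W (g j l)) /\
      (forall j l, real_analytic_on W (h j l)) /\
      B `&` W = [set y | W y /\ exists j : 'I_k,
                   (forall l, g j l y = 0) /\ (forall l, 0 < h j l y)].

Definition subanalytic (R : realType) (n : nat) (A : set 'rV[R]_n) :=
  forall x : 'rV[R]_n, exists V : set 'rV[R]_n, open V /\ V x /\
    exists (m : nat) (B : set 'rV[R]_(n + m)),
      semianalytic B /\ compact (closure B) /\
      A `&` V = (fun z : 'rV[R]_(n + m) => lsubmx z) @` B.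

(* Main.v *)
(** Since each X_z is fat, X is contained in the closure of its interior.  At z in X let F be a smooth
local extension of f.  As H(x, F(x)) vanishes on the interior of X, which accumulates at z, the Taylor
series of F at z is a formal solution of H(x, y) = 0.  Let k be minimal such that the derivative
d^k H / dy^k is not flat along F at z.  On each line through z whose direction v is close to a fixed v0,
the series is a simple root of the (k-1)-st derivative up to a power of t, and a majorant argument
bounds its coefficients uniformly in v.  These coefficients are homogeneous polynomials in v, so
interpolation near v0 bounds the coefficients of the full series, which converges to a function phi.

Write H(x, phi(x) + s) = s^k K(x, phi(x), s).  Where F differs from phi on the interior of X, the
function K(x, phi(x), F(x) - phi(x)) vanishes.  If such points accumulated at z, all its derivatives at z
would vanish by continuity; but up to the factor k! they are those of d^k H / dy^k along F, and some of
these are nonzero.  Hence f = phi on X near z.  The local extensions are glued by the identity theorem.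

Jets are taken along lines and are defined by polynomial approximation, so that no chain rule for
higher derivatives is needed. *)
Require Import Defs.
From HB Require Import structures.
From mathcomp Require Import all_boot all_order all_algebra.
From mathcomp Require Import all_classical all_reals all_analysis.
From mathcomp Require Import complex ring lra zify.
Set Implicit Arguments. Unset Strict Implicit. Unset Printing Implicit Defensive.
Import Order.TTheory GRing.Theory Num.Theory.
Import numFieldNormedType.Exports.
Local Open Scope classical_set_scope.
Local Open Scope ring_scope.

(** * Absolutely summable families *)

(** The interior of X near z may have infinitely many components and F is only smooth, so no
    identity theorem links one component to the next: a priori F could follow different roots of
    H(x, y) = 0 on different components. Hence convergence of the Taylor series does not by itself
    give f = phi, and the quotient K is introduced. As F and phi have the same Taylor series at z,
    the difference F - phi contributes nothing to the jets of K at z, which can therefore be read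
    off from those of H.

    The majorant constants must not depend on the direction v. For this the power t^m is taken
    minimal over all directions in the open unit cube: lower coefficients vanish for every such v,
    and the coefficient of t^m, nonzero at v0, stays bounded below near v0 by continuity.
    Interpolation at equally spaced nodes then loses a factor that is geometric in the degree, which
    costs only a smaller radius of convergence.

    Series are unordered absolutely summable families over an abstract field, so that the
    rearrangements of double series are proved once for the real and the complex case. *)

Definition bounded_family (K : numFieldType) (I : choiceType) (u : I -> K) (B : K) :=
  forall S : seq I, uniq S -> \sum_(a <- S) `|u a| <= B.

(** For [I := mindex n] this is convertible with [abs_summable_to]. The arbitrary index type covers
    the double families used in rearrangements. *)
Definition sums (K : numFieldType) (I : choiceType) (u : I -> K) (s : K) :=
  (exists B : K, bounded_family u B) /\
  (forall e : K, 0 < e -> exists S0 : seq I,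
      forall S : seq I, uniq S -> {subset S0 <= S} ->
        `|s - \sum_(a <- S) u a| < e).

(** Completeness, kept as a hypothesis on [K] so that the power series lemmas apply to both the real
    and the complex numbers. *)
Definition summation_complete (K : numFieldType) :=
  forall (I : choiceType) (u : I -> K) (B : K),
    bounded_family u B -> exists s, sums u s.

Section Sums.
Variables (K : numFieldType).
Implicit Types I J : choiceType.

Lemma normr_lt_all_eq0 (x : K) : (forall e, 0 < e -> `|x| < e) -> x = 0.
Proof.
move=> h; apply/eqP; rewrite -normr_eq0; apply/negP=> /negP n0.
have p : 0 < `|x| by rewrite lt_def n0 normr_ge0.
by move: (h _ p); rewrite ltxx.
Qed.

Lemma bounded_family_le I (u v : I -> K) B :
  (forall i, `|u i| <= `|v i|) -> bounded_family v B -> bounded_family u B.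
Proof. by move=> h hv S uS; apply: le_trans (hv S uS); apply: ler_sum. Qed.

Lemma sums_uniq I (u : I -> K) s t : sums u s -> sums u t -> s = t.
Proof.
move=> [_ hs] [_ ht]; apply/eqP; rewrite -subr_eq0; apply/eqP.
apply: normr_lt_all_eq0 => e e0.
have e2 : 0 < e / 2 by rewrite divr_gt0.
have [S1 h1] := hs _ e2; have [S2 h2] := ht _ e2.
set S := undup (S1 ++ S2).
have a1 : {subset S1 <= S} by move=> x; rewrite mem_undup mem_cat => ->.
have a2 : {subset S2 <= S} by move=> x; rewrite mem_undup mem_cat => ->; rewrite orbT.
have {}h1 := h1 S (undup_uniq _) a1; have {}h2 := h2 S (undup_uniq _) a2.
rewrite [e]splitr.
have -> : s - t = (s - \sum_(a <- S) u a) - (t - \sum_(a <- S) u a) by ring.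
by apply: le_lt_trans (ler_normB _ _) _; apply: ltrD.
Qed.

Lemma eq_sums I (u v : I -> K) s : u =1 v -> sums u s -> sums v s.
Proof. by move=> /funext ->. Qed.

Lemma sums_lin I (u v : I -> K) (a s t : K) :
  sums u s -> sums v t -> sums (fun i => a * u i + v i) (a * s + t).
Proof.
move=> [[B hB] hs] [[C hC] ht]; split.
  exists (`|a| * B + C) => S uS.
  apply: (@le_trans _ _ (\sum_(i <- S) (`|a| * `|u i| + `|v i|))).
    by apply: ler_sum => i _; rewrite -normrM ler_normD.
  rewrite big_split /= -mulr_sumr; apply: lerD; last exact: hC.
  by apply: ler_wpM2l; rewrite ?normr_ge0 ?hB.
move=> e e0.
have a0 : 0 < `|a| + 1 by rewrite ltr_wpDl ?normr_ge0.
have e2 : 0 < e / 2 by rewrite divr_gt0.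
have e3 : 0 < e / 2 / (`|a| + 1) by rewrite divr_gt0.
have [S1 h1] := hs _ e3; have [S2 h2] := ht _ e2.
exists (S1 ++ S2) => S uS sub.
have {}h1 : `|s - \sum_(i <- S) u i| < e / 2 / (`|a| + 1).
  by apply: h1 => // x h; apply: sub; rewrite mem_cat h.
have {}h2 : `|t - \sum_(i <- S) v i| < e / 2.
  by apply: h2 => // x h; apply: sub; rewrite mem_cat h orbT.
rewrite big_split /= -mulr_sumr.
set x := \sum_(i <- S) u i in h1 *; set y := \sum_(i <- S) v i in h2 *.
have -> : a * s + t - (a * x + y) = a * (s - x) + (t - y) by ring.
rewrite [e]splitr; apply: le_lt_trans (ler_normD _ _) _.
apply: ler_ltD => //; rewrite normrM.
apply: (@le_trans _ _ ((`|a| + 1) * (e / 2 / (`|a| + 1)))).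
  by apply: ler_pM; rewrite ?normr_ge0 ?(ltW h1) // lerDl.
by rewrite mulrC divfK // gt_eqF.
Qed.

Lemma sums0 I : sums (fun _ : I => 0 : K) 0.
Proof.
split; first by exists 0 => S _; rewrite big1 // => i _; rewrite normr0.
by move=> e e0; exists [::] => S _ _; rewrite big1 // subr0 normr0.
Qed.

Lemma sumsZ I (u : I -> K) (a s : K) : sums u s -> sums (fun i => a * u i) (a * s).
Proof.
move=> h; have := sums_lin a h (sums0 I); rewrite addr0.
by apply: eq_sums => i; rewrite addr0.
Qed.

Lemma sumsD I (u v : I -> K) (s t : K) :
  sums u s -> sums v t -> sums (fun i => u i + v i) (s + t).
Proof.
by move=> h /(sums_lin 1 h); rewrite mul1r; apply: eq_sums => i; rewrite mul1r.
Qed.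

Lemma sumsB I (u v : I -> K) (s t : K) :
  sums u s -> sums v t -> sums (fun i => u i - v i) (s - t).
Proof.
move=> h /(sumsZ (-1)) h2; have := sumsD h h2.
by rewrite mulN1r; apply: eq_sums => i; rewrite mulN1r.
Qed.

Lemma sums_sum I (J : eqType) (T : seq J) (u : J -> I -> K) (w : J -> K) :
  (forall j, j \in T -> sums (u j) (w j)) ->
  sums (fun i => \sum_(j <- T) u j i) (\sum_(j <- T) w j).
Proof.
elim: T => [|j T IH] h.
  by rewrite big_nil; apply: eq_sums (sums0 _) => i; rewrite big_nil.
rewrite big_cons.
apply: (@eq_sums _ (fun i => u j i + \sum_(j <- T) u j i)).
  by move=> i; rewrite big_cons.
apply: sumsD; first by apply: h; rewrite mem_head.
by apply: IH => k hk; apply: h; rewrite inE hk orbT.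
Qed.

Lemma sums_finite I (u : I -> K) (S0 : seq I) :
  uniq S0 -> (forall i, i \notin S0 -> u i = 0) -> sums u (\sum_(i <- S0) u i).
Proof.
move=> uS0 h.
have E (f : I -> K) S : uniq S -> (forall i, i \notin S0 -> f i = 0) ->
    \sum_(i <- S) f i = \sum_(i <- S0 | i \in S) f i.
  move=> uS hf; rewrite (bigID (mem S0)) /= [X in _ + X]big1 ?addr0; last first.
    by move=> i; apply: hf.
  rewrite -big_filter -[RHS]big_filter; apply: perm_big; apply: uniq_perm.
  - exact: filter_uniq.
  - exact: filter_uniq.
  - by move=> i; rewrite !mem_filter andbC.
split.
  exists (\sum_(i <- S0) `|u i|) => S uS.
  rewrite E // => [|i /h ->]; last by rewrite normr0.
  rewrite [X in _ <= X](bigID (mem S)) /= lerDl; apply: sumr_ge0 => i _.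
  exact: normr_ge0.
move=> e e0; exists S0 => S uS sub.
suff -> : \sum_(i <- S) u i = \sum_(i <- S0) u i by rewrite subrr normr0.
rewrite E // big_seq_cond [RHS]big_seq; by apply: eq_bigl => i; case: (boolP (i \in S0)) => // /sub ->.
Qed.

Lemma sums_single I (u : I -> K) (i0 : I) :
  (forall i, i != i0 -> u i = 0) -> sums u (u i0).
Proof.
move=> h; have := @sums_finite _ u [:: i0] isT; rewrite big_seq1; apply=> i.
by rewrite inE; apply: h.
Qed.

Lemma sums_norm_le I (u : I -> K) s B : sums u s -> bounded_family u B -> `|s| <= B.
Proof.
move=> [_ hs] hB; rewrite -subr_le0.
(* The order of [K] may be partial; [B] is comparable with norms because the empty list gives
   [0 <= B]. *)
have rB : B \is Num.real.
  by apply: ger0_real; have := hB [::] isT; rewrite big_nil.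
case: real_leP => //; first by rewrite rpredB // normr_real.
move=> p; have [S0 h] := hs _ p.
have := h _ (undup_uniq S0); set S := undup S0.
have sub : {subset S0 <= S} by move=> x; rewrite mem_undup.
move=> /(_ sub) h1.
have h2 : `|\sum_(a <- S) u a| <= B.
  by apply: le_trans (ler_norm_sum _ _ _) (hB _ (undup_uniq _)).
have h3 : `|s| <= `|s - \sum_(a <- S) u a| + `|\sum_(a <- S) u a|.
  by rewrite -{1}[s](subrK (\sum_(a <- S) u a)) ler_normD.
have := le_lt_trans h3 (ltr_leD h1 h2).
by rewrite subrK ltxx.
Qed.

Hypothesis KC : summation_complete K.

(** Cauchy criterion: the family of norms has a sum, and the sum over [S] is the difference between
    the defects of [S0] and of [S0 ++ S], each below [e / 2]. *)
Lemma sums_tail I (u : I -> K) B (e : K) : bounded_family u B -> 0 < e ->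
  exists S0 : seq I, forall S : seq I, uniq S -> (forall i, i \in S0 -> i \notin S) ->
    \sum_(i <- S) `|u i| < e.
Proof.
move=> hB e0.
have hB' : bounded_family (fun i => `|u i|) B.
  by apply: bounded_family_le hB => i; rewrite normr_id.
have [s [_ hs]] := KC hB'.
have e2 : 0 < e / 2 by rewrite divr_gt0.
have [S0 h0] := hs _ e2.
exists S0 => S uS dis.
pose T := undup S0 ++ S.
have uT : uniq T.
  rewrite cat_uniq undup_uniq uS /= andbT; apply/hasPn => i iS.
  by rewrite /= mem_undup; apply/negP => /dis; rewrite iS.
have h1 := h0 _ (undup_uniq S0) (fun x h => etrans (mem_undup _ _) h).
have h2 : `|s - \sum_(i <- T) `|u i| | < e / 2.
  by apply: h0 => // x h; rewrite mem_cat mem_undup h.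
have -> : \sum_(i <- S) `|u i| = (s - \sum_(i <- undup S0) `|u i|) - (s - \sum_(i <- T) `|u i|).
  by rewrite big_cat /=; ring.
apply: le_lt_trans (real_ler_norm _) _.
  apply: ger0_real.
  have -> : s - \sum_(i <- undup S0) `|u i| - (s - \sum_(i <- T) `|u i|) = \sum_(i <- S) `|u i|.
    by rewrite big_cat /=; ring.
  by apply: sumr_ge0.
by rewrite [e]splitr; apply: le_lt_trans (ler_normB _ _) _; apply: ltrD.
Qed.

Lemma bounded_family_norm I (u : I -> K) B :
  bounded_family u B -> bounded_family (fun i => `|u i|) B.
Proof. by apply: bounded_family_le => i; rewrite normr_id. Qed.

Lemma sum_indic_fiber I J (p : I -> J) (x : I -> K) (T : seq J) i : uniq T ->
  \sum_(j <- T) x i *+ (p i == j) = x i *+ (p i \in T).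
Proof.
move=> uT; case: (boolP (p i \in T)) => h.
  rewrite (bigD1_seq (p i)) //= eqxx mulr1n big1 ?addr0 // => j.
  by rewrite eq_sym => /negPf ->.
rewrite mulr0n big1_seq // => j /= jT; case: eqP => // E.
by move: h; rewrite E jT.
Qed.

Lemma normrMb (x : K) (b : bool) : `|x *+ b| = `|x| *+ b.
Proof. by case: b; rewrite ?mulr0n ?normr0. Qed.

Lemma ler_mulrb (x : K) (b : bool) : 0 <= x -> x *+ b <= x.
Proof. by case: b. Qed.

(** Summation by packets. The fibre of [p] over [j] is encoded by the factor [*+ (p i == j)], which
    keeps one index type for all fibres. *)
Lemma sums_pack I J (p : I -> J) (u : I -> K) s (w : J -> K) :
  sums u s -> (forall j, sums (fun i => u i *+ (p i == j)) (w j)) -> sums w s.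
Proof.
move=> [[B hB] hs] hw.
have hf (T : seq J) : uniq T ->
    sums (fun i => u i *+ (p i \in T)) (\sum_(j <- T) w j).
  move=> uT; apply: (@eq_sums _ (fun i => \sum_(j <- T) u i *+ (p i == j))).
    by move=> i; rewrite sum_indic_fiber.
  exact: sums_sum.
split.
  exists B => T uT.
  (* The phases [th j] turn the sum of the norms of [w] into the norm of a single sum, whose terms
     are bounded by those of [u]. *)
  pose th j := `|w j| / w j.
  have thw j : th j * w j = `|w j|.
    rewrite /th; case: (eqVneq (w j) 0) => [->|n0]; first by rewrite normr0 mulr0.
    by rewrite divfK.
  have th1 j : `|th j| <= 1.
    rewrite /th normrM normfV normr_id.
    case: (eqVneq (w j) 0) => [->|n0]; first by rewrite normr0 mul0r.
    by rewrite divff // normr_eq0.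
  have h := sums_sum (fun j (_ : j \in T) => sumsZ (th j) (hw j)).
  have -> : \sum_(a <- T) `|w a| = `|\sum_(j <- T) th j * w j|.
    under [in RHS]eq_bigr do rewrite thw.
    by rewrite ger0_norm // sumr_ge0.
  apply: (sums_norm_le h); apply: bounded_family_le hB => i /=.
  have -> : \sum_(j <- T) th j * (u i *+ (p i == j)) = th (p i) * (u i *+ (p i \in T)).
    rewrite -sum_indic_fiber // mulr_sumr; apply: eq_bigr => j _.
    by case: eqP => [->|]; rewrite // mulr0n !mulr0.
  rewrite normrM normrMb -[X in _ <= X]mul1r.
  by apply: ler_pM; rewrite ?mulrn_wge0 ?normr_ge0 ?ler_mulrb.
move=> e e0; have e2 : 0 < e / 2 by rewrite divr_gt0.
(* If [T] contains the image of [S0], the error only involves indices outside [S0], where the tail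
   is below [e / 2]. *)
have [S0 h0] := sums_tail hB e2.
exists (map p S0) => T uT sub.
apply: (@le_lt_trans _ _ (e / 2)); last by rewrite ltr_pdivrMr // ltr_pMr // ltr1n.
apply: (sums_norm_le (sumsB (conj (ex_intro _ B hB) hs) (hf _ uT))).
move=> S uS /=.
have -> : \sum_(a <- S) `|u a - u a *+ (p a \in T)| =
    \sum_(a <- [seq i <- S | p i \notin T]) `|u a|.
  rewrite big_filter [RHS]big_mkcond /=; apply: eq_bigr => a _.
  by case: ifP => /=; case: (p a \in T); rewrite ?mulr1n ?mulr0n ?subrr ?subr0 ?normr0.
apply: ltW; apply: h0; first exact: filter_uniq.
move=> i iS0; rewrite mem_filter (sub (p i)) //.
by apply/mapP; exists i.
Qed.

(** [u] has some sum by completeness; packing it and the uniqueness of sums identify that sum with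
    [s]. *)
Lemma sums_unpack I J (p : I -> J) (u : I -> K) s (w : J -> K) B :
  bounded_family u B -> (forall j, sums (fun i => u i *+ (p i == j)) (w j)) ->
  sums w s -> sums u s.
Proof.
move=> hB hw ws; have [t ht] := KC hB.
by rewrite (sums_uniq ws (sums_pack ht hw)).
Qed.

(** The fibre of [g] over [j] meets the support of [u] at most in [f j], so this is packing and
    unpacking over one-point fibres. *)
Lemma sums_reindex I J (f : J -> I) (g : I -> J) (u : I -> K) B s :
  bounded_family u B -> cancel f g -> (forall i, u i != 0 -> f (g i) = i) ->
  (sums (fun j => u (f j)) s <-> sums u s).
Proof.
move=> hB fg gf.
have h j : sums (fun i => u i *+ (g i == j)) (u (f j)).
  have := @sums_single _ (fun i => u i *+ (g i == j)) (f j).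
  rewrite fg eqxx mulr1n; apply=> i ne.
  case: (eqVneq (g i) j) => [E|_]; last by rewrite mulr0n.
  apply/eqP; rewrite mulr1n; apply/negPn/negP => /gf; rewrite E => F.
  by move: ne; rewrite F eqxx.
split=> [ws|us]; first exact: sums_unpack hB h ws.
exact: sums_pack us h.
Qed.

End Sums.

(** * Completeness of the real and complex numbers *)

Lemma real_summation_complete (R : realType) : summation_complete R.
Proof.
suff pos (I : choiceType) (u : I -> R) B : (forall i, 0 <= u i) -> bounded_family u B -> exists s, sums u s.
  move=> I u B hB.
  have hn := bounded_family_norm hB.
  have [s1 h1] := pos _ _ _ (fun i => normr_ge0 (u i)) hn.
  (* [u = 2 v - |u|] combines two nonnegative families, and for these the supremum of the finite
     sums is the sum. *)
  pose v i := (`|u i| + u i) / 2.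
  have v0 i : 0 <= v i.
    rewrite /v divr_ge0 // addrC -lerBlDr sub0r; apply: lerNnormlW; exact: lexx.
  have hv : bounded_family v B.
    apply: bounded_family_le hB => i; rewrite (ger0_norm (v0 i)) /v.
    by rewrite ler_pdivrMr // mulr_natr mulr2n lerD2l ler_norm.
  have [s2 h2] := pos _ _ _ v0 hv.
  exists (2 * s2 + -1 * s1).
  have := sums_lin 2 h2 (sumsZ (-1) h1); apply: eq_sums => i.
  by rewrite /v; field.
move=> u0 hB.
pose A := [set x : R | exists S, uniq S /\ x = \sum_(i <- S) u i].
have hsup : has_sup A.
  split; first by exists 0, [::]; rewrite big_nil.
  exists B => x [S [uS ->]]; apply: le_trans (hB S uS).
  by apply: ler_sum => i _; apply: ler_norm.
exists (sup A); split; first by exists B.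
move=> e e0; have [x [S0 [uS0 xE]] hx] := sup_adherent e0 hsup.
exists S0 => S uS sub.
have h1 : \sum_(i <- S) u i <= sup A by apply: ub_le_sup; [case: hsup | exists S].
have h2 : \sum_(i <- S0) u i <= \sum_(i <- S) u i.
  rewrite [X in _ <= X](bigID (mem S0)) /= -[X in _ <= X + _]big_filter.
  have pe : perm_eq [seq i <- S | i \in S0] S0.
    apply: uniq_perm => //; first exact: filter_uniq.
    move=> i; rewrite mem_filter; case: (boolP (i \in S0)) => //= /sub //.
  by rewrite (perm_big _ pe) lerDl sumr_ge0.
rewrite ger0_norm ?subr_ge0 //.
rewrite ltrBlDl -ltrBlDr; apply: lt_le_trans hx _; by rewrite xE.
Qed.

Section Complex.
Variable R : realType.

Lemma cplx_of_sum (J : Type) (S : seq J) (v : J -> R) :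
  cplx_of (\sum_(a <- S) v a) = \sum_(a <- S) cplx_of (v a).
Proof. by rewrite /cplx_of; elim/big_rec2: _ => // i x y _ <-; rewrite -rmorphD. Qed.

Lemma cplx_of_norm (x : R) : `|cplx_of x| = cplx_of `|x|.
Proof. by rewrite /cplx_of normc_def /= expr0n /= addr0 sqrtr_sqr. Qed.

Lemma cplx_of_le (x y : R) : (cplx_of x <= cplx_of y) = (x <= y).
Proof. by rewrite /cplx_of; exact: lecR. Qed.

Lemma cplx_of_lt (x y : R) : (cplx_of x < cplx_of y) = (x < y).
Proof. by rewrite /cplx_of; exact: ltcR. Qed.

Lemma cplx_of_Re (x : Cplx R) : x \is Num.real -> cplx_of (complex.Re x) = x.
Proof. by move=> h; rewrite /cplx_of RRe_real. Qed.

Lemma sums_cplx_of (I : choiceType) (v : I -> R) s :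
  sums v s -> sums (fun i => cplx_of (v i)) (cplx_of s).
Proof.
move=> [[B hB] hs]; split.
  exists (cplx_of B) => S uS.
  under eq_bigr do rewrite cplx_of_norm.
  by rewrite -cplx_of_sum cplx_of_le hB.
move=> e e0; have eE := cplx_of_Re (gtr0_real e0); rewrite -{}eE in e0 *.
move: e0; rewrite (_ : 0 = cplx_of 0) // cplx_of_lt => /hs [S0 h].
exists S0 => S uS sub; rewrite -cplx_of_sum /cplx_of -rmorphB.
by rewrite -/(cplx_of _) cplx_of_norm cplx_of_lt h.
Qed.

Lemma complex_summation_complete : summation_complete (Cplx R).
Proof.
move=> I u B hB.
have B0 : 0 <= B by have := hB [::] isT; rewrite big_nil.
have bRe (w : I -> Cplx R) : (forall i, `|w i| <= `|u i|) ->
    bounded_family (fun i => complex.Re (w i)) (complex.Re B).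
  move=> hw S uS; have := hB S uS.
  rewrite -[X in _ <= X](cplx_of_Re (ger0_real B0)) => h.
  rewrite -cplx_of_le; apply: le_trans h; rewrite cplx_of_sum.
  by apply: ler_sum => i _; apply: le_trans (hw i); apply: normc_ge_Re.
have [s1 h1] := real_summation_complete (bRe _ (fun i => lexx _)).
(* The imaginary part of [u i] is the real part of its product with minus the imaginary unit, so
   [bRe] serves for both parts. *)
have hi : forall i, `|- (u i * 'i%C) : Cplx R| <= `|u i|.
  have n1 : `|'i%C : Cplx R| = 1 by rewrite normc_def /= expr0n expr1n add0r sqrtr1.
  by move=> i; rewrite normrN normrM n1 mulr1.
have [s2 h2] := real_summation_complete (bRe _ hi).
exists (('i%C : Cplx R) * cplx_of s2 + cplx_of s1).
have := sums_lin ('i%C : Cplx R) (sums_cplx_of h2) (sums_cplx_of h1).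
apply: eq_sums => i; rewrite /cplx_of.
have -> : complex.Re (- (u i * 'i%C)) = complex.Im (u i).
  by case: (u i) => a b /=; rewrite mulr0 mulr1 sub0r opprK.
by rewrite [RHS]complexE addrC.
Qed.

End Complex.

(** * Multi-indices and power series *)

Section BoundedFamilies.
Variables (K : numFieldType).
Implicit Types I J : choiceType.

Lemma bounded_family_fibers I J (p : I -> J) (u : I -> K) (v : J -> K) B :
  (forall j, bounded_family (fun i => u i *+ (p i == j)) (v j)) ->
  (forall T, uniq T -> \sum_(j <- T) v j <= B) -> bounded_family u B.
Proof.
move=> hu hv S uS; pose T := undup (map p S).
apply: le_trans (hv T (undup_uniq _)).
apply: (@le_trans _ _ (\sum_(j <- T) \sum_(i <- S) `|u i *+ (p i == j)|)); last first.
  by apply: ler_sum => j _; apply: hu.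
rewrite exchange_big /= big_seq [X in _ <= X]big_seq; apply: ler_sum => i iS.
under eq_bigr do rewrite normrMb.
rewrite (sum_indic_fiber p (fun i => `|u i|)) ?undup_uniq //.
by rewrite mem_undup map_f.
Qed.

Lemma bounded_family_comp I J (f : J -> I) (u : I -> K) B :
  injective f -> bounded_family u B -> bounded_family (fun j => u (f j)) B.
Proof.
move=> fi hB S uS; have := hB (map f S); rewrite big_map; apply.
by rewrite map_inj_uniq.
Qed.

Lemma bounded_family_finite I (u : I -> K) (S0 : seq I) :
  uniq S0 -> (forall i, i \notin S0 -> u i = 0) ->
  bounded_family u (\sum_(i <- S0) `|u i|).
Proof.
move=> uS0 h S uS; rewrite [X in _ <= X](bigID (mem S)) /=.
rewrite (bigID (mem S0)) /= [X in _ + X <= _]big1 ?addr0; last first.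
  by move=> i /h ->; rewrite normr0.
rewrite -big_filter -[X in _ <= X + _]big_filter.
rewrite (perm_big [seq i <- S0 | i \in S]) /=.
  by rewrite lerDl; apply: sumr_ge0.
apply: uniq_perm; rewrite ?filter_uniq // => i.
by rewrite !mem_filter andbC.
Qed.

Lemma bounded_familyZ I (u : I -> K) (a B : K) :
  bounded_family u B -> bounded_family (fun i => a * u i) (`|a| * B).
Proof.
move=> hB S uS; under eq_bigr do rewrite normrM.
by rewrite -mulr_sumr ler_wpM2l // hB.
Qed.

Lemma bounded_family_ge0 I (u : I -> K) B : bounded_family u B -> 0 <= B.
Proof. by move=> /(_ [::] isT); rewrite big_nil. Qed.

(** Nonnegative elements of [K] are comparable even if its order is partial, so the maximum exists;
    starting it at 0 covers [n = 0]. *)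
Lemma finite_max_lt n (x : 'I_n -> K) (r : K) : 0 < r -> (forall i, 0 <= x i) ->
  (forall i, x i < r) -> exists q, [/\ 0 <= q, q < r & forall i, x i <= q].
Proof.
move=> r0 x0 xr.
suff [q [q0 qr h]] : exists q, [/\ 0 <= q, q < r & forall i, i \in enum 'I_n -> x i <= q].
  by exists q; split=> // i; apply: h; rewrite mem_enum.
elim: (enum 'I_n) => [|i s [q [q0 qr h]]]; first by exists 0; split.
case: (real_leP (ger0_real (x0 i)) (ger0_real q0)) => hi.
  by exists q; split=> // j; rewrite inE => /orP [/eqP -> //|/h].
exists (x i); split=> // j; rewrite inE => /orP [/eqP -> //|/h] hj.
exact: le_trans hj (ltW hi).
Qed.

End BoundedFamilies.

Section MultiIndex.
Variable n : nat.
Implicit Types a b : mindex n.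

Definition mdeg a := (\sum_(i < n) a i)%N.

Definition mbox N : seq (mindex n) :=
  [seq [ffun i => nat_of_ord (g i)] | g : {ffun 'I_n -> 'I_N.+1}].

Definition msimplex N := [seq a <- mbox N | mdeg a <= N]%N.

Lemma mdeg_ge a i : (a i <= mdeg a)%N.
Proof. by rewrite /mdeg (bigD1 i) //= leq_addr. Qed.

Lemma mbox_uniq N : uniq (mbox N).
Proof.
rewrite /mbox map_inj_uniq ?enum_uniq // => f g /ffunP h.
by apply/ffunP => i; have := h i; rewrite !ffunE => /val_inj.
Qed.

Lemma mem_mbox N a : (a \in mbox N) = [forall i, a i <= N]%N.
Proof.
apply/mapP/forallP => [[g _ ->] i|h]; first by rewrite ffunE -ltnS.
exists [ffun i => inord (a i)]; first by rewrite mem_enum.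
by apply/ffunP => i; rewrite !ffunE inordK // ltnS.
Qed.

Lemma notin_mbox N a : a \notin mbox N -> exists i, (N < a i)%N.
Proof.
move=> h; apply: contrapT => no; case/negP: h; rewrite mem_mbox.
by apply/forallP => i; rewrite leqNgt; apply/negP => l; apply: no; exists i.
Qed.

Lemma mindex_le_or a b : (forall i, (b i <= a i)%N) \/ exists i, (a i < b i)%N.
Proof.
case: (pselect (exists i, (a i < b i)%N)) => [|no]; [by right | left => i].
by rewrite leqNgt; apply/negP => l; apply: no; exists i.
Qed.

Lemma mem_msimplex N a : (a \in msimplex N) = (mdeg a <= N)%N.
Proof.
rewrite mem_filter; case: leqP => //= h; rewrite mem_mbox.
by apply/forallP => i; apply: leq_trans (mdeg_ge a i) h.
Qed.

Lemma msimplex_uniq N : uniq (msimplex N).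
Proof. by rewrite filter_uniq // mbox_uniq. Qed.

Lemma sum_mbox (A : comPzRingType) (f : 'I_n -> nat -> A) N :
  \sum_(a <- mbox N) \prod_i f i (a i) = \prod_i \sum_(j < N.+1) f i j.
Proof.
rewrite /mbox big_map bigA_distr_bigA big_enum /=; apply: eq_bigr => g _.
by apply: eq_bigr => i _; rewrite ffunE.
Qed.

Variable K : numFieldType.
Implicit Types (c : mindex n -> K) (h k x y : 'rV[K]_n).

Lemma binomial_sum_widen (x y : K) m N : (m <= N)%N ->
  \sum_(j < N.+1) 'C(m, j)%:R * x ^+ (m - j) * y ^+ j = (x + y) ^+ m.
Proof.
move=> le; rewrite exprDn.
rewrite (big_ord_widen N.+1 (fun j => (x ^+ (m - j) * y ^+ j) *+ 'C(m, j))) ?ltnS //.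
rewrite [RHS]big_mkcond /=; apply: eq_bigr => j _; rewrite ltnS.
case: leqP => h; first by rewrite -mulrA mulr_natl.
by rewrite bin_small // !mul0r.
Qed.

Lemma monomMl (q : K) a y : monom a (q *: y) = q ^+ mdeg a * monom a y.
Proof.
rewrite /monom /mdeg -prodrXr -big_split /=; apply: eq_bigr => i _.
by rewrite mxE exprMn.
Qed.

Lemma monom_const (q : K) a : monom a (const_mx q) = q ^+ mdeg a.
Proof. by rewrite /monom /mdeg -prodrXr; apply: eq_bigr => i _; rewrite mxE. Qed.

Lemma norm_monom a y : `|monom a y| = \prod_i `|y ord0 i| ^+ a i.
Proof. by rewrite /monom normr_prod; apply: eq_bigr => i _; rewrite normrX. Qed.

Lemma norm_monom_le (q : K) a y :
  (forall i, `|y ord0 i| <= q) -> `|monom a y| <= q ^+ mdeg a.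
Proof.
move=> h; rewrite norm_monom /mdeg -prodrXr; apply: ler_prod => i _.
by rewrite exprn_ge0 // lerXn2r ?nnegrE // (le_trans _ (h i)).
Qed.

(* Convergence on the closed polydisc of radius [q]. *)
Definition poly_bounded c (q : K) :=
  exists B, bounded_family (fun a => c a * q ^+ mdeg a) B.

(** Truncated subtraction is harmless here: the binomial coefficient vanishes as soon as
    [b i > a i]. *)
Definition shift_term c h b a : K :=
  c a * \prod_i ('C(a i, b i)%:R * h ord0 i ^+ (a i - b i)).

(* The coefficients of the Taylor expansion at [h] of the power series [c]. *)
Definition shift_coef c h b : K := xget 0 [set s | sums (shift_term c h b) s].

(** The double family of the binomial expansions of [c a * monom a (h + k)]: summing over [b]
    restores the series at [h + k], summing over [a] gives its re-expansion in [k]. *)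
Definition shift_pair c h k (ab : mindex n * mindex n) : K :=
  shift_term c h ab.2 ab.1 * monom ab.2 k.

Lemma shift_pairE c h k a b : shift_pair c h k (a, b) =
  c a * \prod_i ('C(a i, b i)%:R * h ord0 i ^+ (a i - b i) * k ord0 i ^+ b i).
Proof. by rewrite /shift_pair /shift_term /= /monom -mulrA -big_split. Qed.

Lemma shift_term_eq0 c h a b i : (a i < b i)%N -> shift_term c h b a = 0.
Proof. by move=> l; rewrite /shift_term (bigD1 i) //= bin_small // !mul0r mulr0. Qed.

Lemma shift_pair_supp c h k a ab :
  ab \notin [seq (a, b) | b <- mbox (mdeg a)] -> shift_pair c h k ab *+ (ab.1 == a) = 0.
Proof.
case: ab => a' b /=; case: eqP => // -> nin; rewrite mulr1n /shift_pair /=.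
case: (boolP (b \in mbox (mdeg a))) => hb.
  by move: nin; rewrite map_f.
have [i l] := notin_mbox hb.
by rewrite (@shift_term_eq0 _ _ _ _ i) ?mul0r //; apply: leq_ltn_trans (mdeg_ge a i) l.
Qed.

Lemma sum_shift_pair c h k a :
  \sum_(ab <- [seq (a, b) | b <- mbox (mdeg a)]) shift_pair c h k ab *+ (ab.1 == a) =
  c a * monom a (h + k).
Proof.
rewrite big_map; under eq_bigr do rewrite /= eqxx mulr1n shift_pairE.
rewrite -mulr_sumr (sum_mbox (fun i j => 'C(a i, j)%:R * h ord0 i ^+ (a i - j) * k ord0 i ^+ j)).
congr (_ * _); apply: eq_bigr => i _; rewrite mxE.
by rewrite binomial_sum_widen // mdeg_ge.
Qed.

Lemma shift_pairs_uniq a : uniq [seq (a, b) | b <- mbox (mdeg a)].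
Proof. by rewrite map_inj_uniq ?mbox_uniq // => b b' []. Qed.

(** With absolute values inside, the binomial theorem sums the fibre of [a] to at most
    [|c a| * q ^+ mdeg a]. *)
Lemma shift_pair_bounded c h k (q B : K) : 0 <= q ->
  (forall i, `|h ord0 i| + `|k ord0 i| <= q) ->
  bounded_family (fun a => c a * q ^+ mdeg a) B -> bounded_family (shift_pair c h k) B.
Proof.
move=> q0 hq hB.
apply: (@bounded_family_fibers _ _ _ fst _ (fun a => `|c a| * `|monom a (\row_i (`|h ord0 i| + `|k ord0 i|))|)).
  move=> a S uS; apply: le_trans.
    by apply: (bounded_family_finite (shift_pairs_uniq a) (@shift_pair_supp c h k a)).
  have -> : \sum_(ab <- [seq (a, b) | b <- mbox (mdeg a)]) `|shift_pair c h k ab *+ (ab.1 == a)| =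
     `| c a | * monom a (map_mx Num.norm h + map_mx Num.norm k).
    rewrite -(sum_shift_pair (fun a => `|c a|)) !big_map.
    apply: eq_bigr => b _; rewrite /= eqxx !mulr1n !shift_pairE !normrM normr_prod.
    congr (_ * _); apply: eq_bigr => i _.
    by rewrite !mxE !normrM !normrX ger0_norm.
  rewrite ler_wpM2l //.
  have -> : map_mx Num.norm h + map_mx Num.norm k = \row_i (`|h ord0 i| + `|k ord0 i|).
    by apply/rowP => i; rewrite !mxE.
  apply: real_ler_norm; apply: ger0_real; apply: prodr_ge0 => i _.
  by rewrite mxE exprn_ge0 // addr_ge0.
move=> T uT; apply: le_trans (hB T uT); apply: ler_sum => a _.
rewrite normrM ler_wpM2l // [X in _ <= X]ger0_norm ?exprn_ge0 //.
by apply: norm_monom_le => i; rewrite mxE ger0_norm ?addr_ge0.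
Qed.

Hypothesis KC : summation_complete K.

(** Cauchy estimate: at [k = (e, ..., e)] the slice of the double family at [b] is this family times
    [e ^+ mdeg b]. *)
Lemma shift_term_bounded c h b (e q : K) : 0 < e -> 0 <= q ->
  (forall i, `|h ord0 i| + e <= q) -> poly_bounded c q ->
  exists B, bounded_family (shift_term c h b) B.
Proof.
move=> e0 q0 hq [B hB].
have h1 : bounded_family (shift_pair c h (const_mx e)) B.
  by apply: shift_pair_bounded hB => // i; rewrite mxE (gtr0_norm e0).
have inj : injective (fun a => (a, b)) by move=> a a' [].
have := bounded_familyZ (e ^- mdeg b) (bounded_family_comp inj h1).
move=> h2; eexists; apply: bounded_family_le h2 => a.
rewrite /shift_pair /= monom_const mulrC mulfK //.
by rewrite expf_neq0 // gt_eqF.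
Qed.

Lemma sums_shift_coef c h b (e q : K) : 0 < e -> 0 <= q ->
  (forall i, `|h ord0 i| + e <= q) -> poly_bounded c q ->
  sums (shift_term c h b) (shift_coef c h b).
Proof.
move=> e0 q0 hq hc; have [B hB] := shift_term_bounded b e0 q0 hq hc.
have [s hs] := KC hB.
exact: (@xgetI _ 0 [set s | sums (shift_term c h b) s] s hs).
Qed.

Lemma sums_shift c h k (e q s : K) : 0 < e -> 0 <= q ->
  (forall i, `|h ord0 i| + e <= q) -> (forall i, `|h ord0 i| + `|k ord0 i| <= q) ->
  poly_bounded c q ->
  sums (fun a => c a * monom a (h + k)) s ->
  sums (fun b => shift_coef c h b * monom b k) s.
Proof.
move=> e0 q0 he hk hc hs; have [B hB] := hc.
have hU := shift_pair_bounded q0 hk hB.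
have U : sums (shift_pair c h k) s.
  apply: (sums_unpack KC (p := fst) hU _ hs) => a.
  rewrite -sum_shift_pair; apply: sums_finite; first exact: shift_pairs_uniq.
  exact: shift_pair_supp.
apply: (sums_pack KC (p := snd) U) => b.
have hb : bounded_family (fun ab => shift_pair c h k ab *+ (ab.2 == b)) B.
  by apply: bounded_family_le hU => ab; rewrite normrMb ler_mulrb.
apply/(sums_reindex KC (f := fun a => (a, b)) (g := fst) _ hb) => //.
  by case=> a b' /=; case: (eqVneq b' b) => [->//|_]; rewrite mulr0n eqxx.
rewrite mulrC; apply: eq_sums (sumsZ _ (sums_shift_coef b e0 q0 he hc)) => a /=.
by rewrite eqxx mulr1n /shift_pair /= mulrC.
Qed.

(** A nonzero term with [a != b] contains some factor [h i]; replacing that factor by [e] gains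
    [q / e] against the Cauchy estimate at [(e, ..., e)]. This is what makes Taylor coefficients
    continuous in the centre. *)
Lemma shift_coef_close c b (e : K) : 0 < e -> poly_bounded c (e + e) ->
  exists C, forall h q, (forall i, `|h ord0 i| <= q) -> 0 <= q -> q <= e ->
    `|shift_coef c h b - c b| <= C * q.
Proof.
move=> e0 hc; have e2 : 0 <= e + e by rewrite addr_ge0 // ltW.
have [] := shift_term_bounded b e0 e2 (h := const_mx e) _ hc.
  by move=> i; rewrite mxE gtr0_norm.
move=> B hB; exists (B / e) => h q hq q0 qe.
have hs : sums (shift_term c h b) (shift_coef c h b).
  apply: (sums_shift_coef b e0 e2 _ hc) => i.
  by rewrite lerD2r (le_trans (hq i)).
have h1 : sums (fun a => shift_term c h b a *+ (a == b)) (c b).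
  have := @sums_single _ _ (fun a => shift_term c h b a *+ (a == b)) b.
  have -> : shift_term c h b b *+ (b == b) = c b.
    rewrite eqxx mulr1n /shift_term big1 ?mulr1 // => i _.
    by rewrite binn subnn expr0 mulr1.
  by apply=> a /negPf ->; rewrite mulr0n.
apply: (sums_norm_le (sumsB hs h1)).
have -> : B / e * q = `|q / e| * B by rewrite ger0_norm ?divr_ge0 // 1?ltW //; ring.
apply: bounded_family_le (bounded_familyZ (q / e) hB) => a.
case: (eqVneq a b) => [->|ne]; first by rewrite mulr1n subrr normr0.
rewrite mulr0n subr0 [X in _ <= X]normrM.
have [le|[i l]] := mindex_le_or a b; last first.
  by rewrite (shift_term_eq0 _ _ l) normr0 mulr_ge0.
have [i l] : exists i, (b i < a i)%N.
  have [le'|//] := mindex_le_or b a.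
  by case/eqP: ne; apply/ffunP => i; apply/eqP; rewrite eqn_leq le le'.
rewrite /shift_term !normrM mulrCA ler_wpM2l // !normr_prod.
rewrite (bigD1 i) //= [X in _ <= _ * X](bigD1 i) //= mulrA.
have hX j m : `|h ord0 j| ^+ m <= e ^+ m.
  by rewrite lerXn2r ?nnegrE // ?(ltW e0) // (le_trans (hq j)).
apply: ler_pM => //; first exact: prodr_ge0.
  rewrite mxE !normrM mulrCA ler_wpM2l // !normrX (gtr0_norm e0).
  rewrite -(subnSK l) !exprS mulrA; apply: ler_pM; rewrite ?exprn_ge0 ?normr_ge0 ?hX //.
  by rewrite (ger0_norm q0) normfV (gtr0_norm e0) divfK ?gt_eqF.
apply: ler_prod => j _; rewrite normr_ge0 /= !normrM ler_wpM2l // mxE !normrX.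
by rewrite (gtr0_norm e0).
Qed.

Definition expansion (F : 'rV[K]_n -> K) x (r : K) c :=
  forall y, (forall i, `|y ord0 i - x ord0 i| < r) ->
    sums (fun a => c a * monom a (y - x)) (F y).

Lemma expansion_poly_bounded F x (r q : K) c :
  expansion F x r c -> 0 <= q -> q < r -> poly_bounded c q.
Proof.
move=> h q0 qr; have [] := h (x + const_mx q).
  by move=> i; rewrite !mxE addrAC subrr add0r ger0_norm.
move=> [B hB] _; exists B; apply: bounded_family_le hB => a.
by rewrite addrAC subrr add0r monom_const.
Qed.

Lemma expansion_shift F x y (r q : K) c : 0 <= q -> q < r ->
  expansion F x r c -> (forall i, `|y ord0 i - x ord0 i| <= q) ->
  expansion F y (r - q) (shift_coef c (y - x)).
Proof.
move=> q0 qr hF hy u hu.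
have rq : 0 < r - q by rewrite subr_gt0.
have [p [p0 pr hp]] := finite_max_lt rq (fun i => normr_ge0 (u ord0 i - y ord0 i)) hu.
(* A midpoint: [e] exceeds the distance from [u] to [y], while [q + e] stays below [r]. *)
pose e := (p + (r - q)) / 2.
have pe : p < e by rewrite midf_lt.
have er : e < r - q by rewrite midf_lt.
have e0 : 0 < e by apply: le_lt_trans pe.
have uxE : u - x = (y - x) + (u - y) by rewrite [RHS]addrC addrA subrK.
apply: (@sums_shift c (y - x) (u - y) e (q + e)) => //.
- by rewrite addr_ge0 // ltW.
- by move=> i; rewrite !mxE lerD2r.
- by move=> i; rewrite !mxE; apply: lerD => //; rewrite (le_trans (hp i)) // ltW.
- apply: (expansion_poly_bounded hF); first by rewrite addr_ge0 // ltW.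
  by rewrite -ltrBrDl.
rewrite -uxE; apply: hF => i.
have -> : u ord0 i - x ord0 i = (y ord0 i - x ord0 i) + (u ord0 i - y ord0 i) by ring.
apply: le_lt_trans (ler_normD _ _) _.
by rewrite -[r](subrK q) [X in _ < X]addrC ler_ltD.
Qed.

End MultiIndex.

(** * Interpolation *)

Section Interpolation.
Variable R : realType.

(** Coefficientwise the product is dominated by the product of the ['X + |s k|], whose value at 1 is
    the right-hand side. *)
Lemma coef_prod_XsubC_le (I : Type) (r : seq I) (P : pred I) (s : I -> R) j :
  `|(\prod_(k <- r | P k) ('X - (s k)%:P))`_j| <= \prod_(k <- r | P k) (1 + `|s k|).
Proof.
elim: r j => [|k r IH] j; first by rewrite !big_nil coef1; case: eqP; rewrite ?normr1 ?normr0.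
rewrite !big_cons; case: ifP => // _.
rewrite mulrBl coefB coefXM mulrDl mul1r.
apply: le_trans (ler_normB _ _) _; apply: lerD.
  by case: eqP => // _; rewrite normr0 prodr_ge0 // => i _; rewrite addr_ge0.
by rewrite coefCM normrM ler_wpM2l.
Qed.

Lemma prod_dist_ord (n : nat) (i : 'I_n.+1) :
  \prod_(k < n.+1 | k != i) `|(i : nat)%:R - (k : nat)%:R : R| = (i`! * (n - i)`!)%:R.
Proof.
have ilt := ltn_ord i.
transitivity (\prod_(0 <= k < n.+1 | k != i :> nat) `|(i : nat)%:R - k%:R : R|).
  by rewrite big_mkord.
rewrite (big_cat_nat _ (n := i)) //= ?(ltnW ilt) // big_nat_cond.
rewrite [X in _ * X]big_ltn_cond // eqxx /= natrM; congr (_ * _).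
  transitivity (\prod_(0 <= k < i) (i - k)%:R : R).
    rewrite [RHS]big_nat_cond; apply: eq_big => [k|k /andP [l _]].
      by rewrite andbT; case: (boolP (k < i)%N) => //= l; rewrite neq_ltn l.
    by rewrite -natrB 1?ltnW // normr_nat.
  by rewrite -natr_prod fact_prod big_nat_rev /= add0n big_add1 /=; congr _%:R;
    apply: eq_big_nat => k /andP [_ l]; rewrite subKn.
rewrite -{1}[i.+1 : nat]add0n big_addn subSS fact_prod natr_prod big_add1 /=.
rewrite [RHS]big_nat_cond big_nat_cond; apply: eq_big => [k|k _].
  by rewrite andbT; case: (0 <= k < _)%N => //=; rewrite neq_ltn; apply/orP; right; lia.
have -> : (i : nat)%:R - (k + i.+1)%:R = - k.+1%:R :> R.
  by rewrite natrD -!natr1; ring.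
by rewrite normrN normr_nat.
Qed.

(** An elementary substitute for the Stirling formula: [n.+1 ^ n] is at most the falling factorial
    of [2 n] of length [n], that is a central binomial coefficient times [n!]. *)
Lemma expn_le_fact n : (n.+1 ^ n <= 4 ^ n * n`!)%N.
Proof.
have h1 : (n.+1 ^ n <= (n + n) ^_ n)%N.
  rewrite ffact_prod.
  have -> : (n.+1 ^ n = \prod_(i < n) n.+1)%N by rewrite prod_nat_const card_ord.
  apply: leq_prod => i _; have := ltn_ord i; lia.
apply: leq_trans h1 _; rewrite -bin_ffact leq_mul2r; apply/orP; right.
have -> : (4 ^ n = 2 ^ (n + n))%N by rewrite addnn -mul2n expnM.
rewrite -[2%N]/(1 + 1)%N expnDn.
have l : (n < (n + n).+1)%N by lia.
by rewrite (bigD1 (Ordinal l)) //= !exp1n !muln1 leq_addr.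
Qed.

Lemma leq_fact_prod (n i : nat) : (i <= n)%N -> (n`! <= 2 ^ n * (i`! * (n - i)`!))%N.
Proof.
move=> le; rewrite -(bin_fact le) leq_mul2r; apply/orP; right.
rewrite -[2%N]/(1 + 1)%N expnDn.
have l : (i < n.+1)%N by lia.
by rewrite (bigD1 (Ordinal l)) //= !exp1n !muln1 leq_addr.
Qed.

(* Equally spaced nodes: the Lagrange weights grow only geometrically in the degree. *)
Lemma interpolation_weights (n : nat) (x0 e : R) : `|x0| <= 1 -> 0 < e -> e <= 1 ->
  exists (s : 'I_n.+1 -> R) (w : 'I_n.+1 -> nat -> R),
    [/\ forall i, `|s i - x0| <= e,
        forall j l, (l <= n)%N -> \sum_i w i j * s i ^+ l = (j == l)%:R
      & forall j, \sum_i `|w i j| <= (48 / e) ^+ n].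
Proof.
move=> hx0 e0 e1.
pose sn (k : nat) : R := x0 + e * k%:R / n.+1%:R.
have sn_inj : injective sn.
  have n0 : n.+1%:R^-1 != 0 :> R by rewrite invr_eq0 pnatr_eq0.
  have e0' : e != 0 by rewrite gt_eqF.
  by move=> k l /addrI /(mulIf n0) /(mulfI e0') /eqP; rewrite eqr_nat => /eqP.
have sn_near (k : 'I_n.+1) : `|sn k - x0| <= e.
  rewrite /sn addrAC subrr add0r normrM normrM (gtr0_norm e0) normfV !normr_nat -mulrA.
  rewrite -[X in _ <= X]mulr1 ler_wpM2l ?(ltW e0) // ler_pdivrMr ?ltr0n // mul1r ler_nat.
  exact: ltnW.
pose L (i : 'I_n.+1) : {poly R} := tnth (n.+1.-lagrange sn) i.
exists (fun i => sn i), (fun i j => (L i)`_j); split=> // [j l ln|j].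
  have := @lagrange_gen _ n.+1 sn isT sn_inj 'X^l.
  rewrite size_polyXn ltnS => /(_ ln) /(congr1 (fun p : {poly R} => p`_j)).
  rewrite coefXn coef_sum => ->; apply: eq_bigr => i _.
  by rewrite coefCM hornerXn mulrC.
(* In a Lagrange polynomial the numerator has coefficients at most [3 ^+ n], as the nodes have norm
   at most 2, and the denominator is at least [(e / 8) ^+ n], with 8 = 4 * 2 from [expn_le_fact] and
   [leq_fact_prod]. This gives 24; summing over [n.+1 <= 2 ^ n] nodes turns it into 48. *)
apply: (@le_trans _ _ (\sum_(i < n.+1) (24 / e) ^+ n)); last first.
  rewrite sumr_const card_ord -[X in X <= _]mulr_natl.
  have -> : 48 / e = 2 * (24 / e) :> R by field; rewrite gt_eqF.
  rewrite [X in _ <= X]exprMn ler_wpM2r ?exprn_ge0 ?divr_ge0 ?(ltW e0) //.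
  by rewrite -natrX ler_nat ltn_expl.
apply: ler_sum => i _; rewrite /L lagrangeE //= coefCM normrM normfV.
have num : `|(\prod_(k < n.+1 | k != i) ('X - (sn k)%:P))`_j| <= 3 ^+ n.
  apply: le_trans (coef_prod_XsubC_le _ _ _ _) _.
  have -> : 3 ^+ n = \prod_(k < n.+1 | k != i) 3 :> R.
    by rewrite prodr_const cardC1 card_ord.
  apply: ler_prod => k _; rewrite addr_ge0 //=.
  have : `|sn k| <= `|sn k - x0| + `|x0| by rewrite -{1}[sn k](subrK x0) ler_normD.
  have := sn_near k; lra.
have den : (e ^+ n) / 8 ^+ n <= `|(\prod_(k < n.+1 | k != i) ('X - (sn k)%:P)).[sn i]|.
  rewrite horner_prod normr_prod.
  have -> : \prod_(k < n.+1 | k != i) `|('X - (sn k)%:P).[sn i]| =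
      (e / n.+1%:R) ^+ n * \prod_(k < n.+1 | k != i) `|(i : nat)%:R - (k : nat)%:R|.
    have -> : (e / n.+1%:R) ^+ n = \prod_(k < n.+1 | k != i) (e / n.+1%:R).
      by rewrite prodr_const cardC1 card_ord.
    rewrite -big_split /=; apply: eq_bigr => k _.
    rewrite hornerXsubC -[X in X * _]gtr0_norm ?divr_gt0 ?ltr0n // -normrM; congr `| _ |.
    have N0 : n.+1%:R != 0 :> R by rewrite pnatr_eq0.
    by rewrite /sn; move: (n.+1%:R : R) N0 => N N0; field.
  rewrite prod_dist_ord exprMn -mulrA ler_wpM2l ?exprn_ge0 ?(ltW e0) //.
  rewrite exprVn ler_pdivlMl ?exprn_gt0 ?ltr0n // ler_pdivrMr ?exprn_gt0 //.
  rewrite -!natrX -natrM ler_nat.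
  apply: leq_trans (expn_le_fact n) _.
  have iln : (i <= n)%N by rewrite -ltnS.
  apply: leq_trans (leq_mul (leqnn _) (leq_fact_prod iln)) _.
  by rewrite (_ : 8 = 4 * 2)%N // expnMn; nia.
have den0 : 0 < e ^+ n / 8 ^+ n by rewrite divr_gt0 ?exprn_gt0.
have -> : (24 / e) ^+ n = (e ^+ n / 8 ^+ n)^-1 * 3 ^+ n.
  rewrite invf_div -(_ : 8 * 3 = 24 :> R); last by ring.
  by rewrite -exprVn -!exprMn; congr (_ ^+ _); ring.
apply: ler_pM; rewrite ?invr_ge0 ?normr_ge0 //.
by rewrite lef_pV2 ?posrE //; apply: lt_le_trans den.
Qed.

(* The weights of the product grid recover each coefficient of a polynomial in
   [d] variables from its values near [v0]. *)
Lemma coef_le_of_bounded (d n : nat) (c : mindex d -> R) (v0 : 'rV[R]_d) (e A : R) :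
  (forall i, `|v0 ord0 i| <= 1) -> 0 < e -> e <= 1 ->
  (forall v : 'rV[R]_d, (forall i, `|v ord0 i - v0 ord0 i| <= e) ->
     `|\sum_(a <- msimplex d n) c a * monom a v| <= A) ->
  forall a, (mdeg a <= n)%N -> `|c a| <= A * ((48 / e) ^+ d) ^+ n.
Proof.
move=> hv0 e0 e1 hA a ha.
have W l := interpolation_weights n (hv0 l) e0 e1.
have [s W'] := choice W.
have [w hw] := choice W'.
have hs l i : `|s l i - v0 ord0 l| <= e by case: (hw l).
have hd l j m : (m <= n)%N -> \sum_i w l i j * s l i ^+ m = (j == m)%:R.
  by case: (hw l) => _ h _; apply: h.
have hb l j : \sum_i `|w l i j| <= (48 / e) ^+ n by case: (hw l).
pose pt (g : {ffun 'I_d -> 'I_n.+1}) : 'rV[R]_d := \row_l s l (g l).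
have E : c a = \sum_(g : {ffun 'I_d -> 'I_n.+1}) (\prod_l w l (g l) (a l)) *
    (\sum_(b <- msimplex d n) c b * monom b (pt g)).
  under [RHS]eq_bigr do rewrite mulr_sumr.
  rewrite exchange_big /=.
  rewrite (bigD1_seq a) ?msimplex_uniq ?mem_msimplex //= [X in _ + X]big1_seq ?addr0; last first.
    move=> b /andP [ne]; rewrite mem_msimplex => hbn.
    have -> : \sum_(g : {ffun 'I_d -> 'I_n.+1}) (\prod_l w l (g l) (a l)) * (c b * monom b (pt g)) =
       c b * \prod_l \sum_i w l i (a l) * s l i ^+ (b l).
      rewrite bigA_distr_bigA mulr_sumr; apply: eq_bigr => g _.
      rewrite mulrCA; congr (_ * _); rewrite /monom -big_split /=; apply: eq_bigr => l _.
      by rewrite mxE.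
    have [l nl] : exists l, a l != b l.
      apply: contrapT => no; case/eqP: ne; apply/ffunP => l; apply/eqP.
      by rewrite eq_sym; apply/negP => /negP h; apply: no; exists l.
    rewrite (bigD1 l) //= hd; last exact: leq_trans (mdeg_ge _ _) hbn.
    by rewrite (negPf nl) mul0r mulr0.
  have -> : \sum_(g : {ffun 'I_d -> 'I_n.+1}) (\prod_l w l (g l) (a l)) * (c a * monom a (pt g)) =
     c a * \prod_l \sum_i w l i (a l) * s l i ^+ (a l).
    rewrite bigA_distr_bigA mulr_sumr; apply: eq_bigr => g _.
    rewrite mulrCA; congr (_ * _); rewrite /monom -big_split /=; apply: eq_bigr => l _.
    by rewrite mxE.
  rewrite big1 ?mulr1 // => l _; rewrite hd ?eqxx //.
  exact: leq_trans (mdeg_ge _ _) ha.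
rewrite E; apply: le_trans (ler_norm_sum _ _ _) _.
apply: (@le_trans _ _ (\sum_(g : {ffun 'I_d -> 'I_n.+1}) (\prod_l `|w l (g l) (a l)|) * A)).
  apply: ler_sum => g _; rewrite normrM normr_prod ler_wpM2l //; first exact: prodr_ge0.
  by apply: hA => l; rewrite mxE.
rewrite -mulr_suml mulrC; apply: ler_wpM2l.
  by apply: le_trans (hA v0 _) => // i; rewrite subrr normr0 ltW.
rewrite -(bigA_distr_bigA (fun l i => `|w l i (a l)|)) -exprM mulnC exprM.
rewrite -[X in _ <= X ^+ _]/((48 / e) ^+ n) -[X in _ <= _ ^+ X]card_ord -prodr_const.
by apply: ler_prod => l _; rewrite sumr_ge0 //= hb.
Qed.

End Interpolation.

(** * The majorant argument *)

Section TruncatedNorm.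
Variable R : realFieldType.
Implicit Types (p q : {poly R}) (t : R).

(** A weighted l1 norm on polynomials modulo ['X^n.+1]. It is submultiplicative, as majorants
    require. *)
Definition tnorm t n p : R := \sum_(i < n.+1) `|p`_i| * t ^+ i.

Lemma tnorm_ge0 t n p : 0 <= t -> 0 <= tnorm t n p.
Proof. by move=> t0; apply: sumr_ge0 => i _; rewrite mulr_ge0 // exprn_ge0. Qed.

Lemma eq_tnorm t n p q :
  (forall i, (i <= n)%N -> p`_i = q`_i) -> tnorm t n p = tnorm t n q.
Proof. by move=> h; apply: eq_bigr => i _; rewrite h // -ltnS. Qed.

Lemma tnorm0 t n : tnorm t n 0 = 0.
Proof. by rewrite /tnorm big1 // => i _; rewrite coef0 normr0 mul0r. Qed.

Lemma tnormN t n p : tnorm t n (- p) = tnorm t n p.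
Proof. by apply: eq_bigr => i _; rewrite coefN normrN. Qed.

Lemma tnormD t n p q : 0 <= t -> tnorm t n (p + q) <= tnorm t n p + tnorm t n q.
Proof.
move=> t0; rewrite /tnorm -big_split; apply: ler_sum => i _ /=.
by rewrite coefD -mulrDl ler_wpM2r ?exprn_ge0 // ler_normD.
Qed.

Lemma tnormZ t n c p : tnorm t n (c *: p) = `|c| * tnorm t n p.
Proof.
by rewrite /tnorm mulr_sumr; apply: eq_bigr => i _; rewrite coefZ normrM mulrA.
Qed.

Lemma tnorm_sum t n (I : Type) (r : seq I) (F : I -> {poly R}) : 0 <= t ->
  tnorm t n (\sum_(i <- r) F i) <= \sum_(i <- r) tnorm t n (F i).
Proof.
move=> t0; elim: r => [|i r IH]; first by rewrite !big_nil tnorm0.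
by rewrite !big_cons; apply: le_trans (tnormD _ _ _ t0) _; rewrite lerD2l.
Qed.

Lemma tnorm_le t n m p : 0 <= t -> (n <= m)%N -> tnorm t n p <= tnorm t m p.
Proof.
move=> t0 le; rewrite /tnorm (big_ord_widen m.+1 (fun i => `|p`_i| * t ^+ i)) ?ltnS //.
rewrite [X in _ <= X](bigID (fun i : 'I_m.+1 => (i < n.+1)%N)) /= lerDl.
by apply: sumr_ge0 => i _; rewrite mulr_ge0 // exprn_ge0.
Qed.

Lemma tnormM t n p q : 0 <= t -> tnorm t n (p * q) <= tnorm t n p * tnorm t n q.
Proof.
move=> t0.
pose p' := \poly_(i < n.+1) `|p`_i|; pose q' := \poly_(i < n.+1) `|q`_i|.
have E (r : {poly R}) : tnorm t n r = (\poly_(i < n.+1) `|r`_i|).[t] by rewrite horner_poly.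
rewrite (E p) (E q) -hornerM -/p' -/q'.
have p'0 i : 0 <= p'`_i by rewrite coef_poly; case: ifP.
have q'0 i : 0 <= q'`_i by rewrite coef_poly; case: ifP.
have pq0 i : 0 <= (p' * q')`_i by rewrite coefM sumr_ge0 // => j _; rewrite mulr_ge0.
rewrite (@horner_coef_wide _ (size (p' * q') + n.+1)) ?leq_addr //.
rewrite /tnorm (big_ord_widen (size (p' * q') + n.+1) (fun i => `|(p * q)`_i| * t ^+ i)) ?leq_addl //.
rewrite [X in _ <= X](bigID (fun i : 'I_(size (p' * q') + n.+1) => (i < n.+1)%N)) /=.
rewrite ler_wpDr //; first by apply: sumr_ge0 => i _; rewrite mulr_ge0 // exprn_ge0.
apply: ler_sum => i li; rewrite ler_wpM2r ?exprn_ge0 // !coefM.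
apply: le_trans (ler_norm_sum _ _ _) _; apply: ler_sum => j _.
rewrite normrM !coef_poly (leq_trans (ltn_ord j)) //.
by rewrite (leq_ltn_trans (leq_subr _ _)).
Qed.

Lemma tnorm1 t n : tnorm t n 1 = 1.
Proof.
rewrite /tnorm big_ord_recl coef1 eqxx normr1 expr0 mulr1 big1 ?addr0 // => i _.
by rewrite coef1 normr0 mul0r.
Qed.

Lemma tnormX t n p k : 0 <= t -> tnorm t n (p ^+ k) <= tnorm t n p ^+ k.
Proof.
move=> t0; elim: k => [|k IH]; first by rewrite !expr0 tnorm1.
rewrite !exprS; apply: le_trans (tnormM _ _ _ t0) _.
by rewrite ler_wpM2l // tnorm_ge0.
Qed.

Lemma tnorm_XM t n p : tnorm t n.+1 ('X * p) = t * tnorm t n p.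
Proof.
rewrite /tnorm big_ord_recl coefXM /= normr0 mul0r add0r mulr_sumr.
by apply: eq_bigr => i _; rewrite coefXM /= exprS; ring.
Qed.

Lemma tnorm_XnM t n k p : tnorm t (k + n) ('X^k * p) = t ^+ k * tnorm t n p.
Proof.
elim: k => [|k IH]; first by rewrite expr0 mul1r mul1r.
by rewrite exprS -mulrA addSn tnorm_XM IH exprS mulrA.
Qed.

Lemma tnorm_XnM_le t n k p : 0 <= t -> tnorm t n ('X^k * p) <= t ^+ k * tnorm t n p.
Proof. by move=> t0; rewrite -tnorm_XnM tnorm_le // leq_addl. Qed.

Lemma coef0_XM p : p`_0 = 0 -> exists q, p = 'X * q.
Proof.
move=> p0; exists (drop_poly 1 p); rewrite -{1}[p](poly_take_drop 1) addrC mulrC expr1.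
suff -> : take_poly 1 p = 0 by rewrite addr0.
by apply/polyP => i; rewrite coef_take_poly coef0; case: i.
Qed.

Lemma low_coef_XnM k p : (forall i, (i < k)%N -> p`_i = 0) -> p = 'X^k * drop_poly k p.
Proof.
move=> h; rewrite -{1}[p](poly_take_drop k) addrC mulrC.
suff -> : take_poly k p = 0 by rewrite addr0.
by apply/polyP => i; rewrite coef_take_poly coef0; case: ifP => // /h.
Qed.

(** Every surviving term carries a factor [t], so shrinking the radius from [t0] to [t] gains
    [t / t0]. This is the source of these factors in [newton_step]. *)
Lemma tnorm_rescale t t0 n p : 0 <= t -> t <= t0 -> 0 < t0 -> p`_0 = 0 ->
  tnorm t n p <= t / t0 * tnorm t0 n p.
Proof.
move=> h0 h1 h2 p0; rewrite /tnorm !big_ord_recl p0 normr0 !mul0r !add0r mulr_sumr.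
apply: ler_sum => i _; rewrite mulrCA ler_wpM2l // !exprS mulrA divfK ?gt_eqF //.
by rewrite ler_wpM2l // lerXn2r // ?nnegrE // ltW.
Qed.

(** Without constant terms, the product up to order [n.+1] only sees the factors up to order [n].
    This is what raises the order by one in the induction of [newton_bound]. *)
Lemma tnormM_coef0 t n p q : 0 <= t -> p`_0 = 0 -> q`_0 = 0 ->
  tnorm t n.+1 (p * q) <= tnorm t n p * tnorm t n q.
Proof.
move=> t0 /coef0_XM [p1 ->] /coef0_XM [q1 ->]; rewrite -mulrA tnorm_XM.
case: n => [|n].
  rewrite /tnorm !big_ord1 !expr0 !mulr1 mulrCA !coefXM /= !normr0.
  by rewrite !mulr0.
rewrite mulrCA !tnorm_XM.
rewrite (_ : t * tnorm t n p1 * _ = t * (t * (tnorm t n p1 * tnorm t n q1))); last by ring.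
by rewrite !ler_wpM2l // tnormM.
Qed.

(* A power series in [(X, y)] truncated to a list of terms [g * X^e * y^l]. *)
Definition term := (R * nat * nat)%type.

Definition evalS (L : seq term) (y : {poly R}) : {poly R} :=
  \sum_(x <- L) x.1.1 *: ('X^(x.1.2) * y ^+ x.2).

Definition devalS (L : seq term) (y : {poly R}) : {poly R} :=
  \sum_(x <- L) (x.1.1 * x.2%:R) *: ('X^(x.1.2) * y ^+ x.2.-1).

Definition weight (L : seq term) (r : R) : R :=
  \sum_(x <- L) `|x.1.1| * r ^+ (x.1.2 + x.2).

Lemma pow_taylor2_step (A : comPzRingType) (p w a c Q : A) :
  (p * a + a * c * w + w ^+ 2 * Q) * (p + w) =
  p * (p * a) + p * a * (c + 1) * w + w ^+ 2 * (a * c + (p + w) * Q).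
Proof. ring. Qed.

Lemma pow_taylor2_term (A : comPzRingType) (g x a b k w Q : A) :
  g * (x * (a + b * k * w + w ^+ 2 * Q)) =
  g * (x * a) + g * k * (x * b) * w + w ^+ 2 * (g * (x * Q)).
Proof. ring. Qed.

(** [Q] is a polynomial in [p] and [w] with nonnegative coefficients, so the bound is the value of
    [(p + w)^l - p^l - l p^(l-1) w] at [p = w = s]. *)
Lemma pow_taylor2 (p w : {poly R}) l : exists Q,
  (p + w) ^+ l = p ^+ l + (p ^+ l.-1 *+ l) * w + w ^+ 2 * Q /\
  forall t n s, 0 <= t -> 0 <= s -> tnorm t n p <= s -> tnorm t n w <= s ->
    tnorm t n Q * s ^+ 2 <= (2 ^+ l - 1 - l%:R) * s ^+ l.
Proof.
elim: l => [|l [Q [E h]]].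
  exists 0; split; first by rewrite !expr0 mulr0n mul0r mulr0 !addr0.
  by move=> t n s *; rewrite tnorm0 mul0r !expr0 subrr sub0r oppr0 mul0r.
exists (p ^+ l.-1 *+ l + (p + w) * Q); split.
  rewrite exprSr E.
  case: l {E h} => [|l] /=; first by rewrite !expr0 ?mulr0n ?mulr1n; ring.
  rewrite -[in LHS]mulr_natr exprS pow_taylor2_step -!exprS natr1.
  by rewrite !mulr_natr.
move=> t n s t0 s0 hp hw; have {}h := h t n s t0 s0 hp hw.
have h1 : tnorm t n (p ^+ l.-1 *+ l) * s ^+ 2 <= l%:R * s ^+ l.+1.
  case: l {E h} => [|l] /=; first by rewrite mulr0n tnorm0 !mul0r.
  rewrite -scaler_nat tnormZ normr_nat -mulrA ler_wpM2l //.
  have -> : s ^+ l.+2 = s ^+ l * s ^+ 2 by rewrite -exprD addn2.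
  rewrite ler_wpM2r ?exprn_ge0 //; apply: le_trans (tnormX _ _ _ t0) _.
  by rewrite lerXn2r // nnegrE // tnorm_ge0.
have h2 : tnorm t n ((p + w) * Q) * s ^+ 2 <= (s + s) * ((2 ^+ l - 1 - l%:R) * s ^+ l).
  apply: le_trans (ler_wpM2r _ (tnormM _ _ _ t0)) _; first exact: exprn_ge0.
  rewrite -mulrA; apply: ler_pM => //; rewrite ?mulr_ge0 ?tnorm_ge0 ?exprn_ge0 //.
  by apply: le_trans (tnormD _ _ _ t0) _; apply: lerD.
have s20 : 0 <= s ^+ 2 by exact: exprn_ge0.
apply: le_trans (ler_wpM2r s20 (tnormD _ _ _ t0)) _; rewrite mulrDl.
apply: le_trans (lerD h1 h2) _; rewrite -[l.+1%:R]natr1 !exprS.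
rewrite le_eqVlt; apply/orP; left; apply/eqP; ring.
Qed.

Lemma evalS_taylor2 (L : seq term) (p w : {poly R}) : exists Q,
  evalS L (p + w) = evalS L p + devalS L p * w + w ^+ 2 * Q /\
  forall t n s r M, 0 <= t -> 0 < s -> t <= r -> s + s <= r -> weight L r <= M ->
    tnorm t n p <= s -> tnorm t n w <= s -> tnorm t n Q * s ^+ 2 <= M.
Proof.
have [Qx hQ] := choice (fun x : term => pow_taylor2 p w x.2).
exists (\sum_(x <- L) x.1.1 *: ('X^(x.1.2) * Qx x)); split.
  rewrite /evalS /devalS mulr_suml mulr_sumr -!big_split; apply: eq_bigr => x _ /=.
  rewrite (hQ x).1 -!mul_polyC polyCM polyC_natr -[in LHS]mulr_natr.
  exact: pow_taylor2_term.
move=> t n s r M t0 s0 tr sr hM hp hw; apply: le_trans hM.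
rewrite -ler_pdivlMr ?exprn_gt0 //; apply: le_trans (tnorm_sum _ _ _ t0) _.
rewrite ler_pdivlMr ?exprn_gt0 // mulr_suml; apply: ler_sum => x _.
rewrite tnormZ -mulrA ler_wpM2l //.
have r0 : 0 <= r by apply: le_trans t0 tr.
apply: le_trans (ler_wpM2r _ (tnorm_XnM_le _ _ _ t0)) _; first by rewrite exprn_ge0 // ltW.
rewrite -mulrA exprD; apply: ler_pM; rewrite ?exprn_ge0 ?mulr_ge0 ?tnorm_ge0 ?(ltW s0) //.
  by rewrite lerXn2r // nnegrE.
apply: le_trans ((hQ x).2 t n s t0 (ltW s0) hp hw) _.
apply: (@le_trans _ _ ((s + s) ^+ x.2)); last first.
  by rewrite lerXn2r // nnegrE // addr_ge0 // ltW.
have -> : s + s = 2 * s by ring.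
rewrite exprMn ler_wpM2r ?exprn_ge0 ?(ltW s0) //.
by rewrite -addrA gerDl -opprD oppr_le0 addr_ge0.
Qed.

Lemma tnorm_evalS L t n s r p : 0 <= t -> t <= r -> s <= r -> tnorm t n p <= s ->
  tnorm t n (evalS L p) <= weight L r.
Proof.
move=> t0 tr sr hp; apply: le_trans (tnorm_sum _ _ _ t0) _; apply: ler_sum => x _.
rewrite tnormZ ler_wpM2l //; apply: le_trans (tnorm_XnM_le _ _ _ t0) _.
have r0 : 0 <= r by apply: le_trans tr.
rewrite exprD; apply: ler_pM; rewrite ?exprn_ge0 ?tnorm_ge0 //.
  by rewrite lerXn2r // nnegrE.
apply: le_trans (tnormX _ _ _ t0) _; rewrite lerXn2r // ?nnegrE ?tnorm_ge0 //.
exact: le_trans sr.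
Qed.

(** Cauchy estimate for the derivative in [y]: the factor [l <= 2 ^ l] is paid for by the doubled
    radius [s + s <= r]. *)
Lemma tnorm_devalS L t n s r p : 0 <= t -> 0 < s -> t <= r -> s + s <= r ->
  tnorm t n p <= s -> tnorm t n (devalS L p) * s <= weight L r.
Proof.
move=> t0 s0 tr sr hp; rewrite -ler_pdivlMr //.
apply: le_trans (tnorm_sum _ _ _ t0) _; rewrite ler_pdivlMr // mulr_suml.
apply: ler_sum => x _; rewrite tnormZ normrM -!mulrA ler_wpM2l // normr_nat.
have r0 : 0 <= r by apply: le_trans tr.
apply: (@le_trans _ _ (x.2%:R * (t ^+ x.1.2 * tnorm t n (p ^+ x.2.-1) * s))).
  by rewrite ler_wpM2l // ler_wpM2r ?(ltW s0) // tnorm_XnM_le.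
rewrite exprD -mulrA mulrCA; apply: ler_pM; rewrite ?exprn_ge0 ?mulr_ge0 ?tnorm_ge0 ?(ltW s0) //.
  by rewrite lerXn2r // nnegrE.
case: (x.2) => [|l] /=; first by rewrite mul0r exprn_ge0.
apply: (@le_trans _ _ (2 ^+ l.+1 * s ^+ l.+1)).
  apply: ler_pM; rewrite ?mulr_ge0 ?tnorm_ge0 ?(ltW s0) //.
    by rewrite -natrX ler_nat ltnW // ltn_expl.
  rewrite exprSr ler_wpM2r ?(ltW s0) //; apply: le_trans (tnormX _ _ _ t0) _.
  by rewrite lerXn2r // ?nnegrE ?tnorm_ge0 ?(ltW s0).
by rewrite -exprMn lerXn2r // ?nnegrE ?mulr_ge0 ?(ltW s0) // mulr_natl mulr2n.
Qed.

(** Used with [w = 'X^m * u] and [u(0) = 0]: the derivatives at [p] and at the full series then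
    agree through order [m]. *)
Lemma devalS_dvd L (p w : {poly R}) : exists Z, devalS L (p + w) = devalS L p + w * Z.
Proof.
have ex x : exists Z, (p + w) ^+ (x : term).2.-1 = p ^+ x.2.-1 + w * Z.
  elim: (x.2.-1) => [|l [Z E]]; first by exists 0; rewrite !expr0 mulr0 addr0.
  by exists (p ^+ l + (p + w) * Z); rewrite !exprS E; ring.
have [Z hZ] := choice ex.
exists (\sum_(x <- L) (x.1.1 * x.2%:R) *: ('X^(x.1.2) * Z x)).
rewrite /devalS mulr_sumr -big_split; apply: eq_bigr => x _ /=.
by rewrite hZ mulrDr scalerDr -scalerAr mulrCA.
Qed.

Definition series_poly (phi : nat -> R) N : {poly R} := \poly_(i < N.+1) phi i.

(** The term of degree [m] stays in the first summand, so the cofactor of ['X^m] has no constant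
    term. The truncation order exceeds [n.+1] by [m + m] because the equation will be divided by
    ['X^(m + m)]. *)
Lemma series_poly_split (phi : nat -> R) m n :
  series_poly phi (n.+1 + (m + m)) = series_poly phi m +
    'X^m * \poly_(i < n.+2 + m) (if i == 0%N then 0 else phi (i + m)%N).
Proof.
apply/polyP => i; rewrite coefD coefXnM !coef_poly.
have [im|im] := ltnP i m.
  by rewrite addr0; have -> // : (i < m.+1)%N = (i < (n.+1 + (m + m)).+1)%N by lia.
have -> : (i - m < n.+2 + m)%N = (i < (n.+1 + (m + m)).+1)%N by lia.
rewrite subnK // subn_eq0; case: (leqP i m) => im'.
  have -> : (i < m.+1)%N by [].
  by have -> : (i < (n.+1 + (m + m)).+1)%N; rewrite ?if_same ?addr0 //; lia.
by have -> : (i < m.+1)%N = false; rewrite ?add0r // ltnS leqNgt im'.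
Qed.

(* One step of the majorant argument.  Writing phi = p + X^m u with u(0) = 0, Taylor's formula
   turns the equation into E u = - A - u^2 Q with E(0) = e0, in which the right-hand side
   up to order [n.+1] only involves the coefficients of u up to order [n]. *)
Lemma newton_step (phi : nat -> R) (L : seq term) (m n : nat) (t t0 s sg r M d : R) :
  phi 0%N = 0 ->
  (forall i, (i <= n.+1 + (m + m))%N -> (evalS L (series_poly phi (n.+1 + (m + m))))`_i = 0) ->
  (forall i, (i < m)%N -> (devalS L (series_poly phi (n.+1 + (m + m))))`_i = 0) ->
  d <= `|(devalS L (series_poly phi (n.+1 + (m + m))))`_m| ->
  0 <= t -> t <= t0 -> 0 < t0 -> t0 <= 1 -> t0 <= r -> 0 < sg -> sg + sg <= r ->
  weight L r <= M ->
  (forall k, tnorm t0 k (series_poly phi m) <= sg) ->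
  let u := \poly_(i < n.+2 + m) (if i == 0%N then 0 else phi (i + m)%N) in
  tnorm t n u <= s -> s <= sg ->
  d * tnorm t n.+1 u <=
    t / t0 * (M / t0 ^+ (m + m)) + t / t0 * (M / sg / t0 ^+ m) * s + M / sg ^+ 2 * s ^+ 2.
Proof.
move=> phi0 hG hD0 hDm t_ge0 tt0 t0_gt0 t01 t0r sg0 sgr hM hp u hu ssg.
set N := (n.+1 + (m + m))%N in hG hD0 hDm *.
set p := series_poly phi m in hp *.
have u0 : u`_0 = 0 by rewrite coef_poly.
have phiE : series_poly phi N = p + 'X^m * u by exact: series_poly_split.
have [u1 uE] := coef0_XM u0.
have [Z hZ] := devalS_dvd L p ('X^m * u).
have dlow i : (i <= m)%N -> (devalS L p)`_i = (devalS L (series_poly phi N))`_i.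
  move=> im; rewrite phiE hZ coefD uE -!mulrA coefXnM.
  case: ltnP => h; first by rewrite addr0.
  by rewrite coefXM (_ : i - m = 0)%N ?addr0 //; apply/eqP; rewrite subn_eq0.
have dE : devalS L p = 'X^m * drop_poly m (devalS L p).
  by apply: low_coef_XnM => i im; rewrite dlow ?hD0 // ltnW.
set E := drop_poly m (devalS L p) in dE.
have E0 : E`_0 = (devalS L (series_poly phi N))`_m.
  by rewrite coef_drop_poly add0n dlow.
have [Q [hQ Qb]] := evalS_taylor2 L p ('X^m * u).
have GE : evalS L (series_poly phi N) = evalS L p + 'X^(m + m) * (E * u + u * (u * Q)).
  by rewrite phiE hQ dE exprD; move: ('X^m : {poly R}) => xm; ring.
(* [E * u + u * (u * Q)] has no constant term, so [evalS L p] itself vanishes through order [m + m]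
   and its quotient [A] satisfies [A(0) = 0]. *)
have lowp i : (i <= m + m)%N -> (evalS L p)`_i = 0.
  move=> im; have := hG i; rewrite GE coefD coefXnM (leq_trans im) ?leq_addl //.
  case: ltnP => h; first by rewrite addr0 => ->.
  rewrite (_ : i - (m + m) = 0)%N; last by apply/eqP; rewrite subn_eq0.
  by rewrite coefD !coef0M u0 mulr0 mul0r !addr0 => ->.
have pE : evalS L p = 'X^(m + m) * drop_poly (m + m) (evalS L p).
  by apply: low_coef_XnM => i im; rewrite lowp // ltnW.
set A := drop_poly (m + m) (evalS L p) in pE.
have A0 : A`_0 = 0 by rewrite coef_drop_poly add0n lowp.
have eqn i : (i <= n.+1)%N -> (A + (E * u + u * (u * Q)))`_i = 0.
  move=> im; have := hG (i + (m + m))%N.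
  rewrite GE pE -mulrDr coefXnM ltnNge leq_addl /= addnK; apply.
  by rewrite /N leq_add2r.
set e0 := E`_0 in E0.
have key : tnorm t n.+1 (e0 *: u) <=
   tnorm t n.+1 A + tnorm t n.+1 ((E - e0%:P) * u) + tnorm t n.+1 (u * (u * Q)).
  rewrite (@eq_tnorm _ _ (e0 *: u) (- (A + (E - e0%:P) * u + u * (u * Q)))).
    rewrite tnormN; apply: le_trans (tnormD _ _ _ t_ge0) _.
    by rewrite lerD2r tnormD.
  move=> i im; have := eqn i im; rewrite mulrBl mul_polyC !(coefN, coefD) => h.
  apply/eqP; rewrite -subr_eq0 opprK; apply/eqP; rewrite -[RHS]h; ring.
have r0 : 0 <= r by apply: le_trans t0r; apply: ltW.
have sgr' : sg <= r by apply: le_trans sgr; rewrite lerDl ltW.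
have t01' := ltW t0_gt0.
have bA : tnorm t n.+1 A <= t / t0 * (M / t0 ^+ (m + m)).
  apply: le_trans (tnorm_rescale _ t_ge0 tt0 t0_gt0 A0) _.
  rewrite ler_wpM2l ?divr_ge0 // ler_pdivlMr ?exprn_gt0 // mulrC -tnorm_XnM -pE.
  by apply: le_trans hM; apply: tnorm_evalS (hp _).
have bE : tnorm t n (E - e0%:P) <= t / t0 * (M / sg / t0 ^+ m).
  have c0 : (E - e0%:P)`_0 = 0 by rewrite coefB coefC eqxx subrr.
  apply: le_trans (tnorm_rescale _ t_ge0 tt0 t0_gt0 c0) _.
  rewrite ler_wpM2l ?divr_ge0 //.
  apply: (@le_trans _ _ (tnorm t0 n E)).
    apply: ler_sum => i _; rewrite coefB coefC ler_wpM2r ?exprn_ge0 //.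
    by case: eqP => [->|_]; rewrite ?subr0 // subrr normr0.
  rewrite ler_pdivlMr ?exprn_gt0 // ler_pdivlMr // (mulrC (tnorm _ _ _)) -tnorm_XnM -dE.
  by apply: le_trans hM; apply: tnorm_devalS (hp _).
have x0 : 0 <= tnorm t n u by exact: tnorm_ge0.
have bEu : tnorm t n.+1 ((E - e0%:P) * u) <= t / t0 * (M / sg / t0 ^+ m) * s.
  apply: le_trans (tnormM_coef0 _ t_ge0 _ u0) _; first by rewrite coefB coefC eqxx subrr.
  by apply: ler_pM; rewrite ?tnorm_ge0.
have bp : tnorm t n p <= sg.
  apply: le_trans (hp n); apply: ler_sum => i _.
  by rewrite ler_wpM2l // lerXn2r // nnegrE.
have bw : tnorm t n ('X^m * u) <= sg.
  apply: le_trans (tnorm_XnM_le _ _ _ t_ge0) _; apply: le_trans ssg; apply: le_trans hu.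
  rewrite -[X in _ <= X]mul1r ler_wpM2r // exprn_ile1 //; exact: le_trans tt0 t01.
have bQ : tnorm t n Q <= M / sg ^+ 2.
  rewrite ler_pdivlMr ?exprn_gt0 //.
  by apply: (Qb t n sg r M) => //; apply: le_trans tt0 t0r.
have buQ : tnorm t n.+1 (u * (u * Q)) <= M / sg ^+ 2 * s ^+ 2.
  apply: le_trans (tnormM_coef0 _ t_ge0 u0 _) _; first by rewrite coef0M u0 mul0r.
  have M0 : 0 <= M / sg ^+ 2 by apply: le_trans bQ; exact: tnorm_ge0.
  apply: (@le_trans _ _ (s * (s * (M / sg ^+ 2)))); last first.
    by rewrite mulrA -expr2 mulrC.
  apply: ler_pM; rewrite ?tnorm_ge0 //; apply: le_trans (tnormM _ _ _ t_ge0) _.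
  by apply: ler_pM; rewrite ?tnorm_ge0.
apply: (@le_trans _ _ (tnorm t n.+1 (e0 *: u))).
  by rewrite tnormZ ler_wpM2r ?tnorm_ge0 // E0.
apply: le_trans key _; apply: lerD => //; exact: lerD.
Qed.

Lemma small_mult (A e : R) : 0 <= A -> 0 < e -> exists2 k, 0 < k & forall x, 0 <= x -> x <= k -> x * A <= e.
Proof.
move=> A0 e0; have A1 : 0 < A + 1 by rewrite ltr_wpDl.
exists (e / (A + 1)); first exact: divr_gt0.
move=> x x0 xe; apply: (@le_trans _ _ (e / (A + 1) * (A + 1))); last by rewrite divfK ?gt_eqF.
by apply: ler_pM => //; rewrite lerDl.
Qed.

Lemma tnorm_series_poly_le (phi : nat -> R) m (q : nat) t B : phi 0%N = 0 ->
  (forall i, (i <= m)%N -> `|phi i| <= B) -> 0 <= t -> t <= 1 ->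
  tnorm t q (series_poly phi m) <= t * (m%:R * B).
Proof.
move=> phi0 hB t0 t1.
apply: (@le_trans _ _ (tnorm t m (series_poly phi m))).
  case: (leqP q m) => h; first by rewrite tnorm_le.
  rewrite /tnorm [X in _ <= X](big_ord_widen q.+1 (fun i => `|(series_poly phi m)`_i| * t ^+ i)); last by lia.
  rewrite [X in _ <= X]big_mkcond; apply: ler_sum => i _; case: ifP => // h'.
  by rewrite coef_poly h' normr0 mul0r.
rewrite /tnorm big_ord_recl coef_poly phi0 normr0 mul0r add0r.
have -> : t * (m%:R * B) = \sum_(i < m) B * t.
  by rewrite sumr_const card_ord -mulr_natr; ring.
apply: ler_sum => i _; rewrite coef_poly lift0 ltnS ltn_ord.
apply: ler_pM; rewrite ?exprn_ge0 ?hB //.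
by rewrite exprS -[X in _ <= X]mulr1 ler_wpM2l // exprn_ile1.
Qed.

(* The bounds [t] and [s] do not depend on the series, only on the listed constants. *)
Lemma newton_bound (m : nat) (M r d B : R) : 0 < r -> 0 < d -> 0 <= M -> 0 <= B ->
  exists t s : R, [/\ 0 < t, t <= 1, 0 <= s & forall phi : nat -> R,
    phi 0%N = 0 -> (forall i, (i <= m)%N -> `|phi i| <= B) ->
    (forall N, (m <= N)%N -> exists L : seq term,
      [/\ weight L r <= M,
          forall i, (i <= N)%N -> (evalS L (series_poly phi N))`_i = 0,
          forall i, (i < m)%N -> (devalS L (series_poly phi N))`_i = 0
        & d <= `|(devalS L (series_poly phi N))`_m| ]) ->
    forall n, `|phi (n.+1 + m)%N| * t ^+ n.+1 <= s].
Proof.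
move=> r0 d0 M0 B0.
pose sg := r / 2; have sg0 : 0 < sg by rewrite divr_gt0.
have [k1 k10 hk1] := small_mult (mulr_ge0 (ler0n R m) B0) sg0.
(* [k1] makes the part of the series of degree at most [m] have norm at most [sg] at radius [t0]. *)
pose t0 := Num.min 1 (Num.min r k1).
have t00 : 0 < t0 by rewrite !lt_min ltr01 r0 k10.
have t01 : t0 <= 1 by rewrite ge_min lexx.
have t0r : t0 <= r by rewrite !ge_min lexx !orbT.
have t0k : t0 <= k1 by rewrite !ge_min lexx !orbT.
(* The three terms of [newton_step] are each brought below [d / 3 * s]: the quadratic one by the
   choice of [s], then the other two by the ratio [k = t / t0]. *)
have d3 : 0 < d / 3 by rewrite divr_gt0.
have C0 : 0 <= M / sg ^+ 2 by rewrite divr_ge0 // exprn_ge0 // ltW.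
have [k2 k20 hk2] := small_mult C0 d3.
pose s := Num.min sg k2.
have s0 : 0 < s by rewrite lt_min sg0 k20.
have ssg : s <= sg by rewrite ge_min lexx.
have sk : s <= k2 by rewrite ge_min lexx orbT.
have C1 : 0 <= M / t0 ^+ (m + m) by rewrite divr_ge0 // exprn_ge0 // ltW.
have C2 : 0 <= M / sg / t0 ^+ m by rewrite !divr_ge0 ?exprn_ge0 // ltW.
have [k3 k30 hk3] := small_mult C1 (mulr_gt0 d3 s0).
have [k4 k40 hk4] := small_mult C2 d3.
pose k := Num.min 1 (Num.min k3 k4).
have kk0 : 0 < k by rewrite !lt_min ltr01 k30 k40.
pose t := k * t0.
have t_gt0 : 0 < t by rewrite mulr_gt0.
have tt0 : t <= t0 by rewrite /t -[X in _ <= X]mul1r ler_wpM2r ?(ltW t00) // ge_min lexx.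
have ktE : t / t0 = k by rewrite /t mulfK ?gt_eqF.
exists t, s; split; rewrite ?(ltW s0) ?(le_trans tt0 t01) // => phi phi0 hB hL n.
(* The induction needs the bound on the whole partial sum, since [newton_step] takes a norm of [u]
   as input. *)
suff H j : \sum_(i < j) `|phi (i.+1 + m)%N| * t ^+ i.+1 <= s.
  apply: le_trans (H n.+1); rewrite big_ord_recr /= lerDr sumr_ge0 // => i _.
  by rewrite mulr_ge0 // exprn_ge0 // ltW.
elim: j => [|j IH]; first by rewrite big_ord0 ltW.
have [L [hM hG hD hd]] := hL (j.+1 + (m + m))%N (leq_trans (leq_addr m m) (leq_addl _ _)).
have hp (q : nat) : tnorm t0 q (series_poly phi m) <= sg.
  apply: le_trans (tnorm_series_poly_le _ phi0 hB (ltW t00) t01) _.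
  exact: hk1 (ltW t00) t0k.
have uE i : tnorm t i (\poly_(i < j.+2 + m) (if i == 0%N then 0 else phi (i + m)%N)) =
    \sum_(l < i) (if (l.+1 < j.+2 + m)%N then `|phi (l.+1 + m)%N| else 0) * t ^+ l.+1.
  rewrite /tnorm big_ord_recl coef_poly /= normr0 mul0r add0r; apply: eq_bigr => l _.
  by rewrite coef_poly /=; case: ifP; rewrite ?normr0.
have uE' i : (i <= j.+1)%N -> tnorm t i (\poly_(i < j.+2 + m) (if i == 0%N then 0 else phi (i + m)%N)) =
    \sum_(l < i) `|phi (l.+1 + m)%N| * t ^+ l.+1.
  move=> ij; rewrite uE; apply: eq_bigr => l _; have ll := ltn_ord l.
  by rewrite ltn_addr // ltnS (leq_trans ll).
have sgr : sg + sg <= r by rewrite /sg -splitr.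
have := @newton_step phi L m j t t0 s sg r M d phi0 hG hD hd (ltW t_gt0) tt0 t00 t01 t0r sg0 sgr hM hp.
rewrite /= !uE' // => /(_ IH ssg) h.
rewrite -(ler_pM2l d0); apply: le_trans h _.
rewrite ktE.
have k3k : k <= k3 by rewrite !ge_min lexx !orbT.
have k4k : k <= k4 by rewrite !ge_min lexx !orbT.
have h1 := hk3 k (ltW kk0) k3k.
have h2 := hk4 k (ltW kk0) k4k.
have h3 := hk2 s (ltW s0) sk.
have h4 : k * (M / sg / t0 ^+ m) * s <= d / 3 * s by rewrite ler_wpM2r // ltW.
have h5 : M / sg ^+ 2 * s ^+ 2 <= d / 3 * s.
  by rewrite [s ^+ 2]expr2 mulrA ler_wpM2r ?(ltW s0) // mulrC.
apply: le_trans (lerD (lerD h1 h4) h5) _.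
by rewrite le_eqVlt; apply/orP; left; apply/eqP; field.
Qed.

End TruncatedNorm.

(** * Jets *)

Section PolynomialApproximation.
Variable R : realType.
Implicit Types (f g : R -> R) (p q : {poly R}).

(** [f] equals [p] up to O(t^M), so only the coefficients of [p] below [M] are determined, by
    [appr_zero_coef]. *)
Definition appr (M : nat) f p := exists C t0 : R, 0 < t0 /\
  forall t, `|t| < t0 -> `|f t - p.[t]| <= C * `|t| ^+ M.

Lemma appr_ext M f g p :
  (exists2 t0 : R, 0 < t0 & forall t, `|t| < t0 -> f t = g t) -> appr M f p -> appr M g p.
Proof.
move=> [t1 t10 e] [C [t0 [t00 h]]]; exists C, (Num.min t0 t1).
split; first by rewrite lt_min t00.
by move=> t; rewrite lt_min => /andP [l1 l2]; rewrite -e // h.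
Qed.

Lemma appr_horner M p : appr M (fun t => p.[t]) p.
Proof. by exists 0, 1; split=> // t _; rewrite subrr normr0 mul0r. Qed.

Lemma horner_bounded p : exists C, forall t, `|t| < 1 -> `|p.[t]| <= C.
Proof.
exists (\sum_(i < size p) `|p`_i|) => t t1; rewrite horner_coef.
apply: le_trans (ler_norm_sum _ _ _) _; apply: ler_sum => i _.
rewrite normrM normrX -[X in _ <= X]mulr1 ler_wpM2l //.
by rewrite exprn_ile1 // ltW.
Qed.

Lemma apprD M f g p q : appr M f p -> appr M g q -> appr M (fun t => f t + g t) (p + q).
Proof.
move=> [C [t0 [t00 h]]] [D [t1 [t10 k]]]; exists (C + D), (Num.min t0 t1).
split; first by rewrite lt_min t00.
move=> t; rewrite lt_min => /andP [l1 l2]; rewrite hornerD mulrDl.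
have -> : f t + g t - (p.[t] + q.[t]) = (f t - p.[t]) + (g t - q.[t]) by ring.
by apply: le_trans (ler_normD _ _) _; apply: lerD; [apply: h | apply: k].
Qed.

Lemma apprM M f g p q : appr M f p -> appr M g q -> appr M (fun t => f t * g t) (p * q).
Proof.
move=> [C [t0 [t00 h]]] [D [t1 [t10 k]]].
have [P hP] := horner_bounded p; have [Q hQ] := horner_bounded q.
have C0 : 0 <= `|C| by []; have D0 : 0 <= `|D| by [].
exists (`|C| * (Q + `|D|) + P * `|D|), (Num.min 1 (Num.min t0 t1)).
split; first by rewrite !lt_min t00 t10 ltr01.
move=> t; rewrite !lt_min => /and3P [l l1 l2]; rewrite hornerM.
have -> : f t * g t - p.[t] * q.[t] =
  (f t - p.[t]) * (q.[t] + (g t - q.[t])) + p.[t] * (g t - q.[t]) by ring.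
have tM : 0 <= `|t| ^+ M <= 1 by rewrite exprn_ge0 // exprn_ile1 // ltW.
move/andP: tM => [tM0 tM1].
have h1 : `|f t - p.[t]| <= `|C| * `|t| ^+ M.
  by apply: le_trans (h _ l1) _; rewrite ler_wpM2r // ler_norm.
have h2 : `|g t - q.[t]| <= `|D| * `|t| ^+ M.
  by apply: le_trans (k _ l2) _; rewrite ler_wpM2r // ler_norm.
have h3 : `|g t - q.[t]| <= `|D|.
  by apply: le_trans h2 _; rewrite -[X in _ <= X]mulr1 ler_wpM2l.
apply: le_trans (ler_normD _ _) _; rewrite [X in _ <= X]mulrDl !normrM; apply: lerD.
  rewrite mulrAC; apply: ler_pM => //; apply: le_trans (ler_normD _ _) _.
  by apply: lerD => //; apply: hQ.
by rewrite -mulrA; apply: ler_pM => //; apply: hP.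
Qed.

Lemma apprZ M (c : R) f p : appr M f p -> appr M (fun t => c * f t) (c *: p).
Proof.
move=> h; have := apprM (appr_horner M c%:P) h; rewrite mul_polyC.
by apply: appr_ext; exists 1 => // t _; rewrite hornerC.
Qed.

Lemma apprB M f g p q : appr M f p -> appr M g q -> appr M (fun t => f t - g t) (p - q).
Proof.
move=> h1 /(apprZ (-1)) h2; have := apprD h1 h2; rewrite scaleN1r.
by apply: appr_ext; exists 1 => // t _; rewrite mulN1r.
Qed.

Lemma apprX M f p k : appr M f p -> appr M (fun t => f t ^+ k) (p ^+ k).
Proof.
move=> h; elim: k => [|k IH].
  have := appr_horner M 1; rewrite expr0.
  by apply: appr_ext; exists 1 => // t _; rewrite hornerC.
have := apprM h IH; rewrite -exprS.
by apply: appr_ext; exists 1 => // t _; rewrite exprS.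
Qed.

Lemma appr_sum M (I : Type) (r : seq I) (F : I -> R -> R) (P : I -> {poly R}) :
  (forall i, appr M (F i) (P i)) -> appr M (fun t => \sum_(i <- r) F i t) (\sum_(i <- r) P i).
Proof.
move=> h; elim: r => [|i r IH].
  have := appr_horner M 0; rewrite big_nil.
  by apply: appr_ext; exists 1 => // t _; rewrite hornerC big_nil.
rewrite big_cons; have := apprD (h i) IH.
by apply: appr_ext; exists 1 => // t _; rewrite big_cons.
Qed.

Lemma appr_prod M (I : Type) (r : seq I) (F : I -> R -> R) (P : I -> {poly R}) :
  (forall i, appr M (F i) (P i)) -> appr M (fun t => \prod_(i <- r) F i t) (\prod_(i <- r) P i).
Proof.
move=> h; elim: r => [|i r IH].
  have := appr_horner M 1; rewrite big_nil.
  by apply: appr_ext; exists 1 => // t _; rewrite hornerC big_nil.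
rewrite big_cons; have := apprM (h i) IH.
by apply: appr_ext; exists 1 => // t _; rewrite big_cons.
Qed.

Lemma appr_at0 M f p : appr M.+1 f p -> p`_0 = f 0.
Proof.
move=> [C [t0 [t00 h]]]; have := h 0; rewrite normr0 => /(_ t00).
rewrite exprS mul0r mulr0 normr_le0 subr_eq0 => /eqP ->.
by rewrite horner_coef0.
Qed.

Lemma appr_lipschitz M f p : appr M.+1 f p -> p`_0 = 0 ->
  exists C t0 : R, [/\ 0 <= C, 0 < t0 & forall t, `|t| < t0 -> `|f t| <= C * `|t|].
Proof.
move=> [C [t0 [t00 h]]] /coef0_XM [q pE].
have [Q hQ] := horner_bounded q.
have Q0 : 0 <= Q by apply: le_trans (hQ 0 _); rewrite ?normr0.
exists (Q + `|C|), (Num.min 1 t0); split; rewrite ?lt_min ?t00 ?ltr01 ?addr_ge0 //.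
move=> t; rewrite lt_min => /andP [l1 l2].
rewrite -[f t](subrK p.[t]) addrC; apply: le_trans (ler_normD _ _) _; rewrite mulrDl.
apply: lerD.
  by rewrite pE hornerM hornerX normrM mulrC ler_wpM2r // hQ.
apply: le_trans (h _ l2) _; rewrite exprS mulrCA mulrC.
apply: ler_wpM2r => //; apply: le_trans (ler_norm _) _; rewrite normrM normrX normr_id.
by rewrite -[X in _ <= X]mulr1 ler_wpM2l // exprn_ile1 // ltW.
Qed.

Lemma appr_zero_coef M p : appr M (fun=> 0) p -> forall i, (i < M)%N -> p`_i = 0.
Proof.
move=> [C [t0 [t00 h]]].
(* The point [t = 0] is dropped so that the hypothesis survives division by [t] in the induction. *)
have {h} : forall t, t != 0 -> `|t| < t0 -> `|p.[t]| <= C * `|t| ^+ M.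
  by move=> t _ /h; rewrite sub0r normrN.
elim: M p => [//|M IH] p h.
have p0 : p`_0 = 0.
  have pE : p = (p`_0)%:P + 'X * drop_poly 1 p.
    have hE : (p - (p`_0)%:P)`_0 = 0 by rewrite coefB coefC subrr.
    rewrite -[LHS](subrK (p`_0)%:P) addrC; congr (_ + _).
    rewrite [LHS](low_coef_XnM (k := 1)) ?expr1; last by case.
    by congr (_ * _); apply/polyP => i; rewrite !coef_drop_poly coefB coefC addn1 subr0.
  have [Q hQ] := horner_bounded (drop_poly 1 p).
  have Q0 : 0 <= Q by apply: le_trans (hQ 0 _); rewrite ?normr0.
  have C0 : 0 <= `|C| by [].
  apply: normr_lt_all_eq0 => e e0.
  have D0 : 0 < `|C| + Q + 1 by rewrite ltr_wpDl // addr_ge0.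
  pose m := Num.min (Num.min 1 t0) (e / (`|C| + Q + 1)).
  have m0 : 0 < m by rewrite !lt_min ltr01 t00 divr_gt0.
  pose t := m / 2.
  have tp : 0 < t by rewrite divr_gt0.
  have tm : t < m by rewrite /t ltr_pdivrMr // ltr_pMr // ltr1n.
  move: tm; rewrite !lt_min => /andP [/andP [t1 tt0] te].
  have tn : `|t| = t by rewrite gtr0_norm.
  have := h t; rewrite tn gt_eqF // => /(_ isT tt0).
  rewrite {1}pE hornerD hornerC hornerM hornerX => h1.
  have h2 : `|(drop_poly 1 p).[t]| <= Q by apply: hQ; rewrite tn.
  have h3 : C * t ^+ M.+1 <= `|C| * t.
    apply: (@le_trans _ _ (`|C| * t ^+ M.+1)).
      by rewrite ler_wpM2r ?exprn_ge0 ?(ltW tp) // ler_norm.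
    rewrite ler_wpM2l // exprS -[X in _ <= X]mulr1 ler_wpM2l ?(ltW tp) // exprn_ile1 // ltW //.
  have h4 : `|p`_0| <= `|p`_0 + t * (drop_poly 1 p).[t]| + `|t * (drop_poly 1 p).[t]|.
    by rewrite -{1}[p`_0](addrK (t * (drop_poly 1 p).[t])) ler_normB.
  apply: (@le_lt_trans _ _ (`|C| * t + t * Q)).
    apply: le_trans h4 _; apply: lerD; first exact: le_trans h1 h3.
    by rewrite normrM tn ler_wpM2l // ltW.
  apply: (@le_lt_trans _ _ ((`|C| + Q + 1) * t)).
    by rewrite !mulrDl mul1r (mulrC Q) lerDl ltW.
  by rewrite mulrC -ltr_pdivlMr.
have [q pE] := coef0_XM p0.
case=> [//|i]; rewrite ltnS pE coefXM /=; apply: IH => t tn0 tl.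
have := h t tn0 tl; rewrite pE hornerM hornerX normrM exprS mulrCA.
by rewrite ler_pM2l // normr_gt0.
Qed.

Lemma mvt_zero (f df : R -> R) (h : R) :
  (forall t : R, `|t| <= `|h| -> is_derive t 1 f (df t)) ->
  exists2 c, `|c| <= `|h| & f h - f 0 = df c * h.
Proof.
move=> hf; have [h0|h0] := leP 0 h.
  have D (t : R) : t \in `[0, h] -> is_derive t 1 f (df t).
    by rewrite in_itv /= => /andP [l1 l2]; apply: hf; rewrite !ger0_norm.
  have D' (t : R) : t \in `]0, h[ -> is_derive t 1 f (df t).
    by move=> ht; apply: D; apply: subset_itv_oo_cc.
  have C : {within `[0, h], continuous f}.
    by apply: derivable_within_continuous => t ht; case: (D t ht).
  have [c] := MVT_segment h0 D' C.
  rewrite in_itv /= => /andP [c0 ch] ->; exists c; rewrite ?subr0 //.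
  by rewrite !ger0_norm.
have D (t : R) : t \in `[h, 0] -> is_derive t 1 f (df t).
  by rewrite in_itv /= => /andP [l1 l2]; apply: hf; rewrite !ler0_norm ?lerN2 // ltW.
have D' (t : R) : t \in `]h, 0[ -> is_derive t 1 f (df t).
  by move=> ht; apply: D; apply: subset_itv_oo_cc.
have C : {within `[h, 0], continuous f}.
  by apply: derivable_within_continuous => t ht; case: (D t ht).
have [c] := MVT_segment (ltW h0) D' C.
rewrite in_itv /= => /andP [c0 ch] E; exists c.
  by rewrite !ler0_norm ?lerN2 // ltW.
by rewrite -[LHS]opprB E; ring.
Qed.

Lemma is_derive_horner p (t : R) : is_derive t 1 (fun t => p.[t]) (p^`()).[t].
Proof.
elim/poly_ind: p => [|p c IH].
  have -> : (fun t : R => (0 : {poly R}).[t]) = cst 0 by apply/funext => x; rewrite hornerC.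
  by rewrite deriv0 hornerC; exact: is_derive_cst.
have -> : (fun t : R => (p * 'X + c%:P).[t]) = (fun t => p.[t] * t + c).
  by apply/funext => x; rewrite hornerD hornerM hornerX hornerC.
rewrite derivD derivC addr0 derivM derivX mulr1 !hornerE.
have h : is_derive t 1 (fun t => p.[t] * t) (p.[t] *: 1 + t *: (p^`()).[t]).
  exact: is_deriveM.
apply: is_derive_eq (is_deriveD h (is_derive_cst c t 1)) _.
by rewrite /GRing.scale /=; ring.
Qed.

(** The successive derivatives form a sequence [g], to be filled with directional derivatives. The
    mean value theorem applies to [g 0] minus its polynomial, whose derivative is the same error for
    the shifted sequence. *)
Lemma taylor_appr M (g : nat -> R -> R) :
  (exists2 t0 : R, 0 < t0 & forall n (t : R), `|t| < t0 -> is_derive t 1 (g n) (g n.+1 t)) ->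
  appr M (g 0%N) (\poly_(n < M) (g n 0 / n`!%:R)).
Proof.
elim: M g => [|M IH] g [t0 t00 hg].
  have D : derivable (g 0%N) 0 1 by case: (hg 0%N 0); rewrite ?normr0.
  have /cvgrPdist_lt /(_ 1 ltr01) : {for 0, continuous (g 0%N)}.
    by apply: differentiable_continuous; apply/derivable1_diffP.
  rewrite near_simpl => /nbhs_ballP [r /= r0 hr].
  exists (`|g 0%N 0| + 1), r; split=> // t tr.
  rewrite poly_def big_ord0 hornerC subr0 expr0 mulr1.
  have /ltW : `|g 0%N 0 - g 0%N t| < 1.
    by apply: hr; rewrite /ball /= sub0r normrN.
  move=> h; rewrite -[g 0%N t](subKr (g 0%N 0)); apply: le_trans (ler_normB _ _) _.
  by rewrite lerD2l.
have [C [t1 [t10 h]]] := IH (fun n => g n.+1) (ex_intro2 _ _ t0 t00 (fun n => hg n.+1)).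
exists `|C|, (Num.min t0 t1); split; first by rewrite lt_min t00.
move=> t; rewrite lt_min => /andP [l0 l1].
set p := \poly_(n < M.+1) _; pose q := \poly_(n < M) (g n.+1 0 / n`!%:R).
have dp : p^`() = q.
  apply/polyP => i; rewrite coef_deriv !coef_poly ltnS; case: ifP => // _; last by rewrite mul0rn.
  rewrite -[LHS]mulr_natr factS natrM invfM -mulrA; congr (_ * _).
  by rewrite mulrAC mulVf ?mul1r // pnatr_eq0.
have D (s : R) : `|s| <= `|t| -> is_derive s 1 (fun t => g 0%N t - p.[t]) (g 1%N s - q.[s]).
  move=> st; rewrite -dp.
  exact: (is_deriveB (hg 0%N s (le_lt_trans st l0)) (is_derive_horner p s)).
have [c ct E] := mvt_zero D.
have E0 : g 0%N 0 - p.[0] = 0.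
  by rewrite horner_coef0 coef_poly /= fact0 divr1 subrr.
rewrite E0 subr0 in E; rewrite E normrM exprSr mulrA ler_wpM2r //.
apply: le_trans (h c (le_lt_trans ct l1)) _.
apply: (@le_trans _ _ (`|C| * `|c| ^+ M)); first by rewrite ler_wpM2r ?exprn_ge0 // ler_norm.
by rewrite ler_wpM2l // lerXn2r // nnegrE.
Qed.

End PolynomialApproximation.

(** * Coordinate neighbourhoods and derivatives along lines *)

Lemma nbhs_boxP (K : numFieldType) (n : nat) (x : 'rV[K]_n) (P : set 'rV[K]_n) :
  nbhs x P <-> exists2 r : K, 0 < r &
    forall y : 'rV[K]_n, (forall i, `|y ord0 i - x ord0 i| < r) -> P y.
Proof.
split=> [/nbhs_ballP [r /= r0 h]|[r r0 h]].
  exists r => // y hy; apply: h; split=> // i j.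
  by rewrite (ord1 i) /ball /= distrC.
apply/nbhs_ballP; exists r => // y [_ hy]; apply: h => i.
by have := hy ord0 i; rewrite /ball /= distrC.
Qed.

Section DirectionalDerivatives.
Variables (R : realType) (d : nat).
Implicit Types (g F : 'rV[R]_d -> R) (x v w z : 'rV[R]_d) (V : set 'rV[R]_d).

Lemma is_derive_line g w v (t : R) (D : R) : is_derive (w + t *: v) v g D ->
  is_derive t 1 (fun t => g (w + t *: v)) D.
Proof.
move=> [hd hD].
have E : (fun h : R => h^-1 *: (((fun t => g (w + t *: v)) \o shift t) (h *: 1) - g (w + t *: v))) =
         (fun h : R => h^-1 *: ((g \o shift (w + t *: v)) (h *: v) - g (w + t *: v))).
  apply/funext => h /=; congr (_ *: (g _ - _)).
  by rewrite [h *: 1]mulr1 scalerDl addrCA.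
by split; [rewrite /derivable E | rewrite /derive E].
Qed.

(** The coordinates listed in [s] are moved one at a time; the mean value theorem on each edge and
    the continuity of the partial derivatives at [x] give the first-order error. *)
Lemma line_increment g V x v (s : seq 'I_d) : open V -> V x ->
  (forall y i, V y -> derivable g y (basis_vec R i)) ->
  (forall i, {for x, continuous (fun y => 'D_(basis_vec R i) g y)}) ->
  forall e : R, 0 < e -> exists2 r : R, 0 < r & forall h : R, `|h| < r ->
    `|g (x + h *: \sum_(i <- s) v ord0 i *: basis_vec R i) - g x -
      h * \sum_(i <- s) v ord0 i * 'D_(basis_vec R i) g x| <= e * `|h|.
Proof.
move=> oV Vx hd hc; elim: s => [|i s IH] e e0.
  exists 1 => // h _; rewrite !big_nil scaler0 addr0 subrr mulr0 subr0 normr0.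
  by rewrite mulr_ge0 // ltW.
have e2 : 0 < e / 2 by rewrite divr_gt0.
have [r1 r10 h1] := IH _ e2.
set vs := \sum_(i <- s) v ord0 i *: basis_vec R i in h1 *.
set ds := \sum_(i <- s) v ord0 i * 'D_(basis_vec R i) g x in h1 *.
pose c := v ord0 i.
have c1 : 0 < `|c| + 1 by rewrite ltr_wpDl.
pose e' := e / 2 / (`|c| + 1).
have e'0 : 0 < e' by rewrite divr_gt0.
have /cvgrPdist_lt /(_ e' e'0) N1 := hc i.
have N2 : nbhs x V by apply: open_nbhs_nbhs.
have N : nbhs x [set y | `|'D_(basis_vec R i) g x - 'D_(basis_vec R i) g y| < e' /\ V y].
  by apply: filterI.
have {N} [r2 r20 h2] := (nbhs_boxP _ _).1 N.
(* [A] bounds the coordinates of [vs], so that for small [h] the new edge stays in the box of radius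
   [r2]. *)
pose A := \sum_(j < d) `|vs ord0 j|.
have A0 : 0 <= A by apply: sumr_ge0.
have B0 : 0 < A + `|c| + 1 by rewrite ltr_wpDl // addr_ge0.
exists (Num.min r1 (r2 / (A + `|c| + 1))); first by rewrite lt_min r10 divr_gt0.
move=> h; rewrite lt_min => /andP [l1 l2].
pose y := x + h *: vs.
have box (t : R) : `|t| <= `|h * c| -> forall j, `|(y + t *: basis_vec R i) ord0 j - x ord0 j| < r2.
  move=> ht j; rewrite !mxE addrAC [x _ _ + _]addrC addrK.
  have b2 : `|t * ((ord0 == 0 :> 'I_1) && (j == i))%:R| <= `|h| * `|c|.
    apply: (@le_trans _ _ `|t|); last by rewrite -normrM.
    rewrite normrM -[X in _ <= X]mulr1 ler_wpM2l //.
    by case: (_ && _); rewrite ?normr1 ?normr0.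
  have b3 : `|vs ord0 j| <= A.
    by rewrite /A (bigD1 j) //= lerDl sumr_ge0.
  apply: le_lt_trans (ler_normD _ _) _; rewrite normrM.
  apply: (@le_lt_trans _ _ (`|h| * (A + `|c| + 1))).
    rewrite !mulrDr mulr1 -addrA; apply: lerD; first by rewrite ler_wpM2l.
    by rewrite ler_wpDr.
  by rewrite -ltr_pdivlMr.
have D (t : R) : `|t| <= `|h * c| -> is_derive t 1 (fun t => g (y + t *: basis_vec R i))
    ('D_(basis_vec R i) g (y + t *: basis_vec R i)).
  move=> ht; apply: is_derive_line; apply: derivableP; apply: hd.
  by have [] := h2 _ (box t ht).
have [th hth E] := mvt_zero D.
rewrite !big_cons scalerDr scalerA.
have -> : x + (h * c *: basis_vec R i + h *: vs) = y + (h * c) *: basis_vec R i.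
  by rewrite /y -addrA [h *: vs + _]addrC.
rewrite scale0r addr0 in E.
have -> : g (y + (h * c) *: basis_vec R i) - g x -
     h * (c * 'D_(basis_vec R i) g x + ds) =
   (g y - g x - h * ds) + (h * c) * ('D_(basis_vec R i) g (y + th *: basis_vec R i) - 'D_(basis_vec R i) g x).
  by rewrite -[g (y + _)](subrK (g y)) E; ring.
rewrite [e in X in _ <= X]splitr mulrDl; apply: le_trans (ler_normD _ _) _.
apply: lerD; first exact: h1.
have [h3 _] := h2 _ (box th hth).
rewrite !normrM distrC mulrC [`|h| * _]mulrC mulrA ler_wpM2r //.
apply: (@le_trans _ _ (e' * `|c|)).
  by rewrite ler_wpM2r //; move: h3; rewrite /= => /ltW.
rewrite /e' -mulrA -[X in _ <= X]mulr1 ler_wpM2l ?(ltW e2) //.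
by rewrite mulrC ler_pdivrMr // mul1r lerDl.
Qed.

Lemma is_derive_partials g V x v : open V -> V x ->
  (forall y i, V y -> derivable g y (basis_vec R i)) ->
  (forall i, {for x, continuous (fun y => 'D_(basis_vec R i) g y)}) ->
  is_derive x v g (\sum_i v ord0 i * 'D_(basis_vec R i) g x).
Proof.
move=> oV Vx hd hc; set L := \sum_i _.
have vE : v = \sum_(i <- index_enum 'I_d) v ord0 i *: basis_vec R i.
  rewrite [LHS]row_sum_delta; apply: eq_bigr => i _; congr (_ *: _).
have C : (fun h : R => h^-1 *: ((g \o shift x) (h *: v) - g x)) @ 0^' --> (L : R).
  apply/cvgrPdist_le => e e0.
  have [r r0 hr] := line_increment v (index_enum 'I_d) oV Vx hd hc e0.
  rewrite -vE in hr.
  apply/nbhs_ballP; exists r => //= h; rewrite /ball /= sub0r normrN => hr1 hn0.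
  have := hr h hr1; rewrite -/L => k.
  rewrite distrC -[L](mulKf hn0) [_ *: _]/(_ * _) -mulrBr normrM normfV.
  rewrite ler_pdivrMl ?normr_gt0 // [X in _ <= X]mulrC; apply: le_trans k.
  by rewrite [h *: v + x]addrC.
split; first by apply/cvg_ex; exists L.
by apply: cvg_lim.
Qed.

Fixpoint words (n : nat) : seq (seq 'I_d) :=
  if n is m.+1 then [seq i :: l | i <- index_enum 'I_d, l <- words m] else [:: [::]].

(** The derivative of order [n] along [v], expanded over ordered words to match [iter_partial]. *)
Definition dirD v (n : nat) F w : R :=
  \sum_(l <- words n) (\prod_(i <- l) v ord0 i) * iter_partial l F w.

Lemma is_derive_bigsum (I : Type) (r : seq I) (f df : I -> R -> R) (t : R) :
  (forall i, is_derive t 1 (f i) (df i t)) ->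
  is_derive t 1 (fun t => \sum_(i <- r) f i t) (\sum_(i <- r) df i t).
Proof.
move=> h; elim: r => [|i r IH].
  have -> : (fun t => \sum_(i <- [::]) f i t) = cst 0 by apply/funext => s; rewrite big_nil.
  by rewrite big_nil; exact: is_derive_cst.
have -> : (fun t => \sum_(i <- i :: r) f i t) = (fun t => f i t + \sum_(i <- r) f i t).
  by apply/funext => s; rewrite big_cons.
by rewrite big_cons; exact: is_deriveD.
Qed.

Lemma is_derive_dirD V F v n w (t : R) : open V -> smooth_on V F -> V (w + t *: v) ->
  is_derive t 1 (fun t => dirD v n F (w + t *: v)) (dirD v n.+1 F (w + t *: v)).
Proof.
move=> oV sF Vw.
have -> : dirD v n.+1 F (w + t *: v) = \sum_(l <- words n) (\prod_(i <- l) v ord0 i) *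
   (\sum_i v ord0 i * 'D_(basis_vec R i) (iter_partial l F) (w + t *: v)).
  rewrite /dirD /= big_allpairs_dep exchange_big /=; apply: eq_bigr => l _.
  by rewrite mulr_sumr; apply: eq_bigr => i _; rewrite big_cons /=; ring.
apply: (is_derive_bigsum _ (f := fun l t => (\prod_(i <- l) v ord0 i) * iter_partial l F (w + t *: v))
  (df := fun l t => (\prod_(i <- l) v ord0 i) * (\sum_i v ord0 i * 'D_(basis_vec R i) (iter_partial l F) (w + t *: v)))).
move=> l; apply: is_deriveZ; apply: is_derive_line.
apply: (is_derive_partials v oV Vw) => [y i /(sF l) []//|i].
by have [] := sF (i :: l) _ Vw.
Qed.

Definition mcount (l : seq 'I_d) : mindex d := [ffun i => count_mem i l].

Lemma mcountE l i : mcount l i = count_mem i l.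
Proof. by rewrite ffunE. Qed.

Lemma mdeg_mcount l : mdeg (mcount l) = size l.
Proof.
rewrite /mdeg (eq_bigr (fun i => count_mem i l)); last by move=> i _; exact: mcountE.
elim: l => [|j l IH] /=; first by rewrite big1.
rewrite big_split /= IH (bigD1 j) //= eqxx big1 // => i /negPf ne.
by rewrite eq_sym ne.
Qed.

Lemma monom_mcount l v : monom (mcount l) v = \prod_(i <- l) v ord0 i.
Proof.
transitivity (\prod_(i < d) v ord0 i ^+ count_mem i l).
  by apply: eq_bigr => i _; rewrite mcountE.
elim: l => [|j l IH] /=; first by rewrite big_nil big1.
under eq_bigr do rewrite exprD.
rewrite big_split /= IH big_cons (bigD1 j) //= eqxx expr1 big1 ?mulr1 // => i /negPf ne.
by rewrite eq_sym ne.
Qed.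

Lemma size_words n l : l \in words n -> size l = n.
Proof.
elim: n l => [|n IH] l /=; first by rewrite inE => /eqP ->.
by move=> /allpairsP [[i l'] /= [_ /IH h ->]] /=; rewrite h.
Qed.

(** When mixed partials commute this is the usual Taylor coefficient, the derivative of index [a]
    over [a!], since [|a|! / a!] words have content [a]. *)
Definition taylor_coef F z (a : mindex d) : R :=
  (\sum_(l <- words (mdeg a) | mcount l == a) iter_partial l F z) / (mdeg a)`!%:R.

Lemma dirD_taylor F z v n : dirD v n F z / n`!%:R =
  \sum_(a <- msimplex d n | mdeg a == n) taylor_coef F z a * monom a v.
Proof.
have E : dirD v n F z = \sum_(a <- msimplex d n) \sum_(l <- words n)
    (monom a v * iter_partial l F z) *+ (mcount l == a).
  rewrite exchange_big /dirD /=; rewrite big_seq [RHS]big_seq; apply: eq_bigr => l hl.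
  rewrite (bigD1_seq (mcount l)) ?msimplex_uniq //=; last first.
    by rewrite mem_msimplex mdeg_mcount (size_words hl).
  rewrite eqxx mulr1n monom_mcount [X in _ + X]big1 ?addr0 // => a.
  by rewrite eq_sym => /negPf ->.
rewrite E mulr_suml [RHS]big_mkcond; apply: eq_bigr => a _.
case: eqP => [ha|na]; last first.
  rewrite big1_seq ?mul0r // => l /= hl; case: eqP => // la.
  by case: na; rewrite -la mdeg_mcount (size_words hl).
rewrite /taylor_coef ha mulrAC; congr (_ / _).
rewrite mulr_suml [RHS]big_mkcond; apply: eq_bigr => l _.
by case: eqP => // _; rewrite mulr1n mulrC.
Qed.

End DirectionalDerivatives.

(** * Jets along lines and composition with analytic functions *)

Section Jets.
Variable R : realType.

(** Terms of degree above [N] gain at least [(s / q) ^+ N.+1] over the bound at radius [q]. *)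
Lemma expansion_tail n (F : 'rV[R]_n -> R) x (r q : R) c (N : nat) :
  expansion F x r c -> 0 < q -> q < r -> exists2 C : R, 0 <= C &
    forall (y : 'rV[R]_n) (s : R), (forall i, `|y ord0 i - x ord0 i| <= s) -> 0 <= s -> s <= q ->
    `|F y - \sum_(a <- msimplex n N) c a * monom a (y - x)| <= C * s ^+ N.+1.
Proof.
move=> hF q0 qr; have [B hB] := expansion_poly_bounded hF (ltW q0) qr.
have B0 := bounded_family_ge0 hB.
exists (B / q ^+ N.+1); first by rewrite divr_ge0 // exprn_ge0 // ltW.
move=> y s hy s0 sq.
have h1 : sums (fun a => c a * monom a (y - x)) (F y).
  by apply: hF => i; apply: le_lt_trans (hy i) _; apply: le_lt_trans sq qr.
pose u a := (c a * monom a (y - x)) *+ (a \in msimplex n N).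
have h2 : sums u (\sum_(a <- msimplex n N) c a * monom a (y - x)).
  have -> : \sum_(a <- msimplex n N) c a * monom a (y - x) = \sum_(a <- msimplex n N) u a.
    by rewrite big_seq [RHS]big_seq; apply: eq_bigr => a ha; rewrite /u ha mulr1n.
  by apply: sums_finite; rewrite ?msimplex_uniq // => a /negPf h; rewrite /u h.
apply: (sums_norm_le (sumsB h1 h2)).
have -> : B / q ^+ N.+1 * s ^+ N.+1 = `|(s / q) ^+ N.+1| * B.
  by rewrite ger0_norm ?exprn_ge0 ?divr_ge0 ?(ltW q0) // expr_div_n; ring.
apply: bounded_family_le (bounded_familyZ _ hB) => a.
rewrite /u mem_msimplex; case: leqP => aN.
  by rewrite mulr1n subrr normr0.
rewrite mulr0n subr0 !normrM mulrCA ler_wpM2l //.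
apply: (@le_trans _ _ (s ^+ mdeg a)); first by apply: norm_monom_le => i; rewrite !mxE.
rewrite !ger0_norm ?exprn_ge0 ?divr_ge0 ?(ltW q0) //.
have -> : s ^+ mdeg a = (s / q) ^+ mdeg a * q ^+ mdeg a.
  by rewrite -exprMn divfK // gt_eqF.
rewrite ler_wpM2r ?exprn_ge0 ?(ltW q0) //.
rewrite -(subnKC aN) exprD -[X in _ <= X]mulr1 ler_wpM2l ?exprn_ge0 ?divr_ge0 ?(ltW q0) //.
by rewrite exprn_ile1 ?divr_ge0 ?(ltW q0) // ler_pdivrMr // mul1r.
Qed.

Lemma finite_common_radius n (P : 'I_n -> R -> Prop) :
  (forall i, exists2 t0 : R, 0 < t0 & forall t, `|t| < t0 -> P i t) ->
  exists2 t0 : R, 0 < t0 & forall t, `|t| < t0 -> forall i, P i t.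
Proof.
move=> h.
suff [t0 t00 ht] : exists2 t0 : R, 0 < t0 & forall t, `|t| < t0 -> forall i, i \in enum 'I_n -> P i t.
  by exists t0 => // t tt i; apply: ht; rewrite ?mem_enum.
elim: (enum 'I_n) => [|i s [t0 t00 ht]]; first by exists 1.
have [t1 t10 ht1] := h i; exists (Num.min t0 t1); first by rewrite lt_min t00.
move=> t; rewrite lt_min => /andP [l0 l1] j; rewrite inE => /orP [/eqP ->|].
  exact: ht1.
exact: ht.
Qed.

(** [psi t - y] is O(t), so the tail of degree above [N] is O(t^(N+1)) by [expansion_tail]; the rest
    is polynomial in the coordinates of [psi]. *)
Lemma appr_expansion n N (K : 'rV[R]_n -> R) y (r : R) c (psi : R -> 'rV[R]_n)
    (p : 'I_n -> {poly R}) : 0 < r -> expansion K y r c -> psi 0 = y ->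
  (forall i, appr N.+1 (fun t => psi t ord0 i) (p i)) ->
  appr N.+1 (fun t => K (psi t))
    (\sum_(a <- msimplex n N) c a *: \prod_i (p i - (y ord0 i)%:P) ^+ a i).
Proof.
move=> r0 hK psi0 hp.
have hh i : appr N.+1 (fun t => psi t ord0 i - y ord0 i) (p i - (y ord0 i)%:P).
  apply: apprB => //; have := appr_horner N.+1 (y ord0 i)%:P.
  by apply: appr_ext; exists 1 => // t _; rewrite hornerC.
have lip i : exists C, exists2 t0 : R, 0 < t0 &
    forall t, `|t| < t0 -> 0 <= C /\ `|psi t ord0 i - y ord0 i| <= C * `|t|.
  have [|C [t0 [C0 t00 h]]] := appr_lipschitz (hh i).
    by rewrite (appr_at0 (hh i)) psi0 subrr.
  by exists C, t0 => // t /h.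
have [C hC] := choice lip.
have [t0 t00 ht] := finite_common_radius hC.
pose A := \sum_i C i + 1.
have C0 i : 0 <= C i by have := ht 0; rewrite normr0 => /(_ t00 i) [].
have A0 : 0 < A by rewrite ltr_wpDl // sumr_ge0.
have r2 : 0 < r / 2 by rewrite divr_gt0.
have r2r : r / 2 < r by rewrite ltr_pdivrMr // ltr_pMr // ltr1n.
have [B B0 hB] := expansion_tail N hK r2 r2r.
have h1 : appr N.+1 (fun t => K (psi t) - \sum_(a <- msimplex n N) c a * monom a (psi t - y)) 0.
  exists (B * A ^+ N.+1), (Num.min t0 (r / 2 / A)); split; first by rewrite lt_min t00 divr_gt0.
  move=> t; rewrite lt_min => /andP [l0 l1]; rewrite hornerC subr0 -mulrA -exprMn.
  apply: hB; rewrite ?mulr_ge0 ?(ltW A0) //.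
    move=> i; have [_ h] := ht t l0 i; apply: le_trans h _; rewrite ler_wpM2r //.
    by rewrite /A (bigD1 i) //= -addrA ler_wpDr // addr_ge0 // sumr_ge0.
  by rewrite mulrC -ler_pdivlMr // ltW.
have h2 : appr N.+1 (fun t => \sum_(a <- msimplex n N) c a * monom a (psi t - y))
    (\sum_(a <- msimplex n N) c a *: \prod_i (p i - (y ord0 i)%:P) ^+ a i).
  apply: (appr_sum _ (F := fun a t => c a * monom a (psi t - y))
    (P := fun a => c a *: \prod_i (p i - (y ord0 i)%:P) ^+ a i)) => a.
  apply: apprZ.
  have := appr_prod (index_enum 'I_n) (fun i => apprX (a i) (hh i)).
  apply: appr_ext; exists 1 => // t _; apply: eq_bigr => i _; by rewrite !mxE.
have := apprD h1 h2; rewrite add0r.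
by apply: appr_ext; exists 1 => // t _; rewrite subrK.
Qed.

Variable d : nat.
Implicit Types (x v w z : 'rV[R]_d) (J L : 'rV[R]_d -> {poly R}).

Lemma line_monom x v (a : mindex d) :
  \prod_i (((x ord0 i)%:P + v ord0 i *: 'X) - (x ord0 i)%:P) ^+ a i =
  monom a v *: 'X^(mdeg a) :> {poly R}.
Proof.
transitivity (\prod_i ((v ord0 i ^+ a i)%:P * 'X ^+ a i) : {poly R}).
  by apply: eq_bigr => i _; rewrite addrAC subrr add0r -mul_polyC exprMn polyC_exp.
rewrite big_split /= -mul_polyC; congr (_ * _); last by rewrite /mdeg prodrXr.
by rewrite /monom; elim/big_rec2: _ => [|i p q _ ->]; rewrite ?polyC1 // polyCM.
Qed.

Lemma appr_line N x v i : appr N (fun t : R => (x + t *: v) ord0 i) ((x ord0 i)%:P + v ord0 i *: 'X).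
Proof.
have := appr_horner N ((x ord0 i)%:P + v ord0 i *: 'X).
by apply: appr_ext; exists 1 => // t _; rewrite !mxE !hornerE mulrC.
Qed.

Lemma homogeneous_coef0 (c : mindex d -> R) n (v0 : 'rV[R]_d) (e : R) : 0 < e -> e <= 1 ->
  (forall i, `|v0 ord0 i| <= 1) ->
  (forall v, (forall i, `|v ord0 i - v0 ord0 i| <= e) ->
     \sum_(a <- msimplex d n | mdeg a == n) c a * monom a v = 0) ->
  forall a, mdeg a = n -> c a = 0.
Proof.
move=> e0 e1 hv0 h a ha; apply/eqP; rewrite -normr_le0.
have := @coef_le_of_bounded R d n (fun a => c a *+ (mdeg a == n)) v0 e 0 hv0 e0 e1 _ a.
rewrite mul0r ha eqxx mulr1n; apply=> // v hv.
rewrite normr_le0; apply/eqP; transitivity (\sum_(a <- msimplex d n | mdeg a == n) c a * monom a v).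
  by rewrite [RHS]big_mkcond; apply: eq_bigr => b _; case: ifP => _; rewrite ?mulr1n ?mulr0n ?mul0r.
exact: h.
Qed.

Lemma coef_sum_homog (s : seq (mindex d)) (u : mindex d -> R) n :
  (\sum_(a <- s) u a *: 'X^(mdeg a) : {poly R})`_n = \sum_(a <- s | mdeg a == n) u a.
Proof.
rewrite coef_sum [RHS]big_mkcond; apply: eq_bigr => a _.
by rewrite coefZ coefXn eq_sym; case: eqP; rewrite ?mulr1 ?mulr0.
Qed.

Lemma expansion_zero (K : 'rV[R]_d -> R) x (r : R) c : 0 < r -> expansion K x r c ->
  (\forall y \near x, K y = 0) -> forall a, c a = 0.
Proof.
move=> r0 hK /nbhs_boxP [q q0 hq] a.
have h v : \sum_(b <- msimplex d (mdeg a) | mdeg b == mdeg a) c b * monom b v = 0.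
  have := appr_expansion (N := mdeg a) r0 hK _ (appr_line _ x v).
  rewrite scale0r addr0 => /(_ erefl) h.
  rewrite -coef_sum_homog; apply: (@appr_zero_coef _ (mdeg a).+1) => //.
  apply: appr_ext (_ : appr _ (fun t => K (x + t *: v)) _); last first.
    rewrite (eq_bigr (fun b => c b *: \prod_i (((x ord0 i)%:P + v ord0 i *: 'X) - (x ord0 i)%:P) ^+ b i)) //.
    by move=> b _; rewrite line_monom scalerA.
  have A0 : 0 < \sum_i `|v ord0 i| + 1 by rewrite ltr_wpDl // sumr_ge0.
  exists (q / (\sum_i `|v ord0 i| + 1)); first exact: divr_gt0.
  move=> t; rewrite ltr_pdivlMr // => ht; apply: hq => i.
  rewrite !mxE addrAC subrr add0r normrM; apply: le_lt_trans ht.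
  by rewrite ler_wpM2l // (bigD1 i) //= -addrA lerDl addr_ge0 // sumr_ge0.
apply: (@homogeneous_coef0 c (mdeg a) 0 1) => //.
by move=> i; rewrite mxE normr0.
Qed.

(** The open sets where [K] vanishes need only accumulate at [x]: the coefficients at the centres
    [u] are zero, and they tend to those at [x] by [shift_coef_close]. *)
Lemma expansion_identity (K : 'rV[R]_d -> R) x (r : R) c : 0 < r -> expansion K x r c ->
  (forall q : R, 0 < q -> exists u : 'rV[R]_d, (forall i, `|u ord0 i - x ord0 i| < q) /\
     \forall y \near u, K y = 0) -> forall a, c a = 0.
Proof.
move=> r0 hK h a.
pose e := r / 4; have e0 : 0 < e by rewrite divr_gt0.
have er : e + e < r by rewrite /e; lra.
have e2 : 0 <= e + e by rewrite addr_ge0 // ltW.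
have [C hC] := shift_coef_close (@real_summation_complete R) a e0 (expansion_poly_bounded hK e2 er).
apply: normr_lt_all_eq0 => p p0.
have C1 : 0 < `|C| + 1 by rewrite ltr_wpDl.
pose q := Num.min e (p / (`|C| + 1)).
have q0 : 0 < q by rewrite lt_min e0 divr_gt0.
have qe : q <= e by rewrite ge_min lexx.
have [u [hu Ku]] := h q q0.
have hu' i : `|u ord0 i - x ord0 i| <= q by apply: ltW.
have qr : q < r by apply: le_lt_trans qe _; rewrite /e; lra.
have hs := expansion_shift (@real_summation_complete R) (ltW q0) qr hK hu'.
have rq : 0 < r - q by rewrite subr_gt0.
have z0 := expansion_zero rq hs Ku a.
have := hC (u - x) q; rewrite z0 sub0r normrN => k.
have : `|c a| <= C * q by apply: k; rewrite ?(ltW q0) // => i; rewrite !mxE.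
move=> /le_lt_trans; apply.
apply: (@lt_le_trans _ _ ((`|C| + 1) * q)).
  by rewrite ltr_pM2r // (le_lt_trans (ler_norm _)) // ltrDl.
by rewrite mulrC -ler_pdivlMr // ge_min lexx orbT.
Qed.

Lemma cvg_cst_at z (c : R) : (fun=> c) w @[w --> z] --> c.
Proof. exact: (@cvg_cst _ _ _ (nbhs z)). Qed.

Definition ccont z J := forall i,
  (fun w => (J w)`_i : R) w @[w --> z] --> ((J z)`_i : R).

Lemma ccont_cst z p : ccont z (fun=> p).
Proof. by move=> i; exact: cvg_cst_at. Qed.

Lemma ccontD z J L : ccont z J -> ccont z L -> ccont z (fun w => J w + L w).
Proof.
move=> hJ hL i; rewrite coefD.
have -> : (fun w => (J w + L w)`_i) = (fun w => (J w)`_i + (L w)`_i).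
  by apply/funext => w; rewrite coefD.
exact: cvgD (hJ i) (hL i).
Qed.

Lemma cvg_bigsum z (I : Type) (r : seq I) (f : I -> 'rV[R]_d -> R) :
  (forall i, f i w @[w --> z] --> f i z) ->
  \sum_(i <- r) f i w @[w --> z] --> \sum_(i <- r) f i z.
Proof.
move=> h; elim: r => [|i r IH].
  rewrite big_nil; have -> : (fun w => \sum_(i <- [::]) f i w) = cst 0.
    by apply/funext => w; rewrite big_nil.
  exact: cvg_cst_at.
rewrite big_cons; have -> : (fun w => \sum_(i <- i :: r) f i w) = (fun w => f i w + \sum_(i <- r) f i w).
  by apply/funext => w; rewrite big_cons.
exact: cvgD (h i) IH.
Qed.

Lemma ccontM z J L : ccont z J -> ccont z L -> ccont z (fun w => J w * L w).
Proof.
move=> hJ hL i; rewrite coefM.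
have -> : (fun w => (J w * L w)`_i) = (fun w => \sum_(j < i.+1) (J w)`_j * (L w)`_(i - j)).
  by apply/funext => w; rewrite coefM.
apply: (cvg_bigsum _ (f := fun (j : 'I_i.+1) w => (J w)`_j * (L w)`_(i - j))) => j.
exact: cvgM (hJ j) (hL (i - j)%N).
Qed.

Lemma ccontX z J k : ccont z J -> ccont z (fun w => J w ^+ k).
Proof.
move=> hJ; elim: k => [|k IH].
  have -> : (fun w => J w ^+ 0) = (fun=> 1) by apply/funext => w; rewrite expr0.
  exact: ccont_cst.
have -> : (fun w => J w ^+ k.+1) = (fun w => J w * J w ^+ k).
  by apply/funext => w; rewrite exprS.
exact: ccontM.
Qed.

Lemma ccontC z (f : 'rV[R]_d -> R) : f w @[w --> z] --> f z -> ccont z (fun w => (f w)%:P).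
Proof.
move=> h [|i]; first by under eq_fun do rewrite coefC /=; rewrite coefC.
under eq_fun do rewrite coefC /=; rewrite coefC; exact: cvg_cst_at.
Qed.

Lemma ccontZ z (f : 'rV[R]_d -> R) J : f w @[w --> z] --> f z -> ccont z J ->
  ccont z (fun w => f w *: J w).
Proof.
move=> hf hJ.
have -> : (fun w => f w *: J w) = (fun w => (f w)%:P * J w).
  by apply/funext => w; rewrite mul_polyC.
by apply: ccontM => //; apply: ccontC.
Qed.

Lemma ccontB z J L : ccont z J -> ccont z L -> ccont z (fun w => J w - L w).
Proof.
move=> hJ hL.
have -> : (fun w => J w - L w) = (fun w => J w + (-1) *: L w).
  by apply/funext => w; rewrite scaleN1r.
apply: ccontD => //; apply: ccontZ => //; exact: cvg_cst_at.
Qed.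

Lemma ccont_sum z (I : Type) (r : seq I) (f : I -> 'rV[R]_d -> {poly R}) :
  (forall i, ccont z (f i)) -> ccont z (fun w => \sum_(i <- r) f i w).
Proof.
move=> h; elim: r => [|i r IH].
  have -> : (fun w => \sum_(i <- [::]) f i w) = (fun=> 0) by apply/funext => w; rewrite big_nil.
  exact: ccont_cst.
have -> : (fun w => \sum_(i <- i :: r) f i w) = (fun w => f i w + \sum_(i <- r) f i w).
  by apply/funext => w; rewrite big_cons.
exact: ccontD.
Qed.

Lemma ccont_prod z (I : Type) (r : seq I) (f : I -> 'rV[R]_d -> {poly R}) :
  (forall i, ccont z (f i)) -> ccont z (fun w => \prod_(i <- r) f i w).
Proof.
move=> h; elim: r => [|i r IH].
  have -> : (fun w => \prod_(i <- [::]) f i w) = (fun=> 1) by apply/funext => w; rewrite big_nil.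
  exact: ccont_cst.
have -> : (fun w => \prod_(i <- i :: r) f i w) = (fun w => f i w * \prod_(i <- r) f i w).
  by apply/funext => w; rewrite big_cons.
exact: ccontM.
Qed.

(* [J w] is a jet of order [M] at [w] of the restriction of [g] to the line
   through [w] directed by [v], and it is continuous in [w] at [z]. *)
Definition jet z v (M : nat) (g : 'rV[R]_d -> R) J :=
  (\forall w \near z, appr M (fun t => g (w + t *: v)) (J w)) /\ ccont z J.

Lemma jet_coord z v M i :
  jet z v M (fun w => w ord0 i) (fun w => (w ord0 i)%:P + v ord0 i *: 'X).
Proof.
split; first by apply: (@filterE _ (nbhs z)) => w; apply: appr_line.
apply: ccontD; last exact: ccont_cst.
apply: ccontC; exact: coord_continuous.
Qed.

Lemma jetB z v M f g J L : jet z v M f J -> jet z v M g L ->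
  jet z v M (fun w => f w - g w) (fun w => J w - L w).
Proof.
move=> [h1 c1] [h2 c2]; split; last exact: ccontB.
by near=> w; apply: apprB; near: w.
Unshelve. all: by end_near.
Qed.

Lemma jet_ext z v M f g J : (\forall w \near z, f w = g w) -> jet z v M f J -> jet z v M g J.
Proof.
move=> /nbhs_boxP [q q0 hq] [h c]; split=> //.
have N : nbhs z [set w : 'rV[R]_d | forall i, `|w ord0 i - z ord0 i| < q / 2].
  by apply/nbhs_boxP; exists (q / 2); rewrite ?divr_gt0.
apply: filterS (filterI h N) => w [hw Nw].
apply: appr_ext hw.
have A0 : 0 < \sum_i `|v ord0 i| + 1 by rewrite ltr_wpDl // sumr_ge0.
exists (q / 2 / (\sum_i `|v ord0 i| + 1)); first by rewrite !divr_gt0.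
move=> t; rewrite ltr_pdivlMr // => ht; apply: hq => i; rewrite !mxE.
rewrite addrAC; apply: le_lt_trans (ler_normD _ _) _; rewrite [q]splitr normrM.
apply: ltrD; first exact: Nw.
apply: le_lt_trans ht; rewrite ler_wpM2l // (bigD1 i) //= -addrA lerDl addr_ge0 // sumr_ge0 //.
Qed.

Lemma jet_smooth z v M (V : set 'rV[R]_d) F : open V -> smooth_on V F -> V z ->
  jet z v M F (fun w => \poly_(n < M) (dirD v n F w / n`!%:R)).
Proof.
move=> oV sF Vz; split; last first.
  move=> i; rewrite coef_poly; under eq_fun do rewrite coef_poly.
  case: ifP => _; last exact: cvg_cst_at.
  have h : dirD v i F w @[w --> z] --> dirD v i F z.
    apply: (cvg_bigsum _ (f := fun l w => (\prod_(j <- l) v ord0 j) * iter_partial l F w)) => l.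
    have [h _] := sF l z Vz.
    exact: (cvgM (@cvg_cst_at z (\prod_(j <- l) v ord0 j)) h).
  exact: (cvgM h (@cvg_cst_at z (i`!%:R^-1))).
have : nbhs z V by apply: open_nbhs_nbhs.
apply: filterS => w Vw.
have /nbhs_boxP [q q0 hq] : nbhs w V by apply: open_nbhs_nbhs.
have A0 : 0 < \sum_i `|v ord0 i| + 1 by rewrite ltr_wpDl // sumr_ge0.
have := @taylor_appr R M (fun n t => dirD v n F (w + t *: v)).
have -> : (fun t : R => dirD v 0 F (w + t *: v)) = (fun t => F (w + t *: v)).
  by apply/funext => t; rewrite /dirD /= big_seq1 big_nil mul1r.
rewrite scale0r addr0; apply.
exists (q / (\sum_i `|v ord0 i| + 1)); first exact: divr_gt0.
move=> n t; rewrite ltr_pdivlMr // => ht; apply: (is_derive_dirD n oV sF).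
apply: hq => i; rewrite !mxE addrAC subrr add0r normrM; apply: le_lt_trans ht.
by rewrite ler_wpM2l // (bigD1 i) //= -addrA lerDl addr_ge0 // sumr_ge0.
Qed.

Lemma shift_coef0 n (c : mindex n -> R) (r : R) a : 0 < r -> poly_bounded c r -> shift_coef c 0 a = c a.
Proof.
move=> r0 hc; have r2 : 0 < r / 2 by rewrite divr_gt0.
rewrite [r]splitr in hc.
have [C hC] := shift_coef_close (@real_summation_complete R) a r2 hc.
apply/eqP; rewrite -subr_eq0 -normr_le0 -(mulr0 C); apply: hC => //; last exact: ltW.
by move=> i; rewrite mxE normr0.
Qed.

(** Near [z] the series of [K] is re-expanded at [Psi w] and the jets are substituted into it; the
    new coefficients depend continuously on [w] by [shift_coef_close]. *)
Lemma jet_comp z v N n (K : 'rV[R]_n -> R) (r : R) c (Psi : 'rV[R]_d -> 'rV[R]_n)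
    (J : 'I_n -> 'rV[R]_d -> {poly R}) :
  0 < r -> expansion K (Psi z) r c -> (forall i, jet z v N.+1 (fun w => Psi w ord0 i) (J i)) ->
  exists JK, jet z v N.+1 (fun w => K (Psi w)) JK /\
    JK z = \sum_(a <- msimplex n N) c a *: \prod_i (J i z - (Psi z ord0 i)%:P) ^+ a i.
Proof.
move=> r0 hK hJ.
have at0 i : \forall w \near z, (J i w)`_0 = Psi w ord0 i.
  have [h _] := hJ i; apply: filterS h => w h.
  by rewrite (appr_at0 h) scale0r addr0.
have cont i : Psi w ord0 i @[w --> z] --> Psi z ord0 i.
  have [_ /(_ 0%N)] := hJ i; rewrite (nbhs_singleton (at0 i)).
  by move=> h; apply: cvg_trans h; exact: (near_eq_cvg (at0 i)).
pose e := r / 4; have e0 : 0 < e by rewrite divr_gt0.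
have er : e + e < r by rewrite /e; lra.
have er1 : e < r by rewrite /e; lra.
have e2 : 0 <= e + e by rewrite addr_ge0 // ltW.
have hc := expansion_poly_bounded hK e2 er.
have near_e (q : R) : 0 < q -> \forall w \near z, forall i, `|Psi w ord0 i - Psi z ord0 i| <= q.
  move=> q0; apply: (filter_forall (nbhs_filter z)) => i.
  by have /cvgrPdist_le /(_ q q0) := cont i; apply: filterS => w; rewrite distrC.
exists (fun w => \sum_(a <- msimplex n N) shift_coef c (Psi w - Psi z) a *:
  \prod_i (J i w - (Psi w ord0 i)%:P) ^+ a i).
split; last first.
  apply: eq_bigr => a _; rewrite subrr; congr (_ *: _).
  by apply: (@shift_coef0 _ _ (e + e)) => //; rewrite addr_gt0.
split.
  have hall : \forall w \near z, forall i, appr N.+1 (fun t => Psi (w + t *: v) ord0 i) (J i w).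
    by apply: (filter_forall (nbhs_filter z)) => i; case: (hJ i).
  apply: filterS (filterI hall (near_e e e0)) => w [hw1 hw2].
  have hs := expansion_shift (@real_summation_complete R) (ltW e0) er1 hK hw2.
  have re : 0 < r - e by rewrite subr_gt0.
  by apply: (appr_expansion (psi := fun t => Psi (w + t *: v)) re hs) => //; rewrite scale0r addr0.
apply: ccont_sum => a; apply: ccontZ.
  rewrite subrr (@shift_coef0 _ _ (e + e)) ?addr_gt0 //.
  have [C hC] := shift_coef_close (@real_summation_complete R) a e0 hc.
  apply/(cvgrPdist_le (FF := nbhs_filter z)) => p p0.
  have C1 : 0 < `|C| + 1 by rewrite ltr_wpDl.
  pose q := Num.min e (p / (`|C| + 1)).
  have q0 : 0 < q by rewrite lt_min e0 divr_gt0.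
  apply: filterS (near_e q q0) => w hw; rewrite distrC.
  apply: le_trans (hC _ q _ (ltW q0) _) _.
  - by move=> i; rewrite !mxE.
  - by rewrite ge_min lexx.
  apply: (@le_trans _ _ ((`|C| + 1) * q)).
    by rewrite ler_wpM2r ?(ltW q0) // (le_trans (ler_norm _)) // lerDl.
  by rewrite mulrC -ler_pdivlMr // ge_min lexx orbT.
apply: ccont_prod => i; apply: ccontX; apply: ccontB; first by case: (hJ i).
exact: ccontC.
Qed.

(** At points [u] near which [g] vanishes the jet is zero below order [M] by uniqueness, and
    continuity of the jet carries this to [z]. *)
Lemma jet_flat z v M g J : jet z v M g J ->
  (forall q : R, 0 < q -> exists u : 'rV[R]_d, (forall i, `|u ord0 i - z ord0 i| < q) /\
     \forall y \near u, g y = 0) ->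
  forall i, (i < M)%N -> (J z)`_i = 0.
Proof.
move=> [hJ cJ] h i iM; apply: normr_lt_all_eq0 => e e0.
have /cvgrPdist_lt /(_ e e0) N1 := cJ i.
have N : nbhs z [set w | `|(J z)`_i - (J w)`_i| < e /\ appr M (fun t => g (w + t *: v)) (J w)].
  by apply: filterI.
have {N} [q q0 hq] := (nbhs_boxP _ _).1 N.
have [u [hu /nbhs_boxP [q' q'0 hq']]] := h q q0.
have [h1 h2] := hq u hu.
suff E : (J u)`_i = 0 by move: h1; rewrite E subr0.
apply: (@appr_zero_coef _ M) => //; apply: appr_ext h2.
have A0 : 0 < \sum_i `|v ord0 i| + 1 by rewrite ltr_wpDl // sumr_ge0.
exists (q' / (\sum_i `|v ord0 i| + 1)); first exact: divr_gt0.
move=> t; rewrite ltr_pdivlMr // => ht; apply: hq' => j.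
rewrite !mxE addrAC subrr add0r normrM; apply: le_lt_trans ht.
by rewrite ler_wpM2l // (bigD1 j) //= -addrA lerDl addr_ge0 // sumr_ge0.
Qed.

End Jets.

(** * Formal solutions *)

Section SplitIndex.
Variable n : nat.
Implicit Types (a : mindex (n + 1)) (b : mindex n).

Definition lpart a : mindex n := [ffun i : 'I_n => a (lshift 1 i)].
Definition rpart a : nat := a (rshift n ord0).
Definition mjoin b (j : nat) : mindex (n + 1) :=
  [ffun i : 'I_(n + 1) => if fintype.split i is inl i' then b i' else j].

Lemma lpart_mjoin b j : lpart (mjoin b j) = b.
Proof.
apply/ffunP => i; rewrite !ffunE.
by have -> : fintype.split (lshift 1 i) = inl i by exact: (unsplitK (inl i)).
Qed.

Lemma rpart_mjoin b j : rpart (mjoin b j) = j.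
Proof.
rewrite /rpart ffunE.
by have -> : fintype.split (rshift n (ord0 : 'I_1)) = inr ord0 by exact: (@unsplitK n 1 (inr ord0)).
Qed.

Lemma mjoin_parts a : mjoin (lpart a) (rpart a) = a.
Proof.
apply/ffunP => i; rewrite ffunE -{2}(fintype.splitK i); case: (fintype.split i) => k /=.
  by rewrite ffunE.
by rewrite /rpart (ord1 k).
Qed.

Lemma mdeg_parts a : mdeg a = (mdeg (lpart a) + rpart a)%N.
Proof.
rewrite /mdeg big_split_ord big_ord1 /=; congr (_ + _)%N.
by apply: eq_bigr => i _; rewrite ffunE.
Qed.

Lemma mdeg_mjoin b j : mdeg (mjoin b j) = (mdeg b + j)%N.
Proof. by rewrite mdeg_parts lpart_mjoin rpart_mjoin. Qed.

Lemma prod_parts (A : comPzRingType) (f : 'I_(n + 1) -> A) a :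
  \prod_i f i ^+ a i = (\prod_i f (lshift 1 i) ^+ lpart a i) * f (rshift n ord0) ^+ rpart a.
Proof.
rewrite big_split_ord big_ord1 /=; congr (_ * _).
by apply: eq_bigr => i _; rewrite ffunE.
Qed.

Lemma row_mx_l (A : pzRingType) (x : 'rV[A]_n) (y : A) i : (row_mx x y%:M) ord0 (lshift 1 i) = x ord0 i.
Proof. by rewrite row_mxEl. Qed.

Lemma row_mx_r (A : pzRingType) (x : 'rV[A]_n) (y : A) : (row_mx x y%:M) ord0 (rshift n ord0) = y.
Proof. by rewrite row_mxEr mxE eqxx mulr1n. Qed.

Lemma monom_row_mx (K : numFieldType) a (x : 'rV[K]_n) (y : K) :
  monom a (row_mx x y%:M) = monom (lpart a) x * y ^+ rpart a.
Proof.
rewrite /monom prod_parts row_mx_r; congr (_ * _).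
by apply: eq_bigr => i _; rewrite row_mx_l.
Qed.

Lemma row_mx_scalarB (K : numFieldType) (x x' : 'rV[K]_n) (y y' : K) :
  row_mx x y%:M - row_mx x' y'%:M = row_mx (x - x') (y - y')%:M.
Proof. by rewrite opp_row_mx add_row_mx -raddfB. Qed.

Lemma forall_row_mx (P : 'I_(n + 1) -> Prop) :
  (forall i, P (lshift 1 i)) -> P (rshift n ord0) -> forall i, P i.
Proof. by move=> h1 h2 i; rewrite -(fintype.splitK i); case: (fintype.split i) => k //=; rewrite (ord1 k). Qed.

End SplitIndex.

Lemma geometric_sum_le (R : realFieldType) (q : R) N : 0 <= q -> q <= 1 / 2 ->
  \sum_(j < N) q ^+ j <= 2.
Proof.
move=> q0 q2; suff h : \sum_(j < N) q ^+ j <= 2 - 2 * q ^+ N.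
  by apply: le_trans h _; rewrite gerBl mulr_ge0 // exprn_ge0.
elim: N => [|N IH]; first by rewrite big_ord0 expr0; lra.
rewrite big_ord_recr exprS /=; have := exprn_ge0 N q0; move: (q ^+ N) IH => x IH x0; nra.
Qed.

(** The sum is dominated by a product of [d] geometric series of ratio at most 1/2, whence
    [2 ^+ d]. *)
Lemma geometric_poly_bounded (R : realFieldType) d (p : mindex d -> R) (C k q : R) :
  0 <= C -> 0 <= k -> 0 <= q -> k * q <= 1 / 2 ->
  (forall a, `|p a| <= C * k ^+ mdeg a) -> poly_bounded p q.
Proof.
move=> C0 k0 q0 kq hp; exists (C * 2 ^+ d) => S uS.
pose N := \max_(a <- S) mdeg a.
have hS a : a \in S -> a \in mbox d N.
  move=> aS; rewrite mem_mbox; apply/forallP => i; apply: leq_trans (mdeg_ge a i) _.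
  by rewrite /N (big_rem a) //= leq_maxl.
have kq0 : 0 <= k * q by exact: mulr_ge0.
apply: (@le_trans _ _ (\sum_(a <- S) C * (k * q) ^+ mdeg a)).
  apply: ler_sum => a _; rewrite normrM (ger0_norm (exprn_ge0 _ q0)) exprMn mulrA.
  by rewrite ler_wpM2r ?exprn_ge0.
rewrite -mulr_sumr ler_wpM2l //.
apply: (@le_trans _ _ (\sum_(a <- mbox d N) (k * q) ^+ mdeg a)).
  rewrite [X in _ <= X](bigID (mem S)) /= -[X in _ <= X + _]big_filter.
  rewrite (perm_big [seq a <- mbox d N | a \in S]) /=; last first.
    apply: uniq_perm; rewrite ?filter_uniq ?mbox_uniq // => a; rewrite mem_filter.
    by case: (boolP (a \in S)) => // /hS ->.
  by rewrite lerDl sumr_ge0 // => a _; rewrite exprn_ge0.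
have -> : \sum_(a <- mbox d N) (k * q) ^+ mdeg a = \prod_(i < d) \sum_(j < N.+1) (k * q) ^+ j.
  rewrite -(sum_mbox (fun _ j => (k * q) ^+ j)); apply: eq_bigr => a _.
  by rewrite /mdeg prodrXr.
rewrite -[X in _ <= _ ^+ X]card_ord -prodr_const; apply: ler_prod => i _.
by rewrite sumr_ge0 /= ?geometric_sum_le // => j _; rewrite exprn_ge0.
Qed.

Section Formal.
Variables (R : realType) (d : nat) (c : mindex (d + 1) -> R) (p : mindex d -> R).
Implicit Types (v h : 'rV[R]_d) (k i N M : nat).

(** The homogeneous part of degree [n] of [p]. Degree 0 is dropped because [c] will be centred at
    [(z, F z)], so that the series to substitute for [y] has no constant term. *)
Definition phs v n : R :=
  if n == 0%N then 0 else \sum_(a <- msimplex d n | mdeg a == n) p a * monom a v.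

(* The terms of [(1/k!) d^k H / dy^k] on the line directed by [v]. *)
Definition Lterm k v (a : mindex (d + 1)) : term R :=
  (c a * 'C(rpart a, k)%:R * monom (lpart a) v, mdeg (lpart a), (rpart a - k)%N).

Definition Lg k M v : seq (term R) := [seq Lterm k v a | a <- msimplex (d + 1) M].

(** The coefficient of [t^i] of [(1/k!) d^k H / dy^k] along the formal series on the line directed
    by [v]. The truncations at [i + k] and [i] are exact by [Acoef_stable]. *)
Definition Acoef k v i : R := (evalS (Lg k (i + k) v) (series_poly (phs v) i))`_i.

Lemma evalS_Lg k M v y : evalS (Lg k M v) y =
  \sum_(a <- msimplex (d + 1) M) (c a * 'C(rpart a, k)%:R * monom (lpart a) v) *:
    ('X^(mdeg (lpart a)) * y ^+ (rpart a - k)).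
Proof. by rewrite /evalS big_map. Qed.

Lemma coef_pow_eq (y1 y2 : {poly R}) i l :
  (forall j, (j <= i)%N -> y1`_j = y2`_j) -> forall j, (j <= i)%N -> (y1 ^+ l)`_j = (y2 ^+ l)`_j.
Proof.
move=> e; elim: l => [|l IH] j ji; first by rewrite !expr0.
rewrite !exprS !coefM; apply: eq_bigr => t _; rewrite e ?IH //.
  by apply: leq_trans (leq_subr _ _) ji.
by apply: leq_trans ji; rewrite -ltnS.
Qed.

Lemma coef_XnM_pow_small (y : {poly R}) e l i : y`_0 = 0 -> (i < e + l)%N -> ('X^e * y ^+ l)`_i = 0.
Proof.
move=> /coef0_XM [q ->] il.
by rewrite exprMn mulrA -exprD coefXnM il.
Qed.

Lemma series_phs0 v N : (series_poly (phs v) N)`_0 = 0.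
Proof. by rewrite coef_poly. Qed.

(** As the series has no constant term, the index [a] contributes only from order [mdeg a - k] on;
    and coefficients of the series above [i] do not reach order [i]. *)
Lemma Acoef_stable k v i N M : (i <= N)%N -> (i + k <= M)%N ->
  (evalS (Lg k M v) (series_poly (phs v) N))`_i = Acoef k v i.
Proof.
move=> iN ikM; rewrite /Acoef !evalS_Lg !coef_sum.
have E M' : (i + k <= M')%N -> forall y1 : {poly R}, y1`_0 = 0 ->
   \sum_(a <- msimplex (d + 1) M') ((c a * 'C(rpart a, k)%:R * monom (lpart a) v) *:
      ('X^(mdeg (lpart a)) * y1 ^+ (rpart a - k)))`_i =
   \sum_(a <- msimplex (d + 1) (i + k)) ((c a * 'C(rpart a, k)%:R * monom (lpart a) v) *:
      ('X^(mdeg (lpart a)) * y1 ^+ (rpart a - k)))`_i.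
  move=> hM y1 y10; rewrite (bigID (mem (msimplex (d + 1) (i + k)))) /= [X in _ + X]big1 ?addr0.
    rewrite -big_filter; apply: perm_big; apply: uniq_perm; rewrite ?filter_uniq ?mbox_uniq //.
    move=> a; rewrite mem_filter !mem_msimplex.
    by case: leqP => //= h; apply: leq_trans h hM.
  move=> a; rewrite mem_msimplex -ltnNge mdeg_parts => h; rewrite coefZ.
  case: (ltnP (rpart a) k) => hk; first by rewrite bin_small // mulr0 !mul0r.
  rewrite coef_XnM_pow_small ?mulr0 //.
  by rewrite -(ltn_add2r k) -addnA subnK.
rewrite E ?series_phs0 // [RHS]E ?series_phs0 //.
apply: eq_bigr => a _; rewrite !coefZ !coefXnM; case: ifP => // _; congr (_ * _).
apply: (coef_pow_eq (i := i)); last exact: leq_subr.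
by move=> j ji; rewrite !coef_poly !ltnS ji (leq_trans ji iN).
Qed.

Lemma Lterm_le k v (s : R) a : (forall j, `|v ord0 j| <= 1) -> 0 < s ->
  `|c a * 'C(rpart a, k)%:R * monom (lpart a) v| * s ^+ (mdeg (lpart a) + (rpart a - k)) * s ^+ k
  <= `|c a * (s + s) ^+ mdeg a|.
Proof.
move=> hv s0; have s0' := ltW s0.
have m1 : `|monom (lpart a) v| <= 1.
  by apply: le_trans (norm_monom_le (q := 1) _ hv) _; rewrite ?expr1n.
rewrite !normrM -!mulrA ler_wpM2l // normr_nat.
case: (ltnP (rpart a) k) => hk; first by rewrite bin_small // mul0r.
rewrite -exprD -addnA subnK // -mdeg_parts [`|(s + s) ^+ _|]ger0_norm ?exprn_ge0 ?addr_ge0 //.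
have -> : s + s = 2 * s by ring.
rewrite exprMn; apply: ler_pM; rewrite ?mulr_ge0 ?exprn_ge0 //.
  rewrite -natrX ler_nat.
  apply: (@leq_trans (2 ^ rpart a)); last by rewrite leq_exp2l // mdeg_parts leq_addl.
  rewrite -[2%N]/(1 + 1)%N expnDn (bigD1 (Ordinal (hk : k < (rpart a).+1)%N)) //= !exp1n !muln1.
  exact: leq_addr.
by rewrite -[X in _ <= X]mul1r ler_wpM2r ?exprn_ge0.
Qed.

Lemma weight_Lg k M v (s B : R) : (forall j, `|v ord0 j| <= 1) -> 0 < s ->
  bounded_family (fun a => c a * (s + s) ^+ mdeg a) B -> weight (Lg k M v) s <= B / s ^+ k.
Proof.
move=> hv s0 hB; rewrite /weight big_map ler_pdivlMr ?exprn_gt0 // mulr_suml.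
apply: le_trans (hB _ (msimplex_uniq (d + 1) M)); apply: ler_sum => a _ /=.
exact: Lterm_le.
Qed.

Lemma devalS_Lg k M v y : devalS (Lg k M v) y = k.+1%:R *: evalS (Lg k.+1 M v) y.
Proof.
rewrite /devalS /evalS !big_map scaler_sumr; apply: eq_bigr => a _ /=.
rewrite scalerA subnS; congr (_ *: _).
have := mul_bin_left (rpart a) k => /(congr1 (fun m => m%:R : R)); rewrite !natrM => E.
have gen (x m b w b' K : R) : K * b' = w * b -> x * b * m * w = K * (x * b' * m).
  by move=> e; transitivity (x * m * (w * b)); [ring | rewrite -e; ring].
exact: gen E.
Qed.

Lemma cvg_monom (a : mindex d) v0 : monom a v @[v --> v0] --> monom a v0.
Proof.
(* The monomial is read as coefficient 0 of a product of constant polynomials, so that [ccont_prod]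
   applies. *)
have E v : monom a v = (\prod_i ((v ord0 i)%:P ^+ a i) : {poly R})`_0.
  have -> : \prod_i ((v ord0 i)%:P ^+ a i) = (monom a v)%:P :> {poly R}.
    by rewrite /monom rmorph_prod; apply: eq_bigr => i _; rewrite rmorphXn.
  by rewrite coefC.
rewrite E; have -> : monom a = (fun v => (\prod_i ((v ord0 i)%:P ^+ a i) : {poly R})`_0).
  by apply/funext.
suff h : ccont v0 (fun v => \prod_i ((v ord0 i)%:P ^+ a i)) by exact: (h 0%N).
apply: ccont_prod => i; apply: ccontX; apply: ccontC.
exact: coord_continuous.
Qed.

Lemma cvg_phs n v0 : phs v n @[v --> v0] --> phs v0 n.
Proof.
case: n => [|n]; first exact: cvg_cst_at.
rewrite /phs /= -big_filter; under eq_fun do rewrite -big_filter.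
apply: (cvg_bigsum _ (f := fun a v => p a * monom a v)) => a.
exact: (cvgM (@cvg_cst_at _ _ v0 (p a)) (@cvg_monom a v0)).
Qed.

Lemma cvg_Acoef k i v0 : Acoef k v i @[v --> v0] --> Acoef k v0 i.
Proof.
suff h : ccont v0 (fun v => evalS (Lg k (i + k) v) (series_poly (phs v) i)) by exact: h.
have -> : (fun v => evalS (Lg k (i + k) v) (series_poly (phs v) i)) =
  (fun v => \sum_(a <- msimplex (d + 1) (i + k)) (c a * 'C(rpart a, k)%:R * monom (lpart a) v) *:
    ('X^(mdeg (lpart a)) * series_poly (phs v) i ^+ (rpart a - k))).
  by apply/funext => v; rewrite evalS_Lg.
apply: ccont_sum => a.
apply: ccontZ.
  exact: (cvgM (@cvg_cst_at _ _ v0 (c a * 'C(rpart a, k)%:R)) (@cvg_monom (lpart a) v0)).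
apply: ccontM; first exact: ccont_cst.
apply: ccontX => j; rewrite coef_poly; under eq_fun do rewrite coef_poly.
case: ifP => _; [exact: cvg_phs | exact: cvg_cst_at].
Qed.

(** Among the nonzero coefficients take one of least degree [n] in [x], and let [k] be its degree in
    [y]. Since [y(0) = 0], the coefficient of [t^n] in the [k]-th derivative is then the form of the
    [c (mjoin b k)] with [mdeg b = n], whatever [p] is, and this form is not zero. *)
Lemma Acoef_nonzero : (exists a, c a != 0) ->
  exists k i v, (forall j, `|v ord0 j| < 1) /\ Acoef k v i != 0.
Proof.
move=> [a0 ca0].
have [n [[a1 ca1 na1] nmin]] : exists n, (exists2 a, c a != 0 & mdeg (lpart a) = n) /\
    forall a, c a != 0 -> (n <= mdeg (lpart a))%N.
  have ex : exists n, `[< exists2 a, c a != 0 & mdeg (lpart a) = n >].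
    by exists (mdeg (lpart a0)); apply/asboolP; exists a0.
  exists (ex_minn ex); case: ex_minnP => n /asboolP h1 h2; split=> // a ca.
  by apply: h2; apply/asboolP; exists a.
pose k := rpart a1.
apply: contrapT => no.
have AE v : Acoef k v n = \sum_(b <- msimplex d n | mdeg b == n) c (mjoin b k) * monom b v.
  rewrite /Acoef evalS_Lg coef_sum.
  rewrite (bigID (fun a => (mdeg (lpart a) == n) && (rpart a == k))) /= [X in _ + X]big1 ?addr0.
    rewrite -big_filter -[RHS]big_filter.
    transitivity (\sum_(a <- [seq mjoin b k | b <- [seq b <- msimplex d n | mdeg b == n]])
      c a * monom (lpart a) v).
      rewrite (perm_big [seq mjoin b k | b <- [seq b <- msimplex d n | mdeg b == n]]) /=; last first.
        apply: uniq_perm; rewrite ?filter_uniq ?mbox_uniq //.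
          rewrite map_inj_uniq ?filter_uniq ?mbox_uniq // => b b' /(congr1 (@lpart d)).
          by rewrite !lpart_mjoin.
        move=> a; rewrite mem_filter mem_msimplex; apply/idP/mapP.
          move=> /andP [/andP [/eqP h1 /eqP h2] _]; exists (lpart a).
            by rewrite mem_filter mem_msimplex h1 eqxx leqnn.
          by rewrite -h2 mjoin_parts.
        move=> [b]; rewrite mem_filter => /andP [/eqP h1 _] ->.
        by rewrite mdeg_mjoin lpart_mjoin rpart_mjoin h1 !eqxx leqnn.
      rewrite big_seq [RHS]big_seq; apply: eq_bigr => a /mapP [b].
      rewrite mem_filter => /andP [/eqP h1 _] ->.
      rewrite lpart_mjoin rpart_mjoin h1 binn mulr1 subnn expr0 mulr1 coefZ coefXn eqxx mulr1.
      by [].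
    by rewrite big_map; apply: eq_bigr => b _; rewrite lpart_mjoin.
  move=> a; case: (eqVneq (c a) 0) => [-> _|ca]; first by rewrite !mul0r scale0r coef0.
  move=> nk; have hn := nmin a ca; rewrite coefZ.
  case: (ltnP (rpart a) k) => hk; first by rewrite bin_small // mulr0 !mul0r.
  rewrite coef_XnM_pow_small ?mulr0 ?series_phs0 //.
  move: nk; rewrite negb_and => /orP [nn|nk].
    by apply: ltn_addr; rewrite ltn_neqAle eq_sym nn.
  by apply: (leq_trans (n := (n + 1)%N)); rewrite ?addn1 // -addn1 leq_add // subn_gt0 ltn_neqAle eq_sym nk.
have z v : (forall j, `|v ord0 j| < 1) -> \sum_(b <- msimplex d n | mdeg b == n) c (mjoin b k) * monom b v = 0.
  move=> hv; rewrite -AE; apply/eqP; apply/negP => /negP h.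
  by apply: no; exists k, n, v.
have := @homogeneous_coef0 R d (fun b => c (mjoin b k)) n 0 (1 / 2) _ _ _ _ (lpart a1) na1.
rewrite mjoin_parts => H; case/eqP: ca1; apply: H.
- by rewrite divr_gt0.
- by lra.
- by move=> i; rewrite mxE normr0.
move=> v hv; apply: z => j; have := hv j; rewrite mxE subr0; lra.
Qed.

End Formal.

(** * Convergence of the formal solution *)

Section FormalConvergence.
Variables (R : realType) (d : nat) (c : mindex (d + 1) -> R) (p : mindex d -> R).
Implicit Types (v h : 'rV[R]_d).

(** The first derivative that is not flat has index [k.+1], as index 0 is flat. Both [k] and [m] are
    minimal over all directions of the open unit cube, which makes the vanishing of the lower
    coefficients uniform in [v]. *)
Lemma minimal_nonflat : (exists a, c a != 0) -> (forall v i, Acoef c p 0 v i = 0) ->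
  exists (k m : nat) v0, [/\ forall j, `|v0 ord0 j| < 1, Acoef c p k.+1 v0 m != 0,
    forall k', (k' <= k)%N -> forall v, (forall j, `|v ord0 j| < 1) -> forall i, Acoef c p k' v i = 0
    & forall i, (i < m)%N -> forall v, (forall j, `|v ord0 j| < 1) -> Acoef c p k.+1 v i = 0].
Proof.
move=> c0 flat; have [k0 [i0 [v1 [hv1 A1]]]] := Acoef_nonzero p c0.
have exk : exists k, `[< exists i v, (forall j, `|v ord0 j| < 1) /\ Acoef c p k v i != 0 >].
  by exists k0; apply/asboolP; exists i0, v1.
have [k hk kmin] := ex_minnP exk; move/asboolP: hk => hk.
have exm : exists i, `[< exists v, (forall j, `|v ord0 j| < 1) /\ Acoef c p k v i != 0 >].
  by have [i [v h]] := hk; exists i; apply/asboolP; exists v.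
have [m hm mmin] := ex_minnP exm; move/asboolP: hm => [v0 [hv0 Av0]].
case: k hk kmin exm mmin Av0 => [|k] hk kmin exm mmin Av0.
  by move: Av0; rewrite flat eqxx.
exists k, m, v0; split=> // [k' k'k v hv i|i im v hv]; apply/eqP; apply/negP => /negP A0.
  have : (k.+1 <= k')%N by apply: kmin; apply/asboolP; exists i, v.
  by rewrite ltnNge k'k.
have : (m <= i)%N by apply: mmin; apply/asboolP; exists v.
by rewrite leqNgt im.
Qed.

Lemma phs_bound v m : (forall j, `|v ord0 j| <= 1) -> forall i, (i <= m)%N ->
  `|phs p v i| <= \sum_(n < m.+1) \sum_(a <- msimplex d n) `|p a|.
Proof.
move=> hv i im; rewrite (bigD1 (Ordinal (im : i < m.+1)%N)) //= ler_wpDr //.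
  by apply: sumr_ge0 => n _; apply: sumr_ge0.
rewrite /phs; case: eqP => _; first by rewrite normr0 sumr_ge0.
apply: le_trans (ler_norm_sum _ _ _) _; rewrite big_mkcond; apply: ler_sum => a _.
case: ifP => // _; rewrite normrM -[X in _ <= X]mulr1 ler_wpM2l //.
by apply: le_trans (norm_monom_le (q := 1) _ hv) _; rewrite expr1n.
Qed.

Lemma phs_restrict v n : (0 < n)%N ->
  \sum_(a <- msimplex d n) (p a *+ (mdeg a == n)) * monom a v = phs p v n.
Proof.
move=> n0; rewrite /phs eqn0Ngt n0 /= [RHS]big_mkcond; apply: eq_bigr => a _.
by case: eqP; rewrite ?mulr1n ?mulr0n ?mul0r.
Qed.

Lemma formal_solution_bound (k m : nat) v0 (s B : R) :
  0 < s -> bounded_family (fun a => c a * (s + s) ^+ mdeg a) B ->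
  (forall j, `|v0 ord0 j| < 1) -> Acoef c p k.+1 v0 m != 0 ->
  (forall v, (forall j, `|v ord0 j| < 1) -> forall i, Acoef c p k v i = 0) ->
  (forall i, (i < m)%N -> forall v, (forall j, `|v ord0 j| < 1) -> Acoef c p k.+1 v i = 0) ->
  exists C K : R, [/\ 0 <= C, 0 < K & forall a, `|p a| <= C * K ^+ mdeg a].
Proof.
move=> s0 hB hv0 A0 hk hm.
(* Half the value at [v0], so that the lower bound persists on a box around [v0]. *)
pose D := `|Acoef c p k.+1 v0 m| / 2.
have D0 : 0 < D by rewrite divr_gt0 // normr_gt0.
have [q1 q10 hq1] : exists2 q : R, 0 < q & forall v, (forall j, `|v ord0 j - v0 ord0 j| < q) ->
    D <= `|Acoef c p k.+1 v m|.
  have /(cvgrPdist_lt (FF := nbhs_filter v0)) /(_ D D0) := @cvg_Acoef R d c p k.+1 m v0.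
  move=> /nbhs_boxP [q q0 hq]; exists q => // v /hq /= h.
  have : `|Acoef c p k.+1 v0 m| <= `|Acoef c p k.+1 v0 m - Acoef c p k.+1 v m| + `|Acoef c p k.+1 v m|.
    by rewrite -{1}[Acoef c p k.+1 v0 m](subrK (Acoef c p k.+1 v m)) ler_normD.
  by rewrite /D in h *; lra.
have [q2 [q20 q21 hq2]] := finite_max_lt ltr01 (fun j => normr_ge0 (v0 ord0 j)) hv0.
(* The first bound keeps the lower estimate [D], the second keeps the closed box inside the open
   unit cube. *)
pose e := Num.min (q1 / 2) ((1 - q2) / 2).
have e0 : 0 < e by rewrite lt_min !divr_gt0 // subr_gt0.
have e1 : e <= 1 by rewrite ge_min; apply/orP; right; lra.
have eq1 : e < q1 by apply: le_lt_trans (_ : q1 / 2 < q1); [rewrite ge_min lexx | lra].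
have eq2 : e <= (1 - q2) / 2 by rewrite ge_min lexx orbT.
have ball_lt1 v : (forall j, `|v ord0 j - v0 ord0 j| <= e) -> forall j, `|v ord0 j| < 1.
  move=> hv j; have := hv j; have := hq2 j.
  have : `|v ord0 j| <= `|v ord0 j - v0 ord0 j| + `|v0 ord0 j|.
    by rewrite -{1}[v ord0 j](subrK (v0 ord0 j)) ler_normD.
  lra.
have B0 : 0 <= B := bounded_family_ge0 hB.
have M0 : 0 <= B / s ^+ k by rewrite divr_ge0 // exprn_ge0 // ltW.
pose Bphi := \sum_(n < m.+1) \sum_(a <- msimplex d n) `|p a|.
have Bphi0 : 0 <= Bphi by apply: sumr_ge0 => n _; apply: sumr_ge0.
have [t [u [t0 t1 u0 main]]] := newton_bound m s0 D0 M0 Bphi0.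
have bound v n : (forall j, `|v ord0 j - v0 ord0 j| <= e) ->
    `|phs p v (n.+1 + m)| * t ^+ n.+1 <= u.
  move=> hv; have v1 := ball_lt1 v hv.
  have v1' j : `|v ord0 j| <= 1 by apply: ltW.
  apply: main => //; first by apply: phs_bound.
  (* This truncation is exact through order [N] for the [k]-th derivative and for its derivative in
     [y]. *)
  move=> N mN; exists (Lg c k (N + k.+1) v).
  have dE i : (i <= N)%N -> (devalS (Lg c k (N + k.+1) v) (series_poly (phs p v) N))`_i =
      k.+1%:R * Acoef c p k.+1 v i.
    by move=> iN; rewrite devalS_Lg coefZ Acoef_stable // leq_add2r.
  split.
  - exact: weight_Lg.
  - move=> i iN; rewrite Acoef_stable ?hk //.
    by rewrite addnS ltnW // ltnS leq_add2r.
  - by move=> i im; rewrite dE ?hm ?mulr0 // ltnW // (leq_trans im).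
  rewrite dE // normrM normr_nat.
  apply: le_trans (hq1 v (fun j => le_lt_trans (hv j) eq1)) _.
  by rewrite ler_peMl // ler1n.
have Kd1 : 1 <= (48 / e) ^+ d.
  by rewrite exprn_ege1 // ler_pdivlMr // mul1r; lra.
have Kt1 : 1 <= (48 / e) ^+ d / t by rewrite ler_pdivlMr // mul1r (le_trans t1).
pose W := \sum_(a <- msimplex d m) `|p a|.
have W0 : 0 <= W by apply: sumr_ge0.
(* The rate is the interpolation loss [(48 / e) ^+ d] over the radius [t]; [W] absorbs the degrees
   up to [m]. *)
exists (u + W), ((48 / e) ^+ d / t); split; first exact: addr_ge0.
  by apply: lt_le_trans Kt1.
move=> a; have [am|am] := leqP (mdeg a) m.
  apply: (@le_trans _ _ W).
    by rewrite /W (bigD1_seq a) ?msimplex_uniq ?mem_msimplex //= lerDl sumr_ge0.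
  apply: (@le_trans _ _ (u + W)); first by rewrite lerDr.
  by rewrite ler_peMr ?addr_ge0 // exprn_ege1.
have [n nE] : exists n, mdeg a = (n.+1 + m)%N.
  by exists (mdeg a - m.+1)%N; rewrite addSnnS subnK.
have np : (0 < mdeg a)%N by rewrite nE.
have h1 v : (forall j, `|v ord0 j - v0 ord0 j| <= e) ->
   `|\sum_(b <- msimplex d (mdeg a)) (p b *+ (mdeg b == mdeg a)) * monom b v| <= u / t ^+ n.+1.
  by move=> hv; rewrite phs_restrict // ler_pdivlMr ?exprn_gt0 // nE bound.
have := coef_le_of_bounded (fun i => ltW (hv0 i)) e0 e1 h1 (leqnn _).
rewrite eqxx mulr1n => h2; apply: le_trans h2 _.
have -> : ((48 / e) ^+ d / t) ^+ mdeg a = ((48 / e) ^+ d) ^+ mdeg a / t ^+ mdeg a.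
  by rewrite [LHS]expr_div_n.
rewrite [X in _ <= X]mulrA [X in _ <= X]mulrAC.
have K0 : 0 <= ((48 / e) ^+ d) ^+ mdeg a by rewrite exprn_ge0 // (le_trans ler01 Kd1).
rewrite ler_wpM2r //.
apply: (@le_trans _ _ (u / t ^+ mdeg a)).
  rewrite ler_wpM2l // lef_pV2 ?posrE ?exprn_gt0 // nE addnC exprD.
  by rewrite ler_piMl ?exprn_ge0 ?(ltW t0) // exprn_ile1 // ltW.
by rewrite ler_wpM2r ?invr_ge0 ?exprn_ge0 ?(ltW t0) // lerDl.
Qed.

End FormalConvergence.

(** * From formal to actual vanishing along the convergent solution *)

Section RootVanishing.
Variable R : realType.

Lemma half_pow_small (W e : R) : 0 <= W -> 0 < e -> exists N, forall n, (N <= n)%N -> W * (1 / 2) ^+ n < e.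
Proof.
move=> W0 e0; have We : 0 <= W / e by rewrite divr_ge0 // ltW.
exists (Num.bound (W / e)) => n nN.
have h1 : W / e < n%:R.
  by apply: lt_le_trans (archi_boundP We) _; rewrite ler_nat.
have h2 : n%:R <= 2 ^+ n :> R by rewrite -natrX ler_nat ltnW // ltn_expl.
rewrite expr_div_n expr1n mul1r ltr_pdivrMr ?exprn_gt0 // mulrC -ltr_pdivrMr //.
exact: lt_le_trans h1 h2.
Qed.

Lemma horner_high_le (P : {poly R}) N (e : R) : 0 <= e -> (forall j, (j <= N)%N -> P`_j = 0) ->
  `|P.[e]| <= (1 / 2) ^+ N.+1 * tnorm (e + e) (size P) P.
Proof.
move=> e0 h; rewrite (@horner_coef_wide _ (size P).+1) //.
apply: le_trans (ler_norm_sum _ _ _) _; rewrite /tnorm mulr_sumr; apply: ler_sum => j _.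
have [jN|jN] := leqP j N; first by rewrite h // mul0r normr0 mul0r mulr0.
rewrite normrM (ger0_norm (exprn_ge0 _ e0)) mulrCA ler_wpM2l //.
have -> : e + e = 2 * e by ring.
rewrite [(2 * e) ^+ _]exprMn mulrA -[X in X <= _]mul1r ler_wpM2r ?exprn_ge0 //.
rewrite -(subnKC jN) exprD mulrA -exprMn.
have -> : 1 / 2 * 2 = 1 :> R by field.
by rewrite expr1n mul1r exprn_ege1 // ler1n.
Qed.

Lemma pow_diff_le (x y s : R) l : `|x| <= s -> `|y| <= s ->
  `|x ^+ l - y ^+ l| * s <= l%:R * s ^+ l * `|x - y|.
Proof.
move=> hx hy; have s0 : 0 <= s by apply: le_trans hx.
elim: l => [|l IH]; first by rewrite !expr0 subrr normr0 !mul0r.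
have -> : x ^+ l.+1 - y ^+ l.+1 = x * (x ^+ l - y ^+ l) + y ^+ l * (x - y) by rewrite !exprS; ring.
apply: (@le_trans _ _ ((s * `|x ^+ l - y ^+ l| + s ^+ l * `|x - y|) * s)).
  rewrite ler_wpM2r //; apply: le_trans (ler_normD _ _) _; rewrite !normrM.
  apply: lerD; first by rewrite ler_wpM2r.
  by rewrite ler_wpM2r // normrX lerXn2r // nnegrE.
have := ler_wpM2l s0 IH; rewrite -[l.+1%:R]natr1 exprS.
move: `|x ^+ l - y ^+ l| `|x - y| (l%:R : R) (s ^+ l) => A D L S; lra.
Qed.

Variables (d : nat).
Implicit Types (v h : 'rV[R]_d).

Lemma msimplex_homog (f : mindex d -> R) j N : (j <= N)%N ->
  \sum_(a <- msimplex d N | mdeg a == j) f a = \sum_(a <- msimplex d j | mdeg a == j) f a.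
Proof.
move=> jN; rewrite -big_filter -[RHS]big_filter; apply: perm_big; apply: uniq_perm.
- by rewrite filter_uniq ?msimplex_uniq.
- by rewrite filter_uniq ?msimplex_uniq.
move=> a; rewrite (mem_filter _ _ (msimplex d N)) (mem_filter _ _ (msimplex d j)).
by rewrite !mem_msimplex; case: eqP => //= ->; rewrite jN leqnn.
Qed.

Lemma sum_by_degree (f : mindex d -> R) N :
  \sum_(j < N.+1) \sum_(a <- msimplex d j | mdeg a == j) f a = \sum_(a <- msimplex d N) f a.
Proof.
transitivity (\sum_(j < N.+1) \sum_(a <- msimplex d N) f a *+ (mdeg a == j)).
  apply: eq_bigr => j _; rewrite -(@msimplex_homog _ _ N); last by rewrite -ltnS.
  by rewrite big_mkcond; apply: eq_bigr => a _; case: eqP; rewrite ?mulr1n ?mulr0n.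
rewrite exchange_big /= big_seq [RHS]big_seq; apply: eq_bigr => a; rewrite mem_msimplex => aN.
rewrite (bigD1 (Ordinal (aN : mdeg a < N.+1)%N)) //= eqxx mulr1n big1 ?addr0 // => j nj.
by case: eqP => // E; case/eqP: nj; apply: val_inj.
Qed.

Variables (c : mindex (d + 1) -> R) (p : mindex d -> R).

Variables (s q B Bp : R).
Hypotheses (s0 : 0 < s) (q0 : 0 < q).
Hypothesis cB : bounded_family (fun a => c a * (s + s) ^+ mdeg a) B.
Hypothesis pB : bounded_family (fun a => p a * q ^+ mdeg a) Bp.

Lemma tail_family_bounded (e : R) : 0 <= e -> e <= q -> forall h, (forall j, `|h ord0 j| <= e) ->
  bounded_family (fun a => (p a * monom a h) *+ (mdeg a != 0)%N) (e / q * Bp).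
Proof.
move=> e0 eq h hh; have -> : e / q * Bp = `|e / q| * Bp by rewrite ger0_norm // divr_ge0 // ltW.
apply: bounded_family_le (bounded_familyZ (e / q) pB) => a.
case: eqP => [_|/eqP na]; first by rewrite mulr0n normr0.
rewrite mulr1n !normrM mulrCA ler_wpM2l // normfV (ger0_norm e0) (gtr0_norm q0) (ger0_norm (exprn_ge0 _ (ltW q0))).
apply: le_trans (norm_monom_le _ hh) _.
have [n nE] : exists n, mdeg a = n.+1 by exists (mdeg a).-1; rewrite prednK // lt0n.
rewrite nE !exprS mulrA divfK ?gt_eqF // ler_wpM2l // lerXn2r // ?nnegrE // ltW //.
Qed.

Lemma horner_series_phs v (e : R) N : (series_poly (phs p v) N).[e] =
  \sum_(a <- msimplex d N) (p a * monom a (e *: v)) *+ (mdeg a != 0)%N.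
Proof.
rewrite horner_poly -sum_by_degree; apply: eq_bigr => j _.
rewrite /phs; case: eqP => [j0|/eqP nj].
  by rewrite mul0r big1 // => a /eqP ->; rewrite j0 eqxx mulr0n.
rewrite mulr_suml; apply: eq_bigr => a /eqP ha.
by rewrite ha nj mulr1n monomMl ha; ring.
Qed.

Lemma tnorm_series_phs v (e : R) n N : (forall j, `|v ord0 j| <= 1) -> 0 <= e -> e <= q ->
  tnorm e n (series_poly (phs p v) N) <= e / q * Bp.
Proof.
move=> hv e0 eq.
apply: (@le_trans _ _ (\sum_(a <- msimplex d N) `|(p a * monom a (const_mx e)) *+ (mdeg a != 0)%N|)); last first.
  apply: (tail_family_bounded e0 eq (h := const_mx e)); last exact: msimplex_uniq.
  by move=> j; rewrite mxE ger0_norm.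
rewrite -sum_by_degree.
apply: (@le_trans _ _ (tnorm e N (series_poly (phs p v) N))).
  have [nN|Nn] := leqP n N; first exact: tnorm_le.
  rewrite /tnorm [X in _ <= X](big_ord_widen n.+1 (fun i => `|(series_poly (phs p v) N)`_i| * e ^+ i)); last exact: ltnW.
  rewrite [X in _ <= X]big_mkcond; apply: ler_sum => i _; case: ifP => // h'.
  by rewrite coef_poly h' normr0 mul0r.
apply: ler_sum => j _; rewrite coef_poly ltn_ord /phs.
case: eqP => [j0|/eqP nj]; first by rewrite normr0 mul0r sumr_ge0.
apply: (@le_trans _ _ ((\sum_(a <- msimplex d j | mdeg a == j) `|p a|) * e ^+ j)).
  rewrite ler_wpM2r ?exprn_ge0 //; apply: le_trans (ler_norm_sum _ _ _) _; apply: ler_sum => a _.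
  rewrite normrM -[X in _ <= X]mulr1 ler_wpM2l //.
  by apply: le_trans (norm_monom_le (q := 1) _ hv) _; rewrite expr1n.
rewrite mulr_suml; apply: ler_sum => a /eqP ha.
by rewrite ha nj mulr1n monom_const ha normrM (ger0_norm (exprn_ge0 _ e0)).
Qed.

(** The terms of [(1/i!) d^i H / dy^i] at [(h, y)], in coordinates centred at the base point of
    [c]. *)
Definition root_term i h (y : R) (a : mindex (d + 1)) : R :=
  c a * 'C(rpart a, i)%:R * monom (lpart a) h * y ^+ (rpart a - i).

(** Replace [y] by its partial sum of degree [N] and truncate the double series. Along the line
    through [h] this is a polynomial in [t] without terms up to order [N], evaluated at [e];
    comparison with its norm at [2 e] makes it O(2^(-N)). *)
Lemma root_vanish i : (forall v, (forall j, `|v ord0 j| < 1) -> forall n, Acoef c p i v n = 0) ->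
  forall (e : R), 0 < e -> e + e <= q -> e + e <= s -> (e + e) / q * Bp <= s / 2 ->
  forall h y, (forall j, `|h ord0 j| < e) ->
    sums (fun a => (p a * monom a h) *+ (mdeg a != 0)%N) y ->
    sums (root_term i h y) 0.
Proof.
move=> hA e e0 eq es eB h y hh hy; have e0' := ltW e0; have s0' := ltW s0.
have s2 : 0 < s / 2 by rewrite divr_gt0.
have ee0 : 0 <= e + e by rewrite addr_ge0.
have e_le : e <= e + e by rewrite lerDl.
have Bp0 := bounded_family_ge0 pB.
have B0 := bounded_family_ge0 cB.
pose v := e^-1 *: h.
have hE : h = e *: v by rewrite /v scalerA divff ?scale1r // gt_eqF.
have v1 j : `|v ord0 j| < 1.
  by rewrite mxE normrM normfV (gtr0_norm e0) ltr_pdivrMl // mulr1.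
have v1' j : `|v ord0 j| <= 1 by apply: ltW.
have eBp : e / q * Bp <= s / 2.
  by apply: le_trans eB; rewrite ler_wpM2r // ler_wpM2r // invr_ge0 ltW.
have hb := tail_family_bounded e0' (le_trans e_le eq) (fun j => ltW (hh j)).
have ys : `|y| <= s / 2 by apply: le_trans (sums_norm_le hy hb) _.
pose W := B / s ^+ i.
have W0 : 0 <= W by rewrite divr_ge0 // exprn_ge0.
have xb (S : seq (mindex (d + 1))) : uniq S ->
    \sum_(a <- S) `|c a * 'C(rpart a, i)%:R * monom (lpart a) h| * s ^+ (rpart a - i) <= W.
  move=> uS; rewrite /W ler_pdivlMr ?exprn_gt0 // mulr_suml; apply: le_trans (cB uS).
  apply: ler_sum => a _; apply: le_trans (Lterm_le c i a v1' s0).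
  rewrite ler_wpM2r ?exprn_ge0 // exprD mulrA ler_wpM2r ?exprn_ge0 //.
  rewrite hE monomMl normrM (normrM (c a * _)) (normrM (e ^+ _)) (ger0_norm (exprn_ge0 _ e0')).
  rewrite mulrCA mulrC ler_wpM2l ?mulr_ge0 // lerXn2r // ?nnegrE //.
  exact: le_trans e_le es.
have Ub : bounded_family (root_term i h y) W.
  move=> S uS; apply: le_trans (xb S uS); apply: ler_sum => a _.
  rewrite /root_term normrM normrX ler_wpM2l // lerXn2r // ?nnegrE //.
  by apply: le_trans ys _; lra.
have [t ht] := @real_summation_complete R _ _ _ Ub.
suff t0 : t = 0 by rewrite -t0.
apply: normr_lt_all_eq0 => g g0.
have g3 : 0 < g / 3 by rewrite divr_gt0.
pose W2 := W / (s / 2).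
have W20 : 0 <= W2 by rewrite divr_ge0 // ltW.
have g4 : 0 < g / 3 / (W2 + 1) by rewrite divr_gt0 // ltr_wpDl.
have [_ /(_ _ g3) [S0 hS0]] := ht.
have [_ /(_ _ g4) [S1 hS1]] := hy.
have [N2 hN2] := half_pow_small W0 g3.
(* [N] is large enough for the truncated sum of the terms, for the partial sum of [y], and for the
   geometric error. *)
pose N := maxn (\max_(a <- S0) mdeg a) (maxn (\max_(a <- S1) mdeg a) N2).
pose sg := (series_poly (phs p v) N).[e].
pose G (y' : R) := \sum_(a <- msimplex (d + 1) (N + i)) root_term i h y' a.
have sgE : sg = \sum_(a <- msimplex d N) (p a * monom a h) *+ (mdeg a != 0)%N.
  by rewrite /sg horner_series_phs -hE.
have sgs : `|sg| <= s / 2.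
  rewrite sgE; apply: le_trans (ler_norm_sum _ _ _) _; apply: le_trans eBp.
  exact: hb (msimplex_uniq _ _).
have h1 : `|t - G y| < g / 3.
  apply: hS0; first exact: msimplex_uniq.
  move=> a aS; rewrite mem_msimplex; apply: leq_trans (leq_addr _ _).
  by apply: leq_trans (leq_maxl _ _); rewrite (big_rem a) //= leq_maxl.
have h2 : `|y - sg| < g / 3 / (W2 + 1).
  rewrite sgE; apply: hS1; first exact: msimplex_uniq.
  move=> a aS; rewrite mem_msimplex; apply: leq_trans (leq_maxr _ _).
  by apply: leq_trans (leq_maxl _ _); rewrite (big_rem a) //= leq_maxl.
have h3 : `|G sg| < g / 3.
  have GE : G sg = (evalS (Lg c i (N + i) v) (series_poly (phs p v) N)).[e].
    rewrite evalS_Lg horner_sum; apply: eq_bigr => a _.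
    rewrite hornerZ hornerM hornerXn horner_exp -/sg /root_term {1}hE monomMl; ring.
  rewrite GE; apply: le_lt_trans (horner_high_le (N := N) e0' _) _.
    by move=> j jN; rewrite Acoef_stable ?hA // leq_add2r.
  have tn : tnorm (e + e) (size (evalS (Lg c i (N + i) v) (series_poly (phs p v) N)))
      (evalS (Lg c i (N + i) v) (series_poly (phs p v) N)) <= W.
    apply: le_trans (weight_Lg _ _ v1' s0 cB).
    apply: (@tnorm_evalS R _ _ _ s s) => //.
    by apply: le_trans (tnorm_series_phs _ _ v1' ee0 eq) _; apply: le_trans eB _; lra.
  apply: le_lt_trans (_ : W * (1 / 2) ^+ N.+1 < _).
    by rewrite mulrC ler_wpM2r // exprn_ge0.
  by apply: hN2; rewrite ltnW // ltnS /N !leq_max leqnn !orbT.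
have h4 : `|G y - G sg| <= W2 * `|y - sg|.
  rewrite /G -sumrB /W2 mulrAC ler_pdivlMr // ; apply: le_trans (_ : _ <= W * `|y - sg|) _ => //.
  apply: le_trans (ler_wpM2r (ltW s2) (ler_norm_sum _ _ _)) _.
  rewrite mulr_suml; apply: le_trans (_ : _ <= _ * `|y - sg|) (ler_wpM2r _ (xb _ (msimplex_uniq _ (N + i)))) => //.
  rewrite mulr_suml; apply: ler_sum => a _; rewrite /root_term -mulrBr normrM -!mulrA ler_wpM2l //.
  apply: le_trans (pow_diff_le _ ys sgs) _; rewrite ler_wpM2r //.
  move: (rpart a - i)%N => l.
  have -> : s ^+ l = 2 ^+ l * (s / 2) ^+ l by rewrite -exprMn; congr (_ ^+ _); field.
  by rewrite ler_wpM2r ?exprn_ge0 ?(ltW s2) // -natrX ler_nat ltnW // ltn_expl.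
have h5 : W2 * `|y - sg| <= g / 3.
  apply: (@le_trans _ _ ((W2 + 1) * (g / 3 / (W2 + 1)))).
    by apply: ler_pM => //; [rewrite lerDl | apply: ltW].
  by rewrite mulrC divfK // gt_eqF // ltr_wpDl.
have k1 : `|t| <= `|t - G y| + `|G y| by rewrite -{1}[t](subrK (G y)) ler_normD.
have k2 : `|G y| <= `|G y - G sg| + `|G sg| by rewrite -{1}[G y](subrK (G sg)) ler_normD.
lra.
Qed.

End RootVanishing.

Lemma addn_subDr (x y z : nat) : (x + y + z - (y + z))%N = x.
Proof. by rewrite -addnA addnK. Qed.

(** * Division of the Taylor expansion in y by a power of the increment *)

Section QuotientSeries.
Variables (R : realType) (d : nat) (c : mindex (d + 1) -> R).
Implicit Types (h v : 'rV[R]_d) (y s t : R) (a : mindex (d + 1)) (b : mindex (d + 1 + 1)).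

(** Summing over [i] restores the series of [H] at [(h, y + s)]; summing over [a] gives [s ^+ i]
    times the [i]-th Taylor coefficient of [H] in [y]. *)
Definition taylor_pair h y s (ai : mindex (d + 1) * nat) : R :=
  root_term c ai.2 h y ai.1 * s ^+ ai.2.

Lemma taylor_pair_supp h y s a ai :
  ai \notin [seq (a, i) | i <- iota 0 (rpart a).+1] -> taylor_pair h y s ai *+ (ai.1 == a) = 0.
Proof.
case: ai => a' i; rewrite -[(a', i).1]/a'; case: (eqVneq a' a) => // -> nin.
rewrite mulr1n /taylor_pair /root_term.
case: (leqP i (rpart a)) => hi; last by rewrite bin_small // mulr0 !mul0r.
by case/negP: nin; apply: map_f; rewrite mem_iota ltnS.
Qed.

Lemma taylor_pairs_uniq a : uniq [seq (a, i) | i <- iota 0 (rpart a).+1].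
Proof. by rewrite map_inj_uniq ?iota_uniq // => i j []. Qed.

Lemma sum_taylor_pair h y s a :
  \sum_(ai <- [seq (a, i) | i <- iota 0 (rpart a).+1]) taylor_pair h y s ai *+ (ai.1 == a) =
  c a * monom a (row_mx h (y + s)%:M).
Proof.
rewrite big_map monom_row_mx -(@binomial_sum_widen _ _ _ _ (rpart a)) // mulrA mulr_sumr.
rewrite -[iota 0 _]/(index_iota 0 (rpart a).+1) big_mkord; apply: eq_bigr => i _.
by rewrite eqxx mulr1n /taylor_pair /root_term /=; ring.
Qed.

Lemma taylor_pair_bounded h y s t B : (forall j, `|h ord0 j| <= t) -> `|y| + `|s| <= t ->
  bounded_family (fun a => c a * t ^+ mdeg a) B -> bounded_family (taylor_pair h y s) B.
Proof.
move=> hh hys hB; have t0 : 0 <= t by apply: le_trans hys; rewrite addr_ge0.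
apply: (@bounded_family_fibers _ _ _ fst _ (fun a => `|c a * t ^+ mdeg a|)); last exact: hB.
move=> a S uS; apply: le_trans.
  by apply: (bounded_family_finite (taylor_pairs_uniq a) (@taylor_pair_supp h y s a)).
rewrite big_map -[iota 0 _]/(index_iota 0 (rpart a).+1) big_mkord.
apply: (@le_trans _ _ (`|c a| * t ^+ mdeg (lpart a) * (`|y| + `|s|) ^+ rpart a)).
  rewrite -(@binomial_sum_widen _ _ _ _ (rpart a)) // mulr_sumr; apply: ler_sum => i _.
  rewrite /= eqxx mulr1n /taylor_pair /root_term /= !normrM !normrX normr_nat.
  have -> : `|c a| * 'C(rpart a, i)%:R * `|monom (lpart a) h| * `|y| ^+ (rpart a - i) * `|s| ^+ i =
    `|c a| * `|monom (lpart a) h| * ('C(rpart a, i)%:R * `|y| ^+ (rpart a - i) * `|s| ^+ i) by ring.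
  rewrite ler_wpM2r ?mulr_ge0 ?exprn_ge0 // ler_wpM2l //.
  exact: norm_monom_le.
rewrite normrM (ger0_norm (exprn_ge0 _ t0)) mdeg_parts exprD mulrA.
by rewrite ler_wpM2l ?mulr_ge0 ?exprn_ge0 // lerXn2r // nnegrE // addr_ge0.
Qed.

Lemma sums_taylor_pair h y s t B x : (forall j, `|h ord0 j| <= t) -> `|y| + `|s| <= t ->
  bounded_family (fun a => c a * t ^+ mdeg a) B ->
  sums (fun a => c a * monom a (row_mx h (y + s)%:M)) x -> sums (taylor_pair h y s) x.
Proof.
move=> hh hys hB hx.
apply: (sums_unpack (@real_summation_complete R) (p := fst) (taylor_pair_bounded hh hys hB) _ hx) => a.
rewrite -sum_taylor_pair; apply: sums_finite; first exact: taylor_pairs_uniq.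
exact: taylor_pair_supp.
Qed.

(* The coefficients of [sum_(i >= k) s^(i - k) H_i(x, y)], [H_i] being the [i]-th
   Taylor coefficient of [H] in [y]. *)
Definition quot_coef (k : nat) b : R :=
  let l := (rpart (lpart b) + rpart b + k)%N in
  c (mjoin (lpart (lpart b)) l) * 'C(l, rpart b + k)%:R.

(** Identifies the indices of the quotient with the pairs [(a, i)] such that [k <= i <= rpart a],
    which support the part divisible by [s ^+ k]. *)
Definition quot_pair k b : mindex (d + 1) * nat :=
  (mjoin (lpart (lpart b)) (rpart (lpart b) + rpart b + k), (rpart b + k)%N).

Definition pair_quot k (ai : mindex (d + 1) * nat) : mindex (d + 1 + 1) :=
  mjoin (mjoin (lpart ai.1) (rpart ai.1 - ai.2)) (ai.2 - k).

Lemma quot_pairK k : cancel (quot_pair k) (pair_quot k).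
Proof.
move=> b; rewrite /quot_pair /pair_quot /= lpart_mjoin rpart_mjoin addnK.
by rewrite addn_subDr !mjoin_parts.
Qed.

Lemma taylor_pair_quot k h y s b : taylor_pair h y s (quot_pair k b) =
  s ^+ k * (quot_coef k b * monom b (row_mx (row_mx h y%:M) s%:M)).
Proof.
rewrite /taylor_pair /root_term /quot_coef /= !monom_row_mx lpart_mjoin rpart_mjoin.
by rewrite addn_subDr exprD; ring.
Qed.

(** Cauchy estimate at [h = (t, ..., t)] and [y = s = t], where [|y| + |s| = t + t]. *)
Lemma quot_coef_bounded k t : 0 < t -> poly_bounded c (t + t) -> poly_bounded (quot_coef k) t.
Proof.
move=> t0 [B hB]; exists (`|t ^- k| * B); have t0' := ltW t0.
have h1 : bounded_family (taylor_pair (const_mx t) t t) B.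
  apply: (taylor_pair_bounded _ _ hB); last by rewrite ger0_norm.
  by move=> j; rewrite mxE ger0_norm // lerDl.
apply: bounded_family_le (bounded_familyZ (t ^- k) (bounded_family_comp (can_inj (quot_pairK k)) h1)) => b.
rewrite taylor_pair_quot mulKf ?expf_neq0 ?gt_eqF // !monom_row_mx monom_const.
by rewrite [in mdeg b]mdeg_parts mdeg_parts !exprD.
Qed.

(** The Taylor terms of index below [k] vanish, so [H(h, y + s) = s^k K(h, y, s)]; the left side is
    0 and [s] is not. *)
Lemma quot_vanish k h y s t B x : (forall j, `|h ord0 j| <= t) -> `|y| + `|s| <= t ->
  bounded_family (fun a => c a * t ^+ mdeg a) B -> s != 0 ->
  sums (fun a => c a * monom a (row_mx h (y + s)%:M)) 0 ->
  (forall i, (i < k)%N -> sums (root_term c i h y) 0) ->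
  sums (fun b => quot_coef k b * monom b (row_mx (row_mx h y%:M) s%:M)) x -> x = 0.
Proof.
move=> hh hys hB sn0 hH hroot hx.
have Ub := taylor_pair_bounded hh hys hB.
have U0 := sums_taylor_pair hh hys hB hH.
have low : sums (fun ai => \sum_(i <- iota 0 k) taylor_pair h y s ai *+ (ai.2 == i)) 0.
  have z : \sum_(i <- iota 0 k) (0 : R) = 0 by rewrite big1.
  rewrite -[X in sums _ X]z.
  apply: (sums_sum (w := fun=> 0)) => i; rewrite mem_iota add0n => /andP [_ ik].
  have bi : bounded_family (fun ai => taylor_pair h y s ai *+ (ai.2 == i)) B.
    by apply: bounded_family_le Ub => ai; rewrite normrMb ler_mulrb.
  apply/(sums_reindex (@real_summation_complete R) (f := fun a => (a, i)) (g := fst) _ bi) => //.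
    by case=> a i' /=; case: (eqVneq i' i) => [->//|_]; rewrite mulr0n eqxx.
  have := sumsZ (s ^+ i) (hroot i ik); rewrite mulr0; apply: eq_sums => a /=.
  by rewrite eqxx mulr1n /taylor_pair mulrC.
have low' : sums (fun ai => taylor_pair h y s ai *+ (ai.2 < k)%N) 0.
  apply: eq_sums low => ai; rewrite (sum_indic_fiber snd (taylor_pair h y s)) ?iota_uniq //.
  by rewrite mem_iota add0n.
have high : sums (fun ai => taylor_pair h y s ai *+ (k <= ai.2)%N) 0.
  have := sumsB U0 low'; rewrite subrr; apply: eq_sums => ai.
  by case: ltnP; rewrite ?mulr1n ?mulr0n ?subrr ?subr0.
have highb : bounded_family (fun ai => taylor_pair h y s ai *+ (k <= ai.2)%N) B.
  by apply: bounded_family_le Ub => ai; rewrite normrMb ler_mulrb.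
have gf ai : taylor_pair h y s ai *+ (k <= ai.2)%N != 0 -> quot_pair k (pair_quot k ai) = ai.
  case: ai => a i /=; case: leqP => ki; last by rewrite mulr0n eqxx.
  rewrite mulr1n => ne.
  have ia : (i <= rpart a)%N.
    rewrite leqNgt; apply/negP => l; case/eqP: ne.
    by rewrite /taylor_pair /root_term /= bin_small // mulr0 !mul0r.
  rewrite /quot_pair /pair_quot /= !lpart_mjoin !rpart_mjoin subnK //; congr (_, _).
  by rewrite -addnA subnK // subnK // mjoin_parts.
have K0 := (sums_reindex (@real_summation_complete R) 0 highb (quot_pairK k) gf).2 high.
have := sumsZ (s ^+ k) hx => hx'.
have E : s ^+ k * x = 0.
  apply: sums_uniq hx' _; apply: eq_sums K0 => b /=.
  by rewrite leq_addl mulr1n taylor_pair_quot.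
by move/eqP: E; rewrite mulf_eq0 expf_eq0 (negPf sn0) andbF => /eqP.
Qed.

(** At increment 0, which is the factor [0 ^+ rpart b], the quotient reduces to the [k]-th Taylor
    coefficient of [H] in [y]. This links the jets of the quotient to [Acoef]. *)
Lemma sum_quot_coef k N v (S : {poly R}) :
  \sum_(b <- msimplex (d + 1 + 1) N) quot_coef k b *:
    ((monom (lpart (lpart b)) v *: 'X^(mdeg (lpart (lpart b)))) * S ^+ rpart (lpart b) * 0 ^+ rpart b) =
  evalS (Lg c k (N + k) v) S.
Proof.
rewrite evalS_Lg.
pose f a := (c a * 'C(rpart a, k)%:R * monom (lpart a) v) *: ('X^(mdeg (lpart a)) * S ^+ (rpart a - k)).
pose T b := mjoin (lpart (lpart b)) (rpart (lpart b) + k).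
transitivity (\sum_(a <- [seq T b | b <- [seq b <- msimplex (d + 1 + 1) N | rpart b == 0%N]]) f a).
  rewrite big_map big_filter [RHS]big_mkcond; apply: eq_bigr => b _.
  case: eqP => [b0|nb]; last by rewrite expr0n; case: eqP => // _; rewrite mulr0 scaler0.
  rewrite b0 expr0 mulr1 /f /T /quot_coef b0 addn0 add0n lpart_mjoin rpart_mjoin addnK.
  by rewrite -scalerAl scalerA.
rewrite [RHS](bigID (fun a => (k <= rpart a)%N)) /= [X in _ + X]big1 ?addr0; last first.
  by move=> a; rewrite -ltnNge => l; rewrite bin_small // mulr0 mul0r scale0r.
rewrite -[RHS]big_filter; apply: perm_big; apply: uniq_perm.
- rewrite map_inj_in_uniq ?filter_uniq ?mbox_uniq // => b b'.
  rewrite (mem_filter _ _ (msimplex _ _)) => /andP [/eqP b0 _].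
  rewrite (mem_filter _ _ (msimplex _ _)) => /andP [/eqP b0' _] E.
  rewrite -(mjoin_parts b) -(mjoin_parts b') b0 b0'; congr mjoin.
  rewrite -(mjoin_parts (lpart b)) -(mjoin_parts (lpart b')).
  have := congr1 (@lpart d) E; have := congr1 (@rpart d) E.
  by rewrite /T !lpart_mjoin !rpart_mjoin => /addIn -> ->.
- by rewrite ?filter_uniq ?mbox_uniq.
move=> a; rewrite (mem_filter _ _ (msimplex (d + 1) (N + k))) mem_msimplex; apply/mapP/idP.
  move=> [b]; rewrite (mem_filter _ _ (msimplex _ _)) mem_msimplex => /andP [/eqP b0 bN] ->.
  rewrite /T rpart_mjoin leq_addl mdeg_mjoin addnA leq_add2r.
  by move: bN; rewrite mdeg_parts b0 addn0 mdeg_parts.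
move=> /andP [ka aN]; exists (mjoin (mjoin (lpart a) (rpart a - k)) 0).
  rewrite (mem_filter _ _ (msimplex _ _)) mem_msimplex rpart_mjoin eqxx !mdeg_mjoin addn0.
  by rewrite -(leq_add2r k) -addnA subnK // -mdeg_parts.
by rewrite /T !lpart_mjoin rpart_mjoin subnK // mjoin_parts.
Qed.

End QuotientSeries.

(** * Local solutions *)

Section Expansions.
Variables (R : realType) (d : nat).

Lemma mdeg0P (a : mindex d) : mdeg a = 0%N -> a = [ffun=> 0%N].
Proof.
move=> h; apply/ffunP => i; rewrite ffunE; apply/eqP; rewrite -leqn0 -h; exact: mdeg_ge.
Qed.

Lemma mdeg_zero : mdeg ([ffun=> 0%N] : mindex d) = 0%N.
Proof. by rewrite /mdeg big1 // => i _; rewrite ffunE. Qed.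

Lemma monom_deg0 (a : mindex d) (x : 'rV[R]_d) : mdeg a = 0%N -> monom a x = 1.
Proof. by move=> /mdeg0P ->; rewrite /monom big1 // => i _; rewrite ffunE expr0. Qed.

Lemma sums_nonconstant (c : mindex d -> R) (h : 'rV[R]_d) s : sums (fun a => c a * monom a h) s ->
  sums (fun a => (c a * monom a h) *+ (mdeg a != 0)%N) (s - c [ffun=> 0%N]).
Proof.
move=> hs.
have h1 : sums (fun a => (c a * monom a h) *+ (mdeg a == 0)%N) (c [ffun=> 0%N]).
  have := @sums_single _ _ (fun a => (c a * monom a h) *+ (mdeg a == 0)%N) [ffun=> 0%N].
  rewrite monom_deg0 ?mdeg_zero // eqxx mulr1 mulr1n; apply=> a na.
  by case: eqP => // /mdeg0P E; case/eqP: na.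
apply: eq_sums (sumsB hs h1) => a.
by case: eqP; rewrite ?mulr1n ?mulr0n ?subrr ?subr0.
Qed.

Lemma expansion_center (K : 'rV[R]_d -> R) x (r : R) c : 0 < r -> expansion K x r c ->
  K x = c [ffun=> 0%N].
Proof.
move=> r0 hK; have := hK x; rewrite subrr => /(_ _) h.
have {h} := h (fun i => eq_ind_r (fun u => `|u| < r) (eq_ind_r (fun u => u < r) r0 (normr0 R)) (subrr (x ord0 i))).
move=> /sums_nonconstant h; apply/eqP; rewrite -subr_eq0; apply/eqP; apply: sums_uniq h _.
apply: eq_sums (sums0 R (mindex d)) => a; case: eqP => //= /eqP na.
rewrite mulr1n -(scale0r (0 : 'rV[R]_d)) monomMl expr0n (negPf na) mul0r mulr0 //.
Qed.

Lemma expansion_continuous (K : 'rV[R]_d -> R) (x w : 'rV[R]_d) (r : R) c : 0 < r -> expansion K x r c ->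
  (forall i, `|w ord0 i - x ord0 i| < r) -> {for w, continuous K}.
Proof.
move=> r0 hK hw.
have [q [q0 qr hq]] := finite_max_lt r0 (fun i => normr_ge0 (w ord0 i - x ord0 i)) hw.
have rq : 0 < r - q by rewrite subr_gt0.
have hs := expansion_shift (@real_summation_complete R) q0 qr hK hq.
set c' := shift_coef _ _ in hs.
have r2 : 0 < (r - q) / 2 by rewrite divr_gt0.
have r2r : (r - q) / 2 < r - q by rewrite ltr_pdivrMr // ltr_pMr // ltr1n.
have [C C0 hC] := expansion_tail 0 hs r2 r2r.
have E y : \sum_(a <- msimplex d 0) c' a * monom a (y - w) = K w.
  rewrite (expansion_center rq hs).
  have -> : msimplex d 0 = [:: [ffun=> 0%N]].
    apply: perm_small_eq => //; apply: uniq_perm => //; first exact: msimplex_uniq.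
    move=> a; rewrite mem_msimplex leqn0 inE; apply/eqP/eqP => [/mdeg0P //|->].
    exact: mdeg_zero.
  by rewrite big_seq1 monom_deg0 ?mdeg_zero // mulr1.
apply/(cvgrPdist_le (FF := nbhs_filter w)) => e e0.
have C1 : 0 < C + 1 by rewrite ltr_wpDl.
pose t := Num.min ((r - q) / 2) (e / (C + 1)).
have t0 : 0 < t by rewrite lt_min r2 divr_gt0.
apply/nbhs_boxP; exists t => // y hy /=; rewrite distrC -(E y).
apply: le_trans (hC y t (fun i => ltW (hy i)) (ltW t0) _) _; first by rewrite ge_min lexx.
rewrite expr1; apply: (@le_trans _ _ ((C + 1) * t)); first by rewrite ler_wpM2r ?(ltW t0) // lerDl.
by rewrite mulrC -ler_pdivlMr // ge_min lexx orbT.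
Qed.

End Expansions.

Section PowerSums.
Variables (K : numFieldType) (d : nat).
Hypothesis KC : summation_complete K.

Definition psum (c : mindex d -> K) (x y : 'rV[K]_d) : K :=
  xget 0 [set s | sums (fun a => c a * monom a (y - x)) s].

Lemma expansion_psum c x (q : K) : 0 <= q -> poly_bounded c q -> expansion (psum c x) x q c.
Proof.
move=> q0 [B hB] y hy.
have hb : bounded_family (fun a => c a * monom a (y - x)) B.
  apply: bounded_family_le hB => a; rewrite !normrM ler_wpM2l //.
  rewrite [X in _ <= X]ger0_norm ?exprn_ge0 //.
  by apply: norm_monom_le => i; rewrite !mxE ltW.
have [s hs] := KC hb.
exact: (@xgetI _ 0 [set s | sums (fun a => c a * monom a (y - x)) s] s hs).
Qed.

End PowerSums.

Section LocalSolution.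
Variables (R : realType) (d : nat) (z : 'rV[R]_d) (H : 'rV[R]_(d + 1) -> R) (r : R).
Variables (c : mindex (d + 1) -> R) (F : 'rV[R]_d -> R) (V Om : set 'rV[R]_d).
Hypotheses (r0 : 0 < r) (hH : expansion H (row_mx z (F z)%:M) r c).
Hypothesis c0 : exists a, c a != 0.
Hypotheses (oV : open V) (sF : smooth_on V F) (Vz : V z).
Hypotheses (oOm : open Om) (OmV : Om `<=` V).
Hypothesis zOm : forall q : R, 0 < q -> exists2 u : 'rV[R]_d, Om u & forall i, `|u ord0 i - z ord0 i| < q.
Hypothesis HOm : forall x, Om x -> H (row_mx x (F x)%:M) = 0.

Let p := taylor_coef F z.

Lemma taylor_coef_zero : p [ffun=> 0%N] = F z.
Proof.
rewrite /p /taylor_coef mdeg_zero fact0 divr1 /= big_cons big_nil.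
case: eqP => [_|n]; first by rewrite addr0.
by case: n; apply/ffunP => i; rewrite !ffunE.
Qed.

Lemma jet_series v N :
  \poly_(n < N.+1) (dirD v n F z / n`!%:R) - (F z)%:P = series_poly (phs p v) N.
Proof.
apply/polyP => i; rewrite coefB coefC !coef_poly dirD_taylor /phs.
case: eqP => [->|_]; last by rewrite subr0.
rewrite -taylor_coef_zero /=.
have -> : msimplex d 0 = [:: [ffun=> 0%N]].
  apply: perm_small_eq => //; apply: uniq_perm => //; first exact: msimplex_uniq.
  move=> a; rewrite mem_msimplex leqn0 inE; apply/eqP/eqP => [/mdeg0P //|->].
  exact: mdeg_zero.
by rewrite big_cons big_nil mdeg_zero eqxx monom_deg0 ?mdeg_zero // mulr1 addr0 subrr.
Qed.

(** [H(x, F(x))] vanishes on the open set [Om], which accumulates at [z], so its jets at [z] are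
    zero by [jet_flat]; by [jet_comp] their coefficients are the [Acoef] of index 0. *)
Lemma graph_flat v i : Acoef c p 0 v i = 0.
Proof.
pose J (j : 'I_(d + 1)) : 'rV[R]_d -> {poly R} :=
  if fintype.split j is inl j' then fun w => (w ord0 j')%:P + v ord0 j' *: 'X
  else fun w => \poly_(n < i.+1) (dirD v n F w / n`!%:R).
have Jl j : J (lshift 1 j) = fun w => (w ord0 j)%:P + v ord0 j *: 'X.
  by rewrite /J; have -> : fintype.split (lshift 1 j) = inl j by exact: (unsplitK (inl j)).
have Jr : J (rshift d ord0) = fun w => \poly_(n < i.+1) (dirD v n F w / n`!%:R).
  by rewrite /J; have -> : fintype.split (rshift d (ord0 : 'I_1)) = inr ord0 by exact: (@unsplitK d 1 (inr ord0)).
have hJ j : jet z v i.+1 (fun w => (row_mx w (F w)%:M) ord0 j) (J j).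
  move: j; apply: forall_row_mx => [j|].
    rewrite Jl; apply: jet_ext (jet_coord _ _ _ _).
    by apply: (@filterE _ (nbhs z)) => w; rewrite row_mx_l.
  rewrite Jr; apply: jet_ext (jet_smooth _ _ oV sF Vz).
  by apply: (@filterE _ (nbhs z)) => w; rewrite row_mx_r.
have [JK [hJK JKz]] := jet_comp (Psi := fun w => row_mx w (F w)%:M) r0 hH hJ.
have : (JK z)`_i = 0.
  apply: (jet_flat hJK) => // q q0; have [u Ou hu] := zOm q0; exists u; split=> //.
  by apply: filterS (open_nbhs_nbhs (conj oOm Ou)) => y; apply: HOm.
move=> JK0; rewrite -[RHS]JK0 JKz /Acoef addn0 evalS_Lg.
apply: (congr1 (fun P : {poly R} => P`_i)).
apply: eq_bigr => a _.
rewrite bin0 mulr1 subn0 prod_parts Jr row_mx_r jet_series -[LHS]scalerA; congr (_ *: _).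
rewrite [LHS]scalerAl -(line_monom z); congr (_ * _).
by apply: eq_bigr => j _; rewrite Jl row_mx_l.
Qed.

Lemma local_solution : exists2 q : R, 0 < q & poly_bounded p q /\
  forall x, Om x -> (forall i, `|x ord0 i - z ord0 i| < q) ->
    sums (fun a => p a * monom a (x - z)) (F x).
Proof.
have [k [m [v0 [hv0 A0 lowk lowm]]]] := minimal_nonflat c0 graph_flat.
pose s := r / 4.
have s0 : 0 < s by rewrite divr_gt0.
have ssr : s + s < r by have := r0; rewrite /s; lra.
have ss0 : 0 <= s + s by rewrite addr_ge0 // ltW.
have [B hB] := expansion_poly_bounded hH ss0 ssr.
have [C [K [C0 K0 hp]]] := formal_solution_bound s0 hB hv0 A0 (lowk k (leqnn k)) lowm.
(* Half the radius allowed by [hp], so that the majorant has ratio 1/2. *)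
pose q := (1 / 2) / K.
have q0 : 0 < q by rewrite !divr_gt0.
have pq : poly_bounded p q.
  by apply: (geometric_poly_bounded C0 (ltW K0) (ltW q0) _ hp); rewrite /q mulrC divfK // gt_eqF.
have [Bp hBp] := pq; have Bp0 := bounded_family_ge0 hBp.
pose phi := psum p z.
have hphi : expansion phi z q p by apply: (expansion_psum (@real_summation_complete R)) pq; apply: ltW.
have phiz : phi z = F z by rewrite (expansion_center q0 hphi) taylor_coef_zero.
have s2 : 0 < s / 2 by rewrite divr_gt0.
have Bq : 0 <= 2 / q * Bp by rewrite mulr_ge0 // divr_ge0 // ltW.
have [e1 e10 he1] := small_mult Bq s2.
(* The three bounds give the three smallness conditions on [e] in [root_vanish]. *)
pose e := Num.min (Num.min (q / 2) (s / 2)) e1.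
have e0 : 0 < e by rewrite !lt_min e10 s2 divr_gt0.
have eq : e + e <= q.
  have : e <= q / 2 by rewrite !ge_min lexx.
  by lra.
have es : e + e <= s.
  have : e <= s / 2 by rewrite !ge_min lexx orbT.
  by lra.
have eB : (e + e) / q * Bp <= s / 2.
  have -> : (e + e) / q * Bp = e * (2 / q * Bp) by ring.
  by apply: he1; [exact: ltW | rewrite !ge_min lexx orbT].
have eq1 : e < q by lra.
(* If [F] left the graph of [phi] arbitrarily close to [z], the quotient series [KK] would vanish
   at [(w, phi w, F w - phi w)] near such points [w]; in the limit its jet at [z], which is the
   nonzero jet of the [k.+1]-st [y]-derivative of [H] along [F], would vanish. *)
have [e2 e20 he2] : exists2 e2 : R, 0 < e2 & forall x, Om x ->
    (forall i, `|x ord0 i - z ord0 i| < e2) -> F x = phi x.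
  apply: contrapT => no.
  pose D w := F w - phi w.
  pose Psi w := row_mx (row_mx w (phi w)%:M) (D w)%:M.
  pose kap := quot_coef c k.+1.
  have kapb : poly_bounded kap s by apply: quot_coef_bounded => //; exists B.
  have hK : expansion (psum kap (Psi z)) (Psi z) s kap by apply: (expansion_psum (@real_summation_complete R)) kapb; apply: ltW.
  set KK := psum kap (Psi z) in hK.
  have Dz : D z = 0 by rewrite /D phiz subrr.
  have Jid j : jet z v0 m.+1 (fun w => w ord0 j) (fun w => (w ord0 j)%:P + v0 ord0 j *: 'X).
    exact: jet_coord.
  have [Jphi [hJphi Jphiz]] := jet_comp (Psi := id) q0 hphi Jid.
  (* [F] and [phi] have the same jet at [z], so the last argument [D] of the quotient has zero jet
     there. *)
  have JphiE : Jphi z = \poly_(n < m.+1) (dirD v0 n F z / n`!%:R).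
    rewrite Jphiz; apply/polyP => n; rewrite coef_poly dirD_taylor.
    rewrite (eq_bigr (fun a => (p a * monom a v0) *: 'X^(mdeg a))); last first.
      by move=> a _; rewrite line_monom scalerA.
    rewrite coef_sum_homog ltnS; case: leqP => nm; first by rewrite msimplex_homog.
    rewrite big1_seq // => a /andP [/eqP h1]; rewrite mem_msimplex h1 leqNgt nm //.
  have hJF := jet_smooth v0 m.+1 oV sF Vz.
  have hJD := jetB hJF hJphi.
  pose J1 (j : 'I_(d + 1)) : 'rV[R]_d -> {poly R} :=
    if fintype.split j is inl j' then fun w => (w ord0 j')%:P + v0 ord0 j' *: 'X else Jphi.
  pose J2 (j : 'I_(d + 1 + 1)) : 'rV[R]_d -> {poly R} :=
    if fintype.split j is inl j' then J1 j'
    else fun w => \poly_(n < m.+1) (dirD v0 n F w / n`!%:R) - Jphi w.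
  have J1l j : J1 (lshift 1 j) = fun w => (w ord0 j)%:P + v0 ord0 j *: 'X.
    by rewrite /J1; have -> : fintype.split (lshift 1 j) = inl j by exact: (unsplitK (inl j)).
  have J1r : J1 (rshift d ord0) = Jphi.
    by rewrite /J1; have -> : fintype.split (rshift d (ord0 : 'I_1)) = inr ord0 by exact: (@unsplitK d 1 (inr ord0)).
  have J2l j : J2 (lshift 1 j) = J1 j.
    by rewrite /J2; have -> : fintype.split (lshift 1 j) = inl j by exact: (unsplitK (inl j)).
  have J2r : J2 (rshift (d + 1) ord0) = fun w => \poly_(n < m.+1) (dirD v0 n F w / n`!%:R) - Jphi w.
    by rewrite /J2; have -> : fintype.split (rshift (d + 1) (ord0 : 'I_1)) = inr ord0 by exact: (@unsplitK (d + 1) 1 (inr ord0)).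
  have hJ j : jet z v0 m.+1 (fun w => Psi w ord0 j) (J2 j).
    move: j; apply: forall_row_mx => [|]; last first.
      rewrite J2r; apply: jet_ext hJD.
      by apply: (@filterE _ (nbhs z)) => w; rewrite /Psi row_mx_r.
    apply: forall_row_mx => [j|]; rewrite J2l.
      rewrite J1l; apply: jet_ext (Jid j).
      by apply: (@filterE _ (nbhs z)) => w; rewrite /Psi !row_mx_l.
    rewrite J1r; apply: jet_ext hJphi.
    by apply: (@filterE _ (nbhs z)) => w; rewrite /Psi row_mx_l row_mx_r.
  have [JK [hJK JKz]] := jet_comp s0 hK hJ.
  have JKE : JK z = evalS (Lg c k.+1 (m + k.+1) v0) (series_poly (phs p v0) m).
    rewrite JKz -sum_quot_coef; apply: eq_bigr => b _; congr (_ *: _).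
    rewrite !prod_parts J2r {3}/Psi row_mx_r Dz JphiE subrr subr0; congr (_ * _ * _).
      rewrite -(line_monom z); apply: eq_bigr => j _.
      by rewrite J2l J1l /Psi !row_mx_l.
    by rewrite J2l J1r /Psi row_mx_l row_mx_r JphiE phiz jet_series.
  have : (JK z)`_m = 0; last first.
    by rewrite JKE Acoef_stable // => /eqP; rewrite (negPf A0).
  apply: (jet_flat hJK) => // t t0.
  have cphi (w : 'rV[R]_d) : (forall i, `|w ord0 i - z ord0 i| < q) -> {for w, continuous phi}.
    exact: expansion_continuous q0 hphi.
  have [e3 e30 he3] : exists2 e3 : R, 0 < e3 &
      forall x : 'rV[R]_d, (forall i, `|x ord0 i - z ord0 i| < e3) -> `|D x| < s / 2.
    have h1 : phi w @[w --> z] --> phi z by apply: cphi => i; rewrite subrr normr0.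
    have [h2 _] := sF [::] Vz.
    have h4 : (fun w => F w - phi w) w @[w --> z] --> F z - phi z by exact: (cvgB h2 h1).
    have /(cvgrPdist_lt (FF := nbhs_filter z)) /(_ _ s2) := h4.
    move=> /nbhs_boxP [e3 e30 h3]; exists e3 => // x /h3 /=.
    by rewrite /= phiz subrr sub0r normrN.
  (* [t] is the distance asked for by [jet_flat], [e3] keeps [D] below [s / 2], and [e] allows
     [root_vanish]. *)
  pose g := Num.min (Num.min t e3) e.
  have g0 : 0 < g by rewrite lt_min e0 lt_min t0 e30.
  have [u [Ou hu nu]] : exists u : 'rV[R]_d, [/\ Om u, forall i, `|u ord0 i - z ord0 i| < g & F u != phi u].
    apply: contrapT => no'; apply: no; exists g => // x Ox hx; apply/eqP; apply/negP => /negP nx.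
    by apply: no'; exists x.
  have gt : g <= t by rewrite !ge_min lexx.
  have ge3 : g <= e3 by rewrite !ge_min lexx orbT.
  have ge : g <= e by rewrite ge_min lexx orbT.
  exists u; split; first by move=> i; apply: lt_le_trans (hu i) gt.
  have N1 : nbhs u [set w : 'rV[R]_d | forall i, `|w ord0 i - z ord0 i| < g].
    have [g' [g'0 g'g hg']] := finite_max_lt g0 (fun i => normr_ge0 (u ord0 i - z ord0 i)) hu.
    apply/nbhs_boxP; exists (g - g'); first by rewrite subr_gt0.
    move=> w hw i.
    have -> : w ord0 i - z ord0 i = (w ord0 i - u ord0 i) + (u ord0 i - z ord0 i) by ring.
    apply: le_lt_trans (ler_normD _ _) _; rewrite -[g](subrK g').
    by apply: ltr_leD; [exact: hw | exact: hg'].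
  have N2 : nbhs u Om by apply: open_nbhs_nbhs.
  have N3 : nbhs u [set w : 'rV[R]_d | D w != 0].
    have h1 : phi w @[w --> u] --> phi u.
      by apply: cphi => i; apply: lt_trans (lt_le_trans (hu i) ge) eq1.
    have [h2 _] := sF [::] (OmV Ou).
    have Du : 0 < `|D u| by rewrite normr_gt0 subr_eq0.
    have h4 : (fun w => F w - phi w) w @[w --> u] --> F u - phi u by exact: (cvgB h2 h1).
    have /(cvgrPdist_lt (FF := nbhs_filter u)) /(_ _ Du) := h4.
    apply: filterS => w h; apply/eqP => D0; move: h => /=.
    rewrite -/(D u) -[X in `|_ - X| < _]/(D w) D0 subr0 ltxx //.
  apply: filterS (filterI N1 (filterI N2 N3)) => w [hw [Ow nDw]].
  pose h := w - z.
  have hE j : h ord0 j = w ord0 j - z ord0 j by rewrite !mxE.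
  have hh j : `|h ord0 j| < e by rewrite hE; apply: lt_le_trans (hw j) ge.
  pose y := phi w - F z.
  have hwq j : `|w ord0 j - z ord0 j| < q by apply: lt_trans (lt_le_trans (hw j) ge) eq1.
  have ysum : sums (fun a => (p a * monom a h) *+ (mdeg a != 0)%N) y.
    by rewrite /y -taylor_coef_zero; apply: sums_nonconstant; apply: hphi.
  have ys : `|y| <= s / 2.
    have e_le : e <= q by apply: ltW.
    have := tail_family_bounded q0 hBp (ltW e0) e_le (fun j => ltW (hh j)).
    move=> /(sums_norm_le ysum) /le_trans; apply; apply: le_trans eB.
    by rewrite !ler_wpM2r ?invr_ge0 ?(ltW q0) // lerDl ltW.
  have Dw : `|D w| < s / 2 by apply: he3 => i; apply: lt_le_trans (hw i) ge3.
  have root i : (i < k.+1)%N -> sums (root_term c i h y) 0.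
    move=> ik; apply: (root_vanish s0 q0 hB hBp _ e0 eq es eB hh ysum).
    exact: lowk.
  have hs j : `|h ord0 j| <= s + s by apply: ltW; apply: lt_le_trans (hh j) _; lra.
  have yD : `|y| + `|D w| <= s + s by lra.
  have yDE : y + D w = F w - F z by rewrite /y /D; ring.
  have H0 : sums (fun a => c a * monom a (row_mx h (y + D w)%:M)) 0.
    rewrite -(HOm Ow) yDE /h -row_mx_scalarB; apply: hH.
    apply: forall_row_mx => [j|]; rewrite ?row_mx_l ?row_mx_r.
      by have := hs j; rewrite hE; lra.
    by rewrite -yDE; apply: le_lt_trans (ler_normD _ _) _; lra.
  apply: (quot_vanish hs yD hB nDw H0 root).
  have PsiE : Psi w - Psi z = row_mx (row_mx h y%:M) (D w)%:M.
    by rewrite /Psi row_mx_scalarB row_mx_scalarB Dz subr0 phiz.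
  have := hK (Psi w); rewrite PsiE; apply.
  apply: forall_row_mx => [|]; last by rewrite /Psi !row_mx_r Dz subr0; lra.
  apply: forall_row_mx => [j|]; rewrite /Psi !row_mx_l ?row_mx_r.
    by rewrite -hE; apply: lt_le_trans (hh j) _; lra.
  by rewrite phiz -/y; lra.
exists (Num.min e2 q); first by rewrite lt_min e20.
split.
  have [B' hB'] := pq; exists B'; apply: bounded_family_le hB' => a.
  rewrite !normrM ler_wpM2l // !ger0_norm ?exprn_ge0 ?le_min ?(ltW e20) ?(ltW q0) //.
  by rewrite lerXn2r // ?nnegrE ?le_min ?(ltW e20) ?(ltW q0) // ge_min lexx orbT.
move=> x Ox hx; rewrite he2 //; last by move=> i; have := hx i; rewrite lt_min => /andP [].
by apply: hphi => i; have := hx i; rewrite lt_min => /andP [].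
Qed.

End LocalSolution.

(** * Gluing *)

Section Gluing.
Variables (R : realType).

(** Connectedness: the interior [Z] of the zero set is relatively closed in [U] by
    [expansion_identity]. If all coefficients at [u] vanished, [Z] would contain the whole component
    of [u], hence the point where [H] is nonzero. *)
Lemma expansion_coef_neq0 n (U : set 'rV[R]_n) (H : 'rV[R]_n -> R) (u : 'rV[R]_n) (r : R) c :
  real_analytic_on U H -> (forall u, U u -> exists v, connected_component U u v /\ H v != 0) ->
  U u -> 0 < r -> expansion H u r c -> exists a, c a != 0.
Proof.
move=> hH hv Uu r0 hc; apply: contrapT => no.
have cz (c' : mindex n -> R) (x : 'rV[R]_n) (r' : R) : 0 < r' -> expansion H x r' c' ->
    (forall a, c' a = 0) -> nbhs x [set y | H y = 0].
  move=> r'0 hx c'0; apply/nbhs_boxP; exists r' => // y hy /=.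
  apply: sums_uniq (hx y hy) _; apply: eq_sums (sums0 R _) => a.
  by rewrite c'0 mul0r.
pose Z := [set y | H y = 0]^°.
have Zu : Z u.
  apply: (cz c u r r0 hc) => a; apply/eqP; apply/negP => /negP h.
  by apply: no; exists a.
have [v [Cv Hv]] := hv u Uu.
pose C := connected_component U u.
have E : C `&` Z = C.
  apply: (@component_connected _ U u).
  - by exists u; split=> //; exact: connected_component_refl.
  - by exists Z => //; exact: open_interior.
  exists (closure Z); first exact: closed_closure.
  apply/seteqP; split=> x [Cx Zx]; split=> //; first exact: subset_closure.
  have Ux : U x by apply: connected_component_sub Cx.
  have [r' [r'0 [c' hc']]] := hH x Ux.
  apply: (cz c' x r' r'0 hc'); apply: (expansion_identity r'0 hc') => q q0.
  have N : nbhs x [set y : 'rV[R]_n | forall i, `|y ord0 i - x ord0 i| < q].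
    by apply/nbhs_boxP; exists q.
  have [y [Zy hy]] := Zx _ N; exists y; split=> //.
have [_ Zv] : (C `&` Z) v by rewrite E.
by move/eqP: Hv; apply; exact: (interior_subset Zv).
Qed.

Lemma closure_interior_fat d (X : set 'rV[R]_d) : closed X ->
  (forall z, boundary X z -> exists Xz : set 'rV[R]_d, fat Xz /\ subanalytic Xz /\ Xz z /\ Xz `<=` X) ->
  X `<=` closure X^°.
Proof.
move=> cX hb z Xz; have [iz|niz] := pselect (X^° z); first exact: subset_closure.
have [Y [[_ [cY _]] [_ [Yz YX]]]] : exists Xz : set 'rV[R]_d, fat Xz /\ subanalytic Xz /\ Xz z /\ Xz `<=` X.
  by apply: hb; split=> //; apply: subset_closure.
rewrite -cY in Yz; move: z Yz {Xz niz}; apply: closure_subset.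
by move=> x; apply: filterS.
Qed.

Lemma local_extension d (U : set 'rV[R]_(d + 1)) (H : 'rV[R]_(d + 1) -> R)
    (X : set 'rV[R]_d) (f : 'rV[R]_d -> R) (z : 'rV[R]_d) :
  real_analytic_on U H -> (forall u, U u -> exists v, connected_component U u v /\ H v != 0) ->
  X `<=` closure X^° -> Cinf_on X f ->
  (forall x, X x -> U (row_mx x (f x)%:M) /\ H (row_mx x (f x)%:M) = 0) -> X z ->
  exists (q : R) (c : mindex d -> R), [/\ 0 < q, poly_bounded c q &
    forall x, X x -> (forall i, `|x ord0 i - z ord0 i| < q) ->
      sums (fun a => c a * monom a (x - z)) (f x)].
Proof.
move=> hH hv fatX sf hf Xz.
have [V [oV [Vz [F [sF Ff]]]]] := sf z Xz.
have [Uz _] := hf z Xz.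
have [r [r0 [c hc]]] := hH _ Uz.
have cn0 := expansion_coef_neq0 hH hv Uz r0 hc.
rewrite -(Ff z Vz Xz) in hc.
pose Om := X^° `&` V.
have oOm : open Om by apply: openI => //; exact: open_interior.
have OmV : Om `<=` V by move=> x [].
have near_Om (x : 'rV[R]_d) (P : set 'rV[R]_d) : V x -> X x -> nbhs x P -> exists2 u, Om u & P u.
  move=> Vx Xx Px.
  have N : nbhs x (V `&` P) by apply: filterI => //; apply: open_nbhs_nbhs.
  by have [u [Xu [Vu Pu]]] := fatX x Xx _ N; exists u.
have zOm (q : R) : 0 < q -> exists2 u : 'rV[R]_d, Om u & forall i, `|u ord0 i - z ord0 i| < q.
  move=> q0.
  have N : nbhs z [set u : 'rV[R]_d | forall i, `|u ord0 i - z ord0 i| < q].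
    by apply/nbhs_boxP; exists q.
  exact: (near_Om z _ Vz Xz N).
have HOm x : Om x -> H (row_mx x (F x)%:M) = 0.
  move=> [ix Vx]; have Xx := interior_subset ix.
  by rewrite Ff //; case: (hf x Xx).
have [q q0 [pb hsum]] := local_solution r0 hc cn0 oV sF Vz oOm OmV zOm HOm.
set p := taylor_coef F z in pb hsum.
have hphi : expansion (psum p z) z q p.
  exact: (expansion_psum (@real_summation_complete R) (ltW q0) pb).
have /nbhs_boxP [q1 q10 hq1] : nbhs z V by apply: open_nbhs_nbhs.
pose q2 := Num.min q q1.
have q20 : 0 < q2 by rewrite lt_min q0.
exists q2, p; split=> //.
  have [B hB] := pb; exists B; apply: bounded_family_le hB => a.
  rewrite !normrM ler_wpM2l // !ger0_norm ?exprn_ge0 ?(ltW q20) ?(ltW q0) //.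
  by rewrite lerXn2r // ?nnegrE ?(ltW q20) ?(ltW q0) // ge_min lexx.
move=> x Xx hx.
have Vx : V x by apply: hq1 => i; have := hx i; rewrite lt_min => /andP [].
have xq i : `|x ord0 i - z ord0 i| < q by have := hx i; rewrite lt_min => /andP [].
rewrite -(Ff x Vx Xx).
(* [local_solution] only reaches [Om]. A point of [X] in the box is a limit of points of [Om], and
   both [F] and the series are continuous there. *)
suff -> : F x = psum p z x by exact: hphi.
apply/eqP; rewrite -subr_eq0; apply/negPn/negP => ne.
have h1 : {for x, continuous (psum p z)} := expansion_continuous q0 hphi xq.
have [h2 _] := sF [::] x Vx.
have h3 : (fun w => F w - psum p z w) w @[w --> x] --> F x - psum p z x by exact: (cvgB h2 h1).
have ne0 : 0 < `|F x - psum p z x| by rewrite normr_gt0.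
have /(cvgrPdist_lt (FF := nbhs_filter x)) /(_ _ ne0) N1 := h3.
have N2 : nbhs x [set w : 'rV[R]_d | forall i, `|w ord0 i - z ord0 i| < q].
  have [g [g0 gq hg]] := finite_max_lt q0 (fun i => normr_ge0 (x ord0 i - z ord0 i)) xq.
  apply/nbhs_boxP; exists (q - g); first by rewrite subr_gt0.
  move=> w hw i.
  have -> : w ord0 i - z ord0 i = (w ord0 i - x ord0 i) + (x ord0 i - z ord0 i) by ring.
  apply: le_lt_trans (ler_normD _ _) _; rewrite -[q](subrK g).
  by apply: ltr_leD; [exact: hw | exact: hg].
have [u Ou [hu1 hu2]] := near_Om x _ Vx Xx (filterI N1 N2).
have E : F u = psum p z u by apply: sums_uniq (hsum u Ou hu2) (hphi u hu2).
by move: hu1; rewrite /= E subrr subr0 ltxx.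
Qed.

(** * Complexification and compatibility of the local series *)

Lemma cplx_ofM (x y : R) : cplx_of (x * y) = cplx_of x * cplx_of y.
Proof. by rewrite /cplx_of rmorphM. Qed.

Lemma cplx_ofB (x y : R) : cplx_of (x - y) = cplx_of x - cplx_of y.
Proof. by rewrite /cplx_of rmorphB. Qed.

Lemma cplx_ofD (x y : R) : cplx_of (x + y) = cplx_of x + cplx_of y.
Proof. by rewrite /cplx_of rmorphD. Qed.

Lemma cplx_ofX (x : R) n : cplx_of (x ^+ n) = cplx_of x ^+ n.
Proof. by rewrite /cplx_of rmorphXn. Qed.

Lemma cplx_of_nat n : cplx_of (n%:R : R) = n%:R.
Proof. by rewrite /cplx_of rmorph_nat. Qed.

Lemma cplx_of_prod (I : Type) (r : seq I) (F : I -> R) :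
  cplx_of (\prod_(i <- r) F i) = \prod_(i <- r) cplx_of (F i).
Proof. by rewrite /cplx_of rmorph_prod. Qed.

Variable d : nat.
Implicit Types (x z w : 'rV[R]_d) (c : mindex d -> R).

Lemma cvecB x z : cvec (x - z) = cvec x - cvec z.
Proof. by apply/rowP => i; rewrite !mxE cplx_ofB. Qed.

Lemma monom_cvec a x : monom a (cvec x) = cplx_of (monom a x).
Proof. by rewrite /monom cplx_of_prod; apply: eq_bigr => i _; rewrite mxE cplx_ofX. Qed.

Lemma poly_bounded_cplx c (q : R) : poly_bounded c q ->
  poly_bounded (fun a => cplx_of (c a)) (cplx_of q).
Proof.
move=> [B hB]; exists (cplx_of B) => S uS.
under eq_bigr do rewrite -cplx_ofX -cplx_ofM cplx_of_norm.
by rewrite -cplx_of_sum cplx_of_le hB.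
Qed.

Lemma shift_coef_cplx c (e q : R) x b : 0 < e -> 0 <= q ->
  (forall i, `|x ord0 i| + e <= q) -> poly_bounded c q ->
  shift_coef (fun a => cplx_of (c a)) (cvec x) b = cplx_of (shift_coef c x b).
Proof.
move=> e0 q0 hx hc.
have h1 := sums_cplx_of (sums_shift_coef (@real_summation_complete R) b e0 q0 hx hc).
have e0' : 0 < cplx_of e by rewrite (_ : 0 = cplx_of 0) // cplx_of_lt.
have q0' : 0 <= cplx_of q by rewrite (_ : 0 = cplx_of 0) // cplx_of_le.
have hx' i : `|(cvec x) ord0 i| + cplx_of e <= cplx_of q.
  by rewrite mxE cplx_of_norm -cplx_ofD cplx_of_le.
have h2 := sums_shift_coef (@complex_summation_complete R) b e0' q0' hx' (poly_bounded_cplx hc).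
apply: sums_uniq h2 _; apply: eq_sums h1 => a.
rewrite /shift_term cplx_ofM cplx_of_prod; congr (_ * _); apply: eq_bigr => i _.
by rewrite cplx_ofM cplx_of_nat cplx_ofX mxE.
Qed.

(** Both series represent [f] on the part of the interior of [X] near [w], so their difference at
    [w] vanishes on open sets accumulating at [w]. Agreement of the real coefficients is what
    transfers to the complex series. *)
Lemma local_expansions_agree (X : set 'rV[R]_d) f z w (qz qw e : R) cz cw :
  X `<=` closure X^° -> X w -> 0 < qz -> 0 < qw -> poly_bounded cz qz -> poly_bounded cw qw ->
  (forall x, X x -> (forall i, `|x ord0 i - z ord0 i| < qz) -> sums (fun a => cz a * monom a (x - z)) (f x)) ->
  (forall x, X x -> (forall i, `|x ord0 i - w ord0 i| < qw) -> sums (fun a => cw a * monom a (x - w)) (f x)) ->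
  0 <= e -> e < qz -> (forall i, `|w ord0 i - z ord0 i| <= e) ->
  forall a, shift_coef cz (w - z) a = cw a.
Proof.
move=> fatX Xw qz0 qw0 bz bw hz hw e0 eqz hwz.
have Ez : expansion (psum cz z) z qz cz.
  exact: (expansion_psum (@real_summation_complete R) (ltW qz0) bz).
have Ew : expansion (psum cw w) w qw cw.
  exact: (expansion_psum (@real_summation_complete R) (ltW qw0) bw).
have Es := expansion_shift (@real_summation_complete R) e0 eqz Ez hwz.
pose t := Num.min (qz - e) qw.
have t0 : 0 < t by rewrite lt_min subr_gt0 eqz.
have ED : expansion (fun y => psum cz z y - psum cw w y) w t
    (fun a => shift_coef cz (w - z) a - cw a).
  move=> y hy.
  have hy1 i : `|y ord0 i - w ord0 i| < qz - e by have := hy i; rewrite lt_min => /andP [].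
  have hy2 i : `|y ord0 i - w ord0 i| < qw by have := hy i; rewrite lt_min => /andP [].
  by apply: eq_sums (sumsB (Es y hy1) (Ew y hy2)) => a; rewrite mulrBl.
suff h a : shift_coef cz (w - z) a - cw a = 0 by move=> a; apply/eqP; rewrite -subr_eq0 h.
apply: (expansion_identity t0 ED) => q q0.
pose g := Num.min q t; have g0 : 0 < g by rewrite lt_min q0.
have N : nbhs w [set y : 'rV[R]_d | forall i, `|y ord0 i - w ord0 i| < g].
  by apply/nbhs_boxP; exists g.
have [u [iu hu]] := fatX w Xw _ N; exists u; split.
  by move=> i; apply: lt_le_trans (hu i) _; rewrite ge_min lexx.
have [g' [g'0 g'g hg']] := finite_max_lt g0 (fun i => normr_ge0 (u ord0 i - w ord0 i)) hu.
have N2 : nbhs u [set y : 'rV[R]_d | forall i, `|y ord0 i - w ord0 i| < g].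
  apply/nbhs_boxP; exists (g - g'); first by rewrite subr_gt0.
  move=> y hy i.
  have -> : y ord0 i - w ord0 i = (y ord0 i - u ord0 i) + (u ord0 i - w ord0 i) by ring.
  apply: le_lt_trans (ler_normD _ _) _; rewrite -[g](subrK g').
  by apply: ltr_leD; [exact: hy | exact: hg'].
have N3 : nbhs u X by exact: iu.
apply: filterS (filterI N2 N3) => y [hy Xy].
have yt i : `|y ord0 i - w ord0 i| < t by apply: lt_le_trans (hy i) _; rewrite ge_min lexx orbT.
have yw i : `|y ord0 i - w ord0 i| < qw by have := yt i; rewrite lt_min => /andP [].
have yz i : `|y ord0 i - z ord0 i| < qz.
  have -> : y ord0 i - z ord0 i = (y ord0 i - w ord0 i) + (w ord0 i - z ord0 i) by ring.
  apply: le_lt_trans (ler_normD _ _) _; rewrite -[qz](subrK e); apply: ltr_leD => //.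
  by have := yt i; rewrite lt_min => /andP [].
by rewrite (sums_uniq (Ez y yz) (hz y Xy yz)) (sums_uniq (Ew y yw) (hw y Xy yw)) subrr.
Qed.

End Gluing.

Theorem theorem9p1 (R : realType) (d : nat)
    (U : set 'rV[R]_(d + 1)) (H : 'rV[R]_(d + 1) -> R)
    (X : set 'rV[R]_d) (f : 'rV[R]_d -> R) :
  open U ->
  real_analytic_on U H ->
  (* H is not identically zero (on any connected component of U) *)
  (forall u, U u -> exists v, connected_component U u v /\ H v != 0) ->
  closed X ->
  (forall z, boundary X z ->
     exists Xz : set 'rV[R]_d, fat Xz /\ subanalytic Xz /\ Xz z /\ Xz `<=` X) ->
  Cinf_on X f ->
  (forall x, X x -> U (row_mx x (f x)%:M) /\ H (row_mx x (f x)%:M) = 0) ->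
  exists (W : set 'rV[Cplx R]_d) (G : 'rV[Cplx R]_d -> Cplx R),
    open W /\ (forall x, X x -> W (cvec x)) /\
    holomorphic_on W G /\
    (forall x, X x -> G (cvec x) = cplx_of (f x)).
Proof.
move=> oU hH hv cX hb sf hf.
have fatX := closure_interior_fat cX hb.
pose good (z : 'rV[R]_d) (qc : R * (mindex d -> R)) := [/\ 0 < qc.1, poly_bounded qc.2 qc.1 &
  forall x, X x -> (forall i, `|x ord0 i - z ord0 i| < qc.1) ->
    sums (fun a => qc.2 a * monom a (x - z)) (f x)].
(* A dummy pair is used outside [X], so that [choice] applies to all [z]. *)
have ex z : exists qc, X z -> good z qc.
  have [Xz|nX] := pselect (X z); last by exists (0, fun=> 0).
  by have [q [c h]] := local_extension hH hv fatX sf hf Xz; exists (q, c).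
have [qc hqc] := choice ex.
pose q z := (qc z).1; pose c z := (qc z).2.
have q0 z : X z -> 0 < q z by move=> /hqc [].
have cb z : X z -> poly_bounded (c z) (q z) by move=> /hqc [].
have cf z : X z -> forall x, X x -> (forall i, `|x ord0 i - z ord0 i| < q z) ->
    sums (fun a => c z a * monom a (x - z)) (f x) by move=> /hqc [].
have pos (t : R) : (0 < cplx_of t) = (0 < t) by rewrite -cplx_of_lt.
have nneg (t : R) : (0 <= cplx_of t) = (0 <= t) by rewrite -cplx_of_le.
pose C := @complex_summation_complete R.
pose Phi z := psum (fun a => cplx_of (c z a)) (cvec z).
have hPhi z : X z -> expansion (Phi z) (cvec z) (cplx_of (q z)) (fun a => cplx_of (c z a)).
  move=> Xz; apply: (expansion_psum C); first by rewrite nneg ltW // q0.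
  by apply: poly_bounded_cplx; apply: cb.
(* With a quarter of the radius, two polydiscs that meet have centres within half the larger radius
   [q z]; the smaller one then lies where the series at [z], re-expanded at the other centre,
   converges. *)
pose D z : set 'rV[Cplx R]_d :=
  [set x | forall i, `|x ord0 i - cvec z ord0 i| < cplx_of (q z / 4)].
have agree_le z w x : X z -> X w -> D z x -> D w x -> q w <= q z -> Phi z x = Phi w x.
  move=> Xz Xw Dz Dw qwz; have qz := q0 z Xz; have qw := q0 w Xw.
  have wz i : `|w ord0 i - z ord0 i| <= q z / 2.
    rewrite -cplx_of_le -cplx_of_norm cplx_ofB.
    have -> : cplx_of (w ord0 i) - cplx_of (z ord0 i) =
        (x ord0 i - cvec z ord0 i) - (x ord0 i - cvec w ord0 i) by rewrite !mxE; ring.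
    apply: le_trans (ler_normB _ _) _.
    apply: le_trans (lerD (ltW (Dz i)) (ltW (Dw i))) _.
    by rewrite -cplx_ofD cplx_of_le; lra.
  have qz2 : 0 <= q z / 2 by lra.
  have qz2q : q z / 2 < q z by lra.
  have coefE a : shift_coef (fun a => cplx_of (c z a)) (cvec w - cvec z) a = cplx_of (c w a).
    rewrite -cvecB (@shift_coef_cplx _ _ _ (q z / 2) (q z)) ?(ltW qz) //.
    - congr cplx_of.
      exact: (local_expansions_agree fatX Xw qz qw (cb z Xz) (cb w Xw) (cf z Xz) (cf w Xw) qz2 qz2q wz).
    - by lra.
    - by move=> i; rewrite !mxE; have := wz i; lra.
    - exact: cb.
  have wz' i : `|cvec w ord0 i - cvec z ord0 i| <= cplx_of (q z / 2).
    by rewrite !mxE -cplx_ofB cplx_of_norm cplx_of_le.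
  have h1 := expansion_shift C (_ : 0 <= cplx_of (q z / 2)) (_ : _ < cplx_of (q z)) (hPhi z Xz) wz'.
  have {}h1 := h1 (eq_ind_r is_true qz2 (nneg _)).
  have {}h1 := h1 (eq_ind_r is_true qz2q (cplx_of_lt _ _)).
  have h2 : sums (fun a => cplx_of (c w a) * monom a (x - cvec w)) (Phi z x).
    apply: eq_sums (h1 x _) => [a|i]; first by rewrite coefE.
    by apply: lt_le_trans (Dw i) _; rewrite -cplx_ofB cplx_of_le; lra.
  apply: sums_uniq h2 _; apply: hPhi => // i.
  by apply: lt_le_trans (Dw i) _; rewrite cplx_of_le; lra.
have agree z w x : X z -> X w -> D z x -> D w x -> Phi z x = Phi w x.
  move=> Xz Xw Dz Dw; have [le|lt] := leP (q w) (q z); first exact: agree_le.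
  by apply/esym; apply: agree_le => //; apply: ltW.
(* Any centre whose polydisc contains [x] will do: by [agree] the value of [G] does not depend on
   the choice. *)
pose pt x := xget 0 [set z | X z /\ D z x].
pose G x := Phi (pt x) x.
have GE z x : X z -> D z x -> G x = Phi z x.
  move=> Xz Dz; have [Xp Dp] : X (pt x) /\ D (pt x) x.
    exact: (@xgetI _ 0 [set z | X z /\ D z x] z (conj Xz Dz)).
  exact: agree.
have inner z x : X z -> D z x -> exists g : Cplx R, [/\ 0 <= g, g < cplx_of (q z / 4) &
    forall i, `|x ord0 i - cvec z ord0 i| <= g].
  move=> Xz Dz; apply: finite_max_lt => //.
  by rewrite pos; have := q0 z Xz; lra.
have Dball z (x : 'rV[Cplx R]_d) (g : Cplx R) : g < cplx_of (q z / 4) -> (forall i, `|x ord0 i - cvec z ord0 i| <= g) ->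
    forall y : 'rV[Cplx R]_d, (forall i, `|y ord0 i - x ord0 i| < cplx_of (q z / 4) - g) -> D z y.
  move=> gq hg y hy i.
  have -> : y ord0 i - cvec z ord0 i = (y ord0 i - x ord0 i) + (x ord0 i - cvec z ord0 i) by ring.
  apply: le_lt_trans (ler_normD _ _) _; rewrite -[cplx_of _](subrK g).
  by apply: ltr_leD.
exists [set x | exists2 z, X z & D z x], G; split; last split; last split.
- rewrite openE => x [z Xz Dz]; have [g [g0 gq hg]] := inner z x Xz Dz.
  apply/nbhs_boxP; exists (cplx_of (q z / 4) - g); first by rewrite subr_gt0.
  by move=> y hy; exists z => //; apply: Dball hy.
- move=> x Xx; exists x => // i; rewrite subrr normr0 pos.
  by have := q0 x Xx; lra.
- move=> x [z Xz Dz]; have [g [g0 gq hg]] := inner z x Xz Dz.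
  have qz := q0 z Xz.
  have gq' : g < cplx_of (q z) by apply: lt_le_trans gq _; rewrite cplx_of_le; lra.
  exists (cplx_of (q z / 4) - g); split; first by rewrite subr_gt0.
  exists (shift_coef (fun a => cplx_of (c z a)) (x - cvec z)) => y hy.
  rewrite (GE z y Xz (Dball z x g gq hg y hy)).
  apply: (expansion_shift C g0 gq' (hPhi z Xz) hg) => i.
  by apply: lt_le_trans (hy i) _; rewrite lerD2r cplx_of_le; lra.
move=> x Xx.
have qx := q0 x Xx.
have Dx : D x (cvec x) by move=> i; rewrite subrr normr0 pos; lra.
rewrite (GE x _ Xx Dx).
have h1 : sums (fun a => c x a * monom a (x - x)) (f x).
  by apply: cf => // i; rewrite subrr normr0.
apply: sums_uniq (hPhi x Xx (cvec x) _) _.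
  by move=> i; rewrite subrr normr0 pos.
apply: eq_sums (sums_cplx_of h1) => a.
by rewrite -cvecB monom_cvec cplx_ofM.
Qed.
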